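(* Let $f(z)=z+a_2z^2+a_3z^3+\cdots\in\mathcal{C}_{\arcsin}$. Then the second Hankel determinant $H_{2,2}(f)=a_2a_4-a_3^2$ satisfies $$|H_{2,2}(f)|\le \frac{1}{9\pi^2}.$$ The inequality is sharp, i.e. there is a function in $\mathcal{C}_{\arcsin}$ for which equality holds.
   Context: Let $\Omega=\{z\in\mathbb{C}:|z|<1\}$. Let $\mathcal{A}$ be the family of analytic functions $f$ in $\Omega$ normalized by $f(z)=z+\sum_{n=2}^{\infty}a_nz^n$, and let $\mathcal{S}\subset\mathcal{A}$ be the subclass of univalent functions. A Schwarz function is an analytic $\omega:\Omega\to\mathbb{C}$ with $\omega(0)=0$ and $|\omega(z)|\le 1$ on $\Omega$. For analytic $g,h$ in $\Omega$, $g\prec h$ (subordination) means that there is a Schwarz function $\omega$ with $g(z)=h(\omega(z))$ for all $z\in\Omega$. With $\arcsin$ the principal branch ($\arcsin 0=0$), define $$\mathcal{C}_{\arcsin}=\left\{f\in\mathcal{S}:\ 1+\frac{zf''(z)}{f'(z)}\prec 1+\frac{2}{\pi}\arcsin z \text{ in } \Omega\right\}.$$ *)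

(* Defs.v *)
From Stdlib Require Import Reals Lra.
From Coquelicot Require Import Coquelicot.
Open Scope R_scope.

Definition unit_disk (z : C) : Prop := Cmod z < 1.

(* [C] also carries a real normed-module structure in Coquelicot; the scalar
   field is given explicitly so that this is complex differentiability. *)
Definition analytic_in_disk (f : C -> C) : Prop :=
  forall z : C, unit_disk z -> @ex_derive C_AbsRing C_NormedModule f z.

Definition has_expansion (f : C -> C) (a : nat -> C) : Prop :=
  forall z : C, unit_disk z -> @is_pseries C_AbsRing C_NormedModule a z (f z).

Definition normalized_expansion (f : C -> C) (a : nat -> C) : Prop :=
  a 0%nat = RtoC 0 /\ a 1%nat = RtoC 1 /\ has_expansion f a.

Definition class_A (f : C -> C) : Prop :=
  analytic_in_disk f /\ exists a : nat -> C, normalized_expansion f a.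

Definition univalent_in_disk (f : C -> C) : Prop :=
  forall z w : C, unit_disk z -> unit_disk w -> f z = f w -> z = w.

Definition class_S (f : C -> C) : Prop := class_A f /\ univalent_in_disk f.

Definition schwarz (w : C -> C) : Prop :=
  analytic_in_disk w /\ w (RtoC 0) = RtoC 0 /\
  forall z : C, unit_disk z -> Cmod (w z) <= 1.

Definition subordinate (g h : C -> C) : Prop :=
  exists w : C -> C, schwarz w /\
    forall z : C, unit_disk z -> g z = h (w z).

(* Principal argument, in (-PI, PI]; the value at 0 is irrelevant. *)
Definition Carg (z : C) : R :=
  if Rle_dec 0 (Im z) then acos (Re z / Cmod z) else - acos (Re z / Cmod z).

Definition Clog (z : C) : C := (ln (Cmod z), Carg z).

Definition Csqrt (z : C) : C :=
  Cmult (RtoC (sqrt (Cmod z))) (cos (Carg z / 2), sin (Carg z / 2)).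

(* Principal branch: - i Log (i z + sqrt (1 - z^2)). *)
Definition Carcsin (z : C) : C :=
  (- (Ci * Clog (Ci * z + Csqrt (1 - z * z))))%C.

Definition class_C_arcsin (f : C -> C) : Prop :=
  class_S f /\
  subordinate
    (fun z : C => (1 + z * C_derive (C_derive f) z / C_derive f z)%C)
    (fun z : C => (1 + RtoC (2 / PI) * Carcsin z)%C).

(* The second Hankel determinant H_{2,2}, in terms of the coefficients. *)
Definition hankel22 (a : nat -> C) : C :=
  (a 2%nat * a 4%nat - a 3%nat * a 3%nat)%C.

(* Main.v *)
Require Import Defs.
From Stdlib Require Import Reals Lra Lia Psatz Arith.
From Coquelicot Require Import Coquelicot.
Open Scope R_scope.

(* Write [1 + z f''/f' = 1 + (2/PI) arcsin w] with [w] a Schwarz function, and let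
   [c1, c2, c3] be its first coefficients. Then [a2 a4 - a3^2 = X / (18 PI^2)] with
   [X = 3 c1 c3 - 2 c2^2 + (b/2) c1^2 c2 + ((1 - b^2)/2) c1^4] and [b = 2/PI], and
   [|X| <= 2] follows from [|c2| <= D] and [|c3|^2 <= D (D - |c2|^2)], [D = 1 - |c1|^2].
   These are instances of the contractivity of the Toeplitz matrix of [w], obtained
   from the mean value property on circles. Cauchy's theorem for functions that are
   merely differentiable is avoided: since [arcsin w] is bounded, [f'] has no zero by
   Gronwall's inequality, so [w = sin ((PI/2) z f''/f')] has a continuous derivative
   because [f] is a power series.

   Equality forces [w = z^2], that is, [f' = exp (int (2/PI) arcsin (z^2) / z)]. The
   coefficients of [f'] are nonnegative with sum at most 2, so [Re f' > 0] and [f] is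
   univalent. *)

(** * Complex derivatives *)

(** The two halves need the principal arcsine to different depths. For the bound,
    [csin (Carcsin w) = w] holds for every [w], whichever root and logarithm the formula selects,
    and boundedness of [Carcsin] on the closed disk is the only other fact used. For the extremal
    function the branch itself must be identified, through conditions on real parts that are
    propagated from the origin by connectedness. Division is total: at a zero of [f'] the quotient
    [z f''/f'] has the conventional value 0 and does not control [f'']. Hence the nonvanishing of
    [f'] has to be settled before [w] can be recovered from [f]. The coefficients [c1, c2, c3] never
    come from a power series of [w]. They are those of a cubic that approximates [w] up to O(z^4),
    which is stable under products and under composition with the sine. The price is a factor
    [1/z^3] in the contractivity argument; it is harmless because the mean value property is proved
    on the punctured disk and only a limit at the center is required. The limits r -> 1 are replaced
    by an inequality of Bernoulli type. *)

Definition ccont (f : C -> C) (z : C) : Prop :=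
  forall eps : R, 0 < eps -> exists d : R, 0 < d /\
    forall w : C, Cmod (w - z) < d -> Cmod (f w - f z) < eps.

(* Caratheodory's form of the complex derivative: [d] is the value at [z] of a
   difference quotient that extends continuously to [z]. *)
Definition cder (f : C -> C) (z d : C) : Prop :=
  exists phi : C -> C, ccont phi z /\ phi z = d /\
    forall w : C, f w = (f z + phi w * (w - z))%C.

Lemma Cmod_minus_sym (z w : C) : Cmod (z - w) = Cmod (w - z).
Proof. rewrite <- (Cmod_opp (z - w)). f_equal. ring. Qed.

Lemma Cmod_minus_ge (z w : C) : Cmod z - Cmod w <= Cmod (z - w).
Proof.
  assert (H := Cmod_triangle (z - w) w).
  replace (z - w + w)%C with z in H by ring. lra.
Qed.

Lemma ccont_const (c z : C) : ccont (fun _ => c) z.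
Proof.
  intros e He. exists 1. split; [lra|]. intros w _.
  replace (c - c)%C with (RtoC 0) by ring. rewrite Cmod_0. exact He.
Qed.

Lemma ccont_id (z : C) : ccont (fun w => w) z.
Proof. intros e He. exists e. split; [lra|]. intros w Hw. exact Hw. Qed.

Lemma ccont_plus (f g : C -> C) (z : C) :
  ccont f z -> ccont g z -> ccont (fun w => (f w + g w)%C) z.
Proof.
  intros Hf Hg e He.
  destruct (Hf (e / 2)) as [d1 [Hd1 H1]]; [lra|].
  destruct (Hg (e / 2)) as [d2 [Hd2 H2]]; [lra|].
  exists (Rmin d1 d2). split; [apply Rmin_pos; assumption|]. intros w Hw.
  assert (Hw1 := H1 w (Rlt_le_trans _ _ _ Hw (Rmin_l _ _))).
  assert (Hw2 := H2 w (Rlt_le_trans _ _ _ Hw (Rmin_r _ _))).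
  replace (f w + g w - (f z + g z))%C with ((f w - f z) + (g w - g z))%C by ring.
  apply Rle_lt_trans with (1 := Cmod_triangle _ _). lra.
Qed.

Lemma ccont_mult (f g : C -> C) (z : C) :
  ccont f z -> ccont g z -> ccont (fun w => (f w * g w)%C) z.
Proof.
  intros Hf Hg e He.
  assert (Hfz := Cmod_ge_0 (f z)). assert (Hgz := Cmod_ge_0 (g z)).
  set (m := Cmod (f z) + Cmod (g z) + 1).
  assert (Hm : 1 <= m) by (unfold m; lra).
  set (e1 := Rmin 1 (e / (2 * m))).
  assert (He1 : 0 < e1).
  { apply Rmin_pos; [lra|]. apply Rdiv_lt_0_compat; lra. }
  assert (He1m : e1 * m <= e / 2).
  { apply Rle_trans with (e / (2 * m) * m).
    - apply Rmult_le_compat_r; [lra|apply Rmin_r].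
    - right. field. lra. }
  assert (He11 : e1 <= 1) by apply Rmin_l.
  destruct (Hf e1 He1) as [d1 [Hd1 H1]].
  destruct (Hg e1 He1) as [d2 [Hd2 H2]].
  exists (Rmin d1 d2). split; [apply Rmin_pos; assumption|]. intros w Hw.
  assert (Hw1 := H1 w (Rlt_le_trans _ _ _ Hw (Rmin_l _ _))).
  assert (Hw2 := H2 w (Rlt_le_trans _ _ _ Hw (Rmin_r _ _))).
  replace (f w * g w - (f z * g z))%C
    with ((f w - f z) * (g w - g z) + (f z * (g w - g z) + (f w - f z) * g z))%C by ring.
  apply Rle_lt_trans with (1 := Cmod_triangle _ _).
  apply Rle_lt_trans with
    (Cmod ((f w - f z) * (g w - g z)) +
     (Cmod (f z * (g w - g z)) + Cmod ((f w - f z) * g z))).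
  { apply Rplus_le_compat_l, Cmod_triangle. }
  rewrite !Cmod_mult.
  assert (Hp1 := Cmod_ge_0 (f w - f z)). assert (Hp2 := Cmod_ge_0 (g w - g z)).
  unfold m in *. nra.
Qed.

Lemma ccont_opp (f : C -> C) (z : C) : ccont f z -> ccont (fun w => (- f w)%C) z.
Proof.
  intros Hf e He. destruct (Hf e He) as [d [Hd H]]. exists d. split; [exact Hd|].
  intros w Hw. replace (- f w - - f z)%C with (- (f w - f z))%C by ring.
  rewrite Cmod_opp. auto.
Qed.

Lemma ccont_neq_0 (f : C -> C) (z : C) : ccont f z -> f z <> 0 ->
  exists d : R, 0 < d /\ forall w, Cmod (w - z) < d -> Cmod (f z) / 2 < Cmod (f w).
Proof.
  intros Hf Hz. assert (Hp := proj1 (Cmod_gt_0 _) Hz).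
  destruct (Hf (Cmod (f z) / 2)) as [d [Hd H]]; [lra|].
  exists d. split; [exact Hd|]. intros w Hw. specialize (H w Hw).
  assert (H' := Cmod_minus_ge (f z) (f w)). rewrite Cmod_minus_sym in H'. lra.
Qed.

Lemma Cinv_0 : (/ 0)%C = 0.
Proof. unfold Cinv; simpl. apply injective_projections; simpl; unfold Rdiv; ring. Qed.

Lemma ccont_inv (f : C -> C) (z : C) :
  ccont f z -> f z <> 0 -> ccont (fun w => (/ f w)%C) z.
Proof.
  intros Hf Hz e He. assert (Hp := proj1 (Cmod_gt_0 _) Hz).
  set (m := Cmod (f z)) in *.
  destruct (ccont_neq_0 f z Hf Hz) as [d1 [Hd1 H1]]. fold m in H1.
  destruct (Hf (e * (m * m / 2))) as [d2 [Hd2 H2]].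
  { apply Rmult_lt_0_compat; nra. }
  exists (Rmin d1 d2). split; [apply Rmin_pos; assumption|]. intros w Hw.
  assert (Hw1 := H1 w (Rlt_le_trans _ _ _ Hw (Rmin_l _ _))).
  assert (Hw2 := H2 w (Rlt_le_trans _ _ _ Hw (Rmin_r _ _))).
  assert (Hwn : f w <> 0). { apply Cmod_gt_0. lra. }
  replace (/ f w - / f z)%C with (- (f w - f z) / (f w * f z))%C
    by (field; split; assumption).
  rewrite Cmod_div by (apply Cmult_neq_0; assumption).
  rewrite Cmod_opp, Cmod_mult. fold m.
  assert (Hq : 0 < Cmod (f w) * m) by nra.
  apply Rmult_lt_reg_r with (Cmod (f w) * m); [exact Hq|].
  unfold Rdiv. rewrite Rmult_assoc, Rinv_l, Rmult_1_r by lra.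
  apply Rlt_le_trans with (1 := Hw2). apply Rmult_le_compat_l; [lra|]. nra.
Qed.

Lemma ccont_comp (f g : C -> C) (z : C) :
  ccont g z -> ccont f (g z) -> ccont (fun w => f (g w)) z.
Proof.
  intros Hg Hf e He. destruct (Hf e He) as [d [Hd H]].
  destruct (Hg d Hd) as [d' [Hd' H']]. exists d'. split; auto.
Qed.

Lemma ccont_ext_loc (f g : C -> C) (z : C) :
  (exists d, 0 < d /\ forall w, Cmod (w - z) < d -> f w = g w) -> ccont f z -> ccont g z.
Proof.
  intros [d1 [Hd1 H1]] Hf e He. destruct (Hf e He) as [d [Hd H]].
  exists (Rmin d1 d). split; [apply Rmin_pos; assumption|]. intros w Hw.
  rewrite <- H1 by (apply Rlt_le_trans with (1 := Hw), Rmin_l).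
  rewrite <- H1. { apply H. apply Rlt_le_trans with (1 := Hw), Rmin_r. }
  replace (z - z)%C with (RtoC 0) by ring. rewrite Cmod_0. exact Hd1.
Qed.

Lemma cder_ccont (f : C -> C) (z d : C) : cder f z d -> ccont f z.
Proof.
  intros [phi [H1 [H2 H3]]].
  assert (H : ccont (fun w => (f z + phi w * (w + - z))%C) z).
  { apply ccont_plus; [apply ccont_const|]. apply ccont_mult; [exact H1|].
    apply ccont_plus; [apply ccont_id|apply ccont_const]. }
  apply ccont_ext_loc with (2 := H). exists 1. split; [lra|].
  intros w _. rewrite (H3 w). reflexivity.
Qed.

Lemma cder_const (c z : C) : cder (fun _ => c) z 0.
Proof.
  exists (fun _ => RtoC 0). split; [apply ccont_const|]. split; [reflexivity|].
  intros w. ring.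
Qed.

Lemma cder_id (z : C) : cder (fun w => w) z 1.
Proof.
  exists (fun _ => RtoC 1). split; [apply ccont_const|]. split; [reflexivity|].
  intros w. ring.
Qed.

Lemma cder_eq (f : C -> C) (z d d' : C) : cder f z d -> d = d' -> cder f z d'.
Proof. intros H <-. exact H. Qed.

Lemma cder_plus (f g : C -> C) (z df dg : C) :
  cder f z df -> cder g z dg -> cder (fun w => (f w + g w)%C) z (df + dg)%C.
Proof.
  intros [p [P1 [P2 P3]]] [q [Q1 [Q2 Q3]]].
  exists (fun w => (p w + q w)%C). split; [apply ccont_plus; assumption|].
  split; [congruence|]. intros w. rewrite (P3 w), (Q3 w). ring.
Qed.

Lemma cder_opp (f : C -> C) (z df : C) :
  cder f z df -> cder (fun w => (- f w)%C) z (- df)%C.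
Proof.
  intros [p [P1 [P2 P3]]].
  exists (fun w => (- p w)%C). split; [apply ccont_opp; assumption|].
  split; [congruence|]. intros w. rewrite (P3 w). ring.
Qed.

Lemma cder_minus (f g : C -> C) (z df dg : C) :
  cder f z df -> cder g z dg -> cder (fun w => (f w - g w)%C) z (df - dg)%C.
Proof. intros Hf Hg. apply cder_plus; [exact Hf|]. apply cder_opp, Hg. Qed.

Lemma cder_mult (f g : C -> C) (z df dg : C) :
  cder f z df -> cder g z dg ->
  cder (fun w => (f w * g w)%C) z (df * g z + f z * dg)%C.
Proof.
  intros Hf Hg. assert (Cg := cder_ccont _ _ _ Hg).
  destruct Hf as [p [P1 [P2 P3]]]. destruct Hg as [q [Q1 [Q2 Q3]]].
  exists (fun w => (p w * g w + f z * q w)%C). split.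
  { apply ccont_plus; apply ccont_mult; try assumption. apply ccont_const. }
  split; [congruence|]. intros w. rewrite (P3 w), (Q3 w). ring.
Qed.

Lemma cder_scal (c : C) (f : C -> C) (z df : C) :
  cder f z df -> cder (fun w => (c * f w)%C) z (c * df)%C.
Proof.
  intros Hf. apply cder_eq with (1 := cder_mult _ _ _ _ _ (cder_const c z) Hf). ring.
Qed.

Lemma cder_comp (f g : C -> C) (z df dg : C) :
  cder g z dg -> cder f (g z) df -> cder (fun w => f (g w)) z (df * dg)%C.
Proof.
  intros Hg [p [P1 [P2 P3]]]. assert (Cg := cder_ccont _ _ _ Hg).
  destruct Hg as [q [Q1 [Q2 Q3]]].
  exists (fun w => (p (g w) * q w)%C). split.
  { apply ccont_mult; [|assumption]. apply ccont_comp; assumption. }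
  split; [congruence|]. intros w. rewrite (P3 (g w)).
  assert (E : (g w - g z = q w * (w - z))%C) by (rewrite (Q3 w); ring).
  rewrite E. ring.
Qed.

Lemma cder_Cinv (z : C) : z <> 0 -> cder Cinv z (- / (z * z))%C.
Proof.
  intros Hz.
  (* The slope has to be right at every [w], also far from [z]. At [w = 0], where [/ 0] is 0, it is
     (0 - 1/z)/(0 - z) = 1/z^2. *)
  exists (fun w => if Ceq_dec w 0 then (/ (z * z))%C else (- / (w * z))%C).
  split; [|split].
  - apply ccont_ext_loc with (fun w => (- / (w * z))%C).
    { destruct (ccont_neq_0 (fun w => w) z (ccont_id z) Hz) as [d [Hd H]].
      exists d. split; [exact Hd|]. intros w Hw. specialize (H w Hw).
      destruct (Ceq_dec w 0) as [->|_]; [|reflexivity].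
      rewrite Cmod_0 in H. assert (H0 := Cmod_ge_0 z). lra. }
    apply ccont_opp. apply (ccont_inv (fun w => (w * z)%C)).
    + apply ccont_mult; [apply ccont_id|apply ccont_const].
    + apply Cmult_neq_0; exact Hz.
  - destruct (Ceq_dec z 0) as [->|_]; [now elim Hz|reflexivity].
  - intros w. destruct (Ceq_dec w 0) as [->|n].
    + rewrite Cinv_0. field. exact Hz.
    + field. split; assumption.
Qed.

Lemma cder_inv (f : C -> C) (z df : C) :
  cder f z df -> f z <> 0 -> cder (fun w => (/ f w)%C) z (- df / (f z * f z))%C.
Proof.
  intros Hf Hn. apply cder_eq with (1 := cder_comp _ _ _ _ _ Hf (cder_Cinv _ Hn)).
  field. exact Hn.
Qed.

Lemma Cminus_diag_eq (z : C) : (z - z)%C = 0.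
Proof. ring. Qed.

Lemma cder_intro (f : C -> C) (z d : C) :
  (forall eps, 0 < eps -> exists dl, 0 < dl /\ forall w, Cmod (w - z) < dl ->
     Cmod (f w - f z - d * (w - z)) <= eps * Cmod (w - z)) ->
  cder f z d.
Proof.
  intros H.
  exists (fun w => if Ceq_dec w z then d else ((f w - f z) / (w - z))%C).
  split; [|split].
  - intros e He. destruct (H (e / 2)) as [dl [Hdl H']]; [lra|].
    exists dl. split; [exact Hdl|]. intros w Hw.
    destruct (Ceq_dec z z) as [_|n]; [|now elim n].
    destruct (Ceq_dec w z) as [->|n].
    { rewrite Cminus_diag_eq, Cmod_0. exact He. }
    assert (Hn := Cminus_eq_contra _ _ n).
    assert (Hp := proj1 (Cmod_gt_0 _) Hn).
    replace ((f w - f z) / (w - z) - d)%C with ((f w - f z - d * (w - z)) / (w - z))%C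
      by (field; exact Hn).
    rewrite Cmod_div by exact Hn.
    apply Rle_lt_trans with (e / 2); [|lra].
    apply Rmult_le_reg_r with (Cmod (w - z)); [exact Hp|].
    unfold Rdiv at 1. rewrite Rmult_assoc, Rinv_l, Rmult_1_r by lra. auto.
  - destruct (Ceq_dec z z) as [_|n]; [reflexivity|now elim n].
  - intros w. destruct (Ceq_dec w z) as [->|n]; [ring|].
    field. exact (Cminus_eq_contra _ _ n).
Qed.

Lemma cder_elim (f : C -> C) (z d : C) :
  cder f z d ->
  (forall eps, 0 < eps -> exists dl, 0 < dl /\ forall w, Cmod (w - z) < dl ->
     Cmod (f w - f z - d * (w - z)) <= eps * Cmod (w - z)).
Proof.
  intros [p [P1 [P2 P3]]] e He. destruct (P1 e He) as [dl [Hdl H]].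
  exists dl. split; [exact Hdl|]. intros w Hw. specialize (H w Hw).
  rewrite (P3 w). replace (f z + p w * (w - z) - f z - d * (w - z))%C
    with ((p w - p z) * (w - z))%C by (rewrite <- P2; ring).
  rewrite Cmod_mult. apply Rmult_le_compat_r; [apply Cmod_ge_0|lra].
Qed.

Lemma cder_ext_loc (f g : C -> C) (z d : C) :
  (exists dl, 0 < dl /\ forall w, Cmod (w - z) < dl -> f w = g w) ->
  cder f z d -> cder g z d.
Proof.
  intros [d1 [Hd1 H1]] Hf. apply cder_intro. intros e He.
  destruct (cder_elim _ _ _ Hf e He) as [d2 [Hd2 H2]].
  exists (Rmin d1 d2). split; [apply Rmin_pos; assumption|]. intros w Hw.
  rewrite <- H1 by (apply Rlt_le_trans with (1 := Hw), Rmin_l).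
  rewrite <- H1 by (rewrite Cminus_diag_eq, Cmod_0; exact Hd1).
  apply H2. apply Rlt_le_trans with (1 := Hw), Rmin_r.
Qed.

Lemma cder_quadratic (f : C -> C) (z d : C) (K dl : R) :
  0 < dl -> (forall w, Cmod (w - z) < dl ->
     Cmod (f w - f z - d * (w - z)) <= K * Cmod (w - z) ^ 2) ->
  cder f z d.
Proof.
  intros Hdl H. apply cder_intro. intros e He.
  assert (Hk : 0 <= Rabs K) by apply Rabs_pos.
  assert (HkK : K <= Rabs K) by apply Rle_abs.
  exists (Rmin dl (e / (Rabs K + 1))). split.
  { apply Rmin_pos; [exact Hdl|]. apply Rdiv_lt_0_compat; lra. }
  intros w Hw.
  assert (Hw1 := H w (Rlt_le_trans _ _ _ Hw (Rmin_l _ _))).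
  assert (Hw2 := Rlt_le_trans _ _ _ Hw (Rmin_r _ _)).
  apply Rle_trans with (1 := Hw1). assert (Hp := Cmod_ge_0 (w - z)).
  apply (Rmult_lt_compat_r (Rabs K + 1)) in Hw2; [|lra].
  unfold Rdiv in Hw2. rewrite Rmult_assoc, Rinv_l in Hw2 by lra. nra.
Qed.

Lemma is_derive_of_cder (f : C -> C) (z d : C) :
  cder f z d -> @is_derive C_AbsRing C_NormedModule f z d.
Proof.
  intros H. split.
  - apply (@is_linear_scal_l C_AbsRing C_NormedModule).
  - intros x Hx.
    (* The library asks for the estimate at every limit [x] of the neighbourhood filter of [z]; by
       separation [z] is the only one. *)
    assert (Hx' : z = x).
    { apply (@is_filter_lim_locally_unique C_AbsRing (AbsRing_NormedModule C_AbsRing)). exact Hx. }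
    subst x. intros eps.
    destruct (cder_elim _ _ _ H eps (cond_pos eps)) as [dl [Hdl H']].
    exists (mkposreal dl Hdl). intros w Hw.
    change (Cmod (w - z) < dl) in Hw. specialize (H' w Hw).
    change (Cmod (f w - f z - (w - z) * d) <= eps * Cmod (w - z)).
    rewrite (Cmult_comm (w - z)). exact H'.
Qed.

Lemma Cmod_le_abs (x y : R) : Cmod (x, y) <= Rabs x + Rabs y.
Proof.
  replace (x, y) with (RtoC x + RtoC y * Ci)%C
    by (unfold RtoC, Ci, Cplus, Cmult; simpl; f_equal; ring).
  apply Rle_trans with (1 := Cmod_triangle _ _).
  rewrite Cmod_mult, !Cmod_R, Cmod_Ci. lra.
Qed.

Lemma im_as_re (z : C) : Im z = Re (- Ci * z)%C.
Proof. unfold Im, Re, Ci, Cmult, Copp; simpl. ring. Qed.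

Lemma im_le_Cmod (z : C) : Rabs (Im z) <= Cmod z.
Proof.
  rewrite im_as_re. apply Rle_trans with (1 := re_le_Cmod _).
  rewrite Cmod_mult, Cmod_opp, Cmod_Ci. lra.
Qed.

Lemma continuity_pt_re_curve (phi : C -> C) (g1 g2 : R -> R) (t : R) :
  ccont phi (g1 t, g2 t) -> continuity_pt g1 t -> continuity_pt g2 t ->
  continuity_pt (fun s => Re (phi (g1 s, g2 s))) t.
Proof.
  intros Hp H1 H2 e He. destruct (Hp e He) as [d [Hd H]].
  destruct (H1 (d / 2)) as [d1 [Hd1 K1]]; [lra|].
  destruct (H2 (d / 2)) as [d2 [Hd2 K2]]; [lra|].
  exists (Rmin d1 d2). split; [apply Rmin_pos; assumption|].
  intros s [Hs Hst]. simpl in *. unfold R_dist in *.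
  specialize (K1 s (conj Hs (Rlt_le_trans _ _ _ Hst (Rmin_l _ _)))).
  specialize (K2 s (conj Hs (Rlt_le_trans _ _ _ Hst (Rmin_r _ _)))).
  replace (Re (phi (g1 s, g2 s)) - Re (phi (g1 t, g2 t)))
    with (Re (phi (g1 s, g2 s) - phi (g1 t, g2 t))%C) by reflexivity.
  apply Rle_lt_trans with (1 := re_le_Cmod _). apply H.
  change ((g1 s, g2 s) - (g1 t, g2 t))%C with (g1 s - g1 t, g2 s - g2 t).
  apply Rle_lt_trans with (1 := Cmod_le_abs _ _). lra.
Qed.

(** A product rule in which [a] is merely continuous: the other factor vanishes at [t], so no
    derivative of [a] enters. Caratheodory's form along a curve produces exactly such products. *)
Lemma is_derive_increment_mult (a g : R -> R) (t d : R) :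
  continuity_pt a t -> is_derive g t d ->
  is_derive (fun s => a s * (g s - g t)) t (a t * d).
Proof.
  intros Ha Hg. apply is_derive_Reals. apply is_derive_Reals in Hg.
  intros e He.
  (* The error is u v + u |d| + |a t| v with u, v < e1 <= 1, hence at most e1 m. *)
  set (m := Rabs (a t) + Rabs d + 1).
  assert (H1 := Rabs_pos (a t)). assert (H2 := Rabs_pos d).
  assert (Hm : 1 <= m) by (unfold m; lra).
  set (e1 := Rmin 1 (e / (2 * m))).
  assert (He1 : 0 < e1).
  { apply Rmin_pos; [lra|]. apply Rdiv_lt_0_compat; lra. }
  assert (He1m : e1 * m <= e / 2).
  { apply Rle_trans with (e / (2 * m) * m).
    - apply Rmult_le_compat_r; [lra|apply Rmin_r].
    - right. field. lra. }
  assert (He11 : e1 <= 1) by apply Rmin_l.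
  destruct (Ha e1 He1) as [d1 [Hd1 K1]].
  destruct (Hg e1 He1) as [d2 K2].
  exists (mkposreal _ (Rmin_pos _ _ Hd1 (cond_pos d2))). simpl. intros h Hh Hhd.
  specialize (K2 h Hh (Rlt_le_trans _ _ _ Hhd (Rmin_r _ _))).
  assert (K : Rabs (a (t + h) - a t) < e1).
  { apply K1. split.
    - split; [exact I|]. intros E. apply Hh. lra.
    - simpl. unfold R_dist. replace (t + h - t) with h by ring.
      apply Rlt_le_trans with (1 := Hhd), Rmin_l. }
  replace ((a (t + h) * (g (t + h) - g t) - a t * (g t - g t)) / h - a t * d)
    with ((a (t + h) - a t) * ((g (t + h) - g t) / h - d)
          + (a (t + h) - a t) * d + a t * ((g (t + h) - g t) / h - d)) by (field; exact Hh).
  eapply Rle_lt_trans; [apply Rabs_triang|].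
  eapply Rle_lt_trans; [apply Rplus_le_compat_r, Rabs_triang|].
  rewrite !Rabs_mult.
  set (u := Rabs (a (t + h) - a t)) in *.
  set (v := Rabs ((g (t + h) - g t) / h - d)) in *.
  assert (Hu : 0 <= u) by apply Rabs_pos. assert (Hv : 0 <= v) by apply Rabs_pos.
  unfold m in *. nra.
Qed.

(** Taking real parts in Caratheodory's identity leaves the increments of [g1] and [g2] with the
    continuous coefficients Re p and Re (i p). Imaginary parts follow by applying it to
    [- Ci * H]. *)
Lemma is_derive_re_curve (H : C -> C) (D : C) (g1 g2 : R -> R) (t d1 d2 : R) :
  cder H (g1 t, g2 t) D -> is_derive g1 t d1 -> is_derive g2 t d2 ->
  is_derive (fun s => Re (H (g1 s, g2 s))) t (Re (D * (d1, d2))%C).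
Proof.
  intros [p [P1 [P2 P3]]] H1 H2.
  assert (C1 : continuity_pt g1 t).
  { apply derivable_continuous_pt. exists d1. apply is_derive_Reals, H1. }
  assert (C2 : continuity_pt g2 t).
  { apply derivable_continuous_pt. exists d2. apply is_derive_Reals, H2. }
  apply is_derive_ext with
    (fun s => Re (H (g1 t, g2 t)) + (Re (p (g1 s, g2 s)) * (g1 s - g1 t) +
       Re ((fun w => Ci * p w)%C (g1 s, g2 s)) * (g2 s - g2 t))).
  { intros s. rewrite (P3 (g1 s, g2 s)).
    unfold Re, Ci, Cplus, Cmult, Cminus, Copp; simpl. ring. }
  replace (Re (D * (d1, d2))%C) with
    (0 + (Re (p (g1 t, g2 t)) * d1 + Re ((fun w => Ci * p w)%C (g1 t, g2 t)) * d2))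
    by (rewrite P2; unfold Re, Ci, Cplus, Cmult, Cminus, Copp; simpl; ring).
  apply (is_derive_plus (fun _ => Re (H (g1 t, g2 t)))).
  { apply @is_derive_const. }
  apply @is_derive_plus.
  - apply (is_derive_increment_mult (fun s => Re (p (g1 s, g2 s))) g1); [|exact H1].
    apply continuity_pt_re_curve; assumption.
  - apply (is_derive_increment_mult
             (fun s => Re ((fun w => Ci * p w)%C (g1 s, g2 s))) g2); [|exact H2].
    apply (continuity_pt_re_curve (fun w => Ci * p w)%C); try assumption.
    apply ccont_mult; [apply ccont_const|assumption].
Qed.

Lemma continuity_2d_re_comp (phi : C -> C) (a b : R -> R -> R) (x y : R) :
  ccont phi (a x y, b x y) -> continuity_2d_pt a x y -> continuity_2d_pt b x y ->
  continuity_2d_pt (fun u v => Re (phi (a u v, b u v))) x y.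
Proof.
  intros Hp H1 H2 e. destruct (Hp e (cond_pos e)) as [d [Hd H]].
  assert (Hd2 : 0 < d / 2) by lra.
  destruct (H1 (mkposreal _ Hd2)) as [d1 K1].
  destruct (H2 (mkposreal _ Hd2)) as [d2 K2]. simpl in K1, K2.
  exists (mkposreal _ (Rmin_pos _ _ (cond_pos d1) (cond_pos d2))). simpl.
  intros u v Hu Hv.
  specialize (K1 u v (Rlt_le_trans _ _ _ Hu (Rmin_l _ _)) (Rlt_le_trans _ _ _ Hv (Rmin_l _ _))).
  specialize (K2 u v (Rlt_le_trans _ _ _ Hu (Rmin_r _ _)) (Rlt_le_trans _ _ _ Hv (Rmin_r _ _))).
  replace (Re (phi (a u v, b u v)) - Re (phi (a x y, b x y)))
    with (Re (phi (a u v, b u v) - phi (a x y, b x y))%C) by reflexivity.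
  apply Rle_lt_trans with (1 := re_le_Cmod _). apply H.
  change ((a u v, b u v) - (a x y, b x y))%C with (a u v - a x y, b u v - b x y).
  apply Rle_lt_trans with (1 := Cmod_le_abs _ _). lra.
Qed.

(** * Circle means *)

Definition cpolar (r t : R) : C := (r * cos t, r * sin t).

Lemma Cmod_cpolar (r t : R) : 0 <= r -> Cmod (cpolar r t) = r.
Proof.
  intros Hr. unfold Cmod, cpolar; simpl.
  replace (r * cos t * (r * cos t * 1) + r * sin t * (r * sin t * 1)) with (r * r).
  - apply sqrt_square, Hr.
  - assert (E := sin2_cos2 t). unfold Rsqr in E. nra.
Qed.

Section CircleMean.

Variables H dH : C -> C.
(** The center is left out because the function to be averaged contains a factor [1/z^3]. Continuity
    of [dH] is what permits differentiation under the integral sign. *)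
Hypothesis HdH : forall z : C, 0 < Cmod z < 1 -> cder H z (dH z) /\ ccont dH z.

Let punctured (r t : R) : 0 < r < 1 -> 0 < Cmod (cpolar r t) < 1.
Proof. intros Hr. rewrite Cmod_cpolar; lra. Qed.

Lemma is_derive_radial (r t : R) : 0 < r < 1 ->
  is_derive (fun u => Re (H (cpolar u t))) r (Re (dH (cpolar r t) * (cos t, sin t))%C).
Proof.
  intros Hr.
  apply (is_derive_re_curve H _ (fun u => u * cos t) (fun u => u * sin t)).
  - apply HdH, punctured, Hr.
  - auto_derive; [exact I|ring].
  - auto_derive; [exact I|ring].
Qed.

(** The circle has tangent i r e^(it), and Im H = Re (- i H): the two factors cancel, which leaves
    [r] times the radial derivative of Re H. *)
Lemma is_derive_angular (r t : R) : 0 < r < 1 ->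
  is_derive (fun s => Im (H (cpolar r s))) t (r * Re (dH (cpolar r t) * (cos t, sin t))%C).
Proof.
  intros Hr.
  apply is_derive_ext with (fun s => Re (- Ci * H (cpolar r s))%C).
  { intros s. now rewrite im_as_re. }
  replace (r * Re (dH (cpolar r t) * (cos t, sin t))%C)
    with (Re ((- Ci * dH (cpolar r t)) * ((r * - sin t, r * cos t))%R)%C)
    by (unfold Re, Ci, Cmult, Copp; simpl; ring).
  apply (is_derive_re_curve (fun w => - Ci * H w)%C _ (fun u => r * cos u) (fun u => r * sin u)).
  - apply cder_scal, HdH. apply (punctured r t Hr).
  - auto_derive; [exact I|ring].
  - auto_derive; [exact I|ring].
Qed.

Lemma continuity_2d_radial_derivative (r t : R) : 0 < r < 1 ->
  continuity_2d_pt (fun u v => Re (dH (cpolar u v) * (cos v, sin v))%C) r t.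
Proof.
  intros Hr.
  assert (K1 : continuity_2d_pt (fun u v => u * cos v) r t).
  { apply continuity_2d_pt_mult; [apply continuity_2d_pt_id1|].
    apply continuity_1d_2d_pt_comp; [apply continuity_cos|apply continuity_2d_pt_id2]. }
  assert (K2 : continuity_2d_pt (fun u v => u * sin v) r t).
  { apply continuity_2d_pt_mult; [apply continuity_2d_pt_id1|].
    apply continuity_1d_2d_pt_comp; [apply continuity_sin|apply continuity_2d_pt_id2]. }
  assert (Hc := proj2 (HdH _ (punctured r t Hr))).
  apply continuity_2d_pt_ext with
    (fun u v => Re (dH (cpolar u v)) * cos v + Re ((fun w => Ci * dH w)%C (cpolar u v)) * sin v).
  { intros u v. unfold Re, Ci, Cmult; simpl. ring. }
  apply continuity_2d_pt_plus; apply continuity_2d_pt_mult.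
  - apply (continuity_2d_re_comp dH (fun u v => u * cos v) (fun u v => u * sin v)); assumption.
  - apply continuity_1d_2d_pt_comp; [apply continuity_cos|apply continuity_2d_pt_id2].
  - apply (continuity_2d_re_comp (fun w => Ci * dH w)%C
             (fun u v => u * cos v) (fun u v => u * sin v)); try assumption.
    apply ccont_mult; [apply ccont_const|assumption].
  - apply continuity_1d_2d_pt_comp; [apply continuity_sin|apply continuity_2d_pt_id2].
Qed.

Lemma continuous_angular (r t : R) : 0 < r < 1 ->
  continuous (fun s => Re (H (cpolar r s))) t.
Proof.
  intros Hr. apply continuity_pt_filterlim.
  apply (continuity_pt_re_curve H (fun s => r * cos s) (fun s => r * sin s)).
  - apply cder_ccont with (dH (cpolar r t)). apply HdH, (punctured r t Hr).
  - apply derivable_continuous_pt. exists (r * - sin t).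
    apply derivable_pt_lim_scal, derivable_pt_lim_cos.
  - apply derivable_continuous_pt. exists (r * cos t).
    apply derivable_pt_lim_scal, derivable_pt_lim_sin.
Qed.

Lemma continuous_radial_derivative (r t : R) : 0 < r < 1 ->
  continuous (fun s => Re (dH (cpolar r s) * (cos s, sin s))%C) t.
Proof.
  intros Hr. apply continuity_pt_filterlim. intros e He.
  destruct (continuity_2d_radial_derivative r t Hr (mkposreal e He)) as [d Hd].
  exists d. split; [apply cond_pos|]. intros s [_ Hs]. simpl in *.
  apply Hd; [|exact Hs].
  replace (r - r) with 0 by ring. rewrite Rabs_R0. apply cond_pos.
Qed.

Lemma ex_RInt_circle (r : R) : 0 < r < 1 ->
  ex_RInt (fun t => Re (H (cpolar r t))) 0 (2 * PI).
Proof.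
  intros Hr. apply (@ex_RInt_continuous R_CompleteNormedModule).
  intros t _. apply continuous_angular, Hr.
Qed.

(* By the Cauchy-Riemann equations the radial derivative of [Re H] is, up to the
   factor [r], the angular derivative of [Im H], whose integral over a period vanishes. *)
Lemma is_derive_circle_mean (r : R) : 0 < r < 1 ->
  is_derive (fun u => RInt (fun t => Re (H (cpolar u t))) 0 (2 * PI)) r 0.
Proof.
  intros Hr.
  assert (Hloc : forall P : R -> Prop, (forall u, 0 < u < 1 -> P u) -> locally r P).
  { intros P HP. assert (Hd : 0 < Rmin r (1 - r)) by (apply Rmin_pos; lra).
    exists (mkposreal _ Hd). intros u Hu.
    change (Rabs (u - r) < Rmin r (1 - r)) in Hu.
    assert (H1 := Rmin_l r (1 - r)). assert (H2 := Rmin_r r (1 - r)).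
    apply Rabs_def2 in Hu. apply HP. lra. }
  assert (E : RInt (fun t => Derive (fun u => Re (H (cpolar u t))) r) 0 (2 * PI) = 0).
  { apply is_RInt_unique.
    apply is_RInt_ext with (fun t => scal (/ r) (r * Re (dH (cpolar r t) * (cos t, sin t))%C)).
    { intros t _. symmetry.
      etransitivity; [apply (is_derive_unique _ _ _ (is_derive_radial r t Hr))|].
      unfold scal; simpl; unfold mult; simpl. field. lra. }
    assert (E : scal (/ r) (minus (Im (H (cpolar r (2 * PI)))) (Im (H (cpolar r 0)))) = 0).
    { unfold cpolar. rewrite cos_2PI, sin_2PI, cos_0, sin_0.
      unfold scal, minus, plus, opp; simpl; unfold mult; simpl. ring. }
    apply (eq_ind _ (fun l => is_RInt _ 0 (2 * PI) l)) with (2 := E).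
    apply @is_RInt_scal.
    apply (@is_RInt_derive R_CompleteNormedModule (fun t => Im (H (cpolar r t)))).
    - intros t _. apply is_derive_angular, Hr.
    - intros t _.
      apply (continuous_scal_r r (fun s => Re (dH (cpolar r s) * (cos s, sin s))%C)).
      apply continuous_radial_derivative, Hr. }
  apply (eq_ind _ (fun l => is_derive _ r l)) with (2 := E).
  apply (is_derive_RInt_param (fun u t => Re (H (cpolar u t)))).
  - apply Hloc. intros u Hu t _. eexists. apply is_derive_radial, Hu.
  - intros t _.
    apply continuity_2d_pt_ext_loc with (fun u v => Re (dH (cpolar u v) * (cos v, sin v))%C).
    + assert (Hd : 0 < Rmin r (1 - r)) by (apply Rmin_pos; lra).
      exists (mkposreal _ Hd). intros u v Hu _. simpl in Hu.
      assert (H1 := Rmin_l r (1 - r)). assert (H2 := Rmin_r r (1 - r)).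
      apply Rabs_def2 in Hu. symmetry. apply is_derive_unique, is_derive_radial. lra.
    + apply continuity_2d_radial_derivative, Hr.
  - apply Hloc. intros u Hu. apply ex_RInt_circle, Hu.
Qed.

Lemma circle_mean_const (r s : R) : 0 < r < 1 -> 0 < s < 1 ->
  RInt (fun t => Re (H (cpolar r t))) 0 (2 * PI) = RInt (fun t => Re (H (cpolar s t))) 0 (2 * PI).
Proof.
  intros Hr Hs.
  assert (Hin : forall x, Rmin s r <= x <= Rmax s r -> 0 < x < 1).
  { intros x. unfold Rmin, Rmax. destruct (Rle_dec s r); lra. }
  destruct (MVT_gen (fun u => RInt (fun t => Re (H (cpolar u t))) 0 (2 * PI)) s r (fun _ => 0))
    as [c [_ Hc]].
  - intros x Hx. apply is_derive_circle_mean, Hin. lra.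
  - intros x Hx. apply derivable_continuous_pt. exists 0.
    apply is_derive_Reals, is_derive_circle_mean, Hin, Hx.
  - lra.
Qed.

(** The mean over radius [r] equals the mean over an arbitrarily small circle, on which H is close
    to [l]. A negative Re l would make the small mean negative while the large one is nonnegative.
    No value or derivative of H at the center is involved. *)
Lemma center_minimum_principle (l : C) (r : R) :
  (forall eps, 0 < eps -> exists d, 0 < d /\
     forall z, 0 < Cmod z < d -> Cmod (H z - l) < eps) ->
  0 < r < 1 -> (forall z, Cmod z = r -> 0 <= Re (H z)) -> 0 <= Re l.
Proof.
  intros Hl Hr Hpos. apply Rnot_lt_le. intros Hneg.
  destruct (Hl (- Re l)) as [d [Hd K]]; [lra|].
  set (s := Rmin (d / 2) (1 / 2)).
  assert (Hs0 : 0 < s) by (apply Rmin_pos; lra).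
  assert (Hsd : s <= d / 2) by apply Rmin_l. assert (Hs1 : s <= 1 / 2) by apply Rmin_r.
  assert (HP := PI_RGT_0).
  assert (I1 : 0 <= RInt (fun t => Re (H (cpolar r t))) 0 (2 * PI)).
  { apply RInt_ge_0; [lra|apply ex_RInt_circle, Hr|].
    intros t _. apply Hpos. apply Cmod_cpolar. lra. }
  assert (I2 : RInt (fun t => Re (H (cpolar s t))) 0 (2 * PI) < 0).
  { apply Rlt_le_trans with (RInt (fun _ => 0) 0 (2 * PI)).
    - apply RInt_lt; [lra| | |].
      + intros t _. apply continuous_const.
      + intros t _. apply continuous_angular. lra.
      + intros t _. assert (Hm : Cmod (cpolar s t) = s) by (apply Cmod_cpolar; lra).
        assert (K1 := K (cpolar s t)). rewrite Hm in K1. specialize (K1 ltac:(lra)).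
        assert (K2 := Rle_lt_trans _ _ _ (re_le_Cmod _) K1).
        apply Rabs_def2 in K2.
        replace (Re (H (cpolar s t) - l)%C) with (Re (H (cpolar s t)) - Re l) in K2 by reflexivity.
        lra.
    - rewrite RInt_const. unfold scal; simpl; unfold mult; simpl. lra. }
  rewrite (circle_mean_const r s) in I1 by lra. lra.
Qed.

End CircleMean.

(** * Coefficients of Schwarz functions *)

(** Complex differentiability with a continuous derivative, which is the regularity that the circle
    means demand. *)
Definition hol (U : C -> Prop) (f : C -> C) : Prop :=
  exists df : C -> C, forall z, U z -> cder f z (df z) /\ ccont df z.

Lemma hol_const (U : C -> Prop) (c : C) : hol U (fun _ => c).
Proof. exists (fun _ => RtoC 0). intros z _. split; [apply cder_const|apply ccont_const]. Qed.

Lemma hol_id (U : C -> Prop) : hol U (fun z => z).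
Proof. exists (fun _ => RtoC 1). intros z _. split; [apply cder_id|apply ccont_const]. Qed.

Lemma hol_plus (U : C -> Prop) (f g : C -> C) :
  hol U f -> hol U g -> hol U (fun z => (f z + g z)%C).
Proof.
  intros [df F] [dg G]. exists (fun z => (df z + dg z)%C). intros z Hz.
  destruct (F z Hz), (G z Hz). split; [apply cder_plus|apply ccont_plus]; assumption.
Qed.

Lemma hol_opp (U : C -> Prop) (f : C -> C) : hol U f -> hol U (fun z => (- f z)%C).
Proof.
  intros [df F]. exists (fun z => (- df z)%C). intros z Hz.
  destruct (F z Hz). split; [apply cder_opp|apply ccont_opp]; assumption.
Qed.

Lemma hol_minus (U : C -> Prop) (f g : C -> C) :
  hol U f -> hol U g -> hol U (fun z => (f z - g z)%C).
Proof. intros F G. apply hol_plus; [exact F|apply hol_opp, G]. Qed.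

Lemma hol_mult (U : C -> Prop) (f g : C -> C) :
  hol U f -> hol U g -> hol U (fun z => (f z * g z)%C).
Proof.
  intros [df F] [dg G]. exists (fun z => (df z * g z + f z * dg z)%C). intros z Hz.
  destruct (F z Hz) as [F1 F2], (G z Hz) as [G1 G2].
  split; [apply cder_mult; assumption|].
  apply ccont_plus; apply ccont_mult; eauto using cder_ccont.
Qed.

Lemma hol_inv (U : C -> Prop) (f : C -> C) :
  hol U f -> (forall z, U z -> f z <> 0) -> hol U (fun z => (/ f z)%C).
Proof.
  intros [df F] Hn. exists (fun z => (- df z * / (f z * f z))%C). intros z Hz.
  destruct (F z Hz) as [F1 F2]. assert (Hfz := Hn z Hz).
  assert (Fc := cder_ccont _ _ _ F1).
  split; [apply cder_inv; assumption|].
  apply ccont_mult; [apply ccont_opp, F2|].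
  apply (ccont_inv (fun z => (f z * f z)%C)).
  - apply ccont_mult; assumption.
  - apply Cmult_neq_0; assumption.
Qed.

Lemma hol_comp (U V : C -> Prop) (f g : C -> C) :
  hol V f -> hol U g -> (forall z, U z -> V (g z)) -> hol U (fun z => f (g z)).
Proof.
  intros [df F] [dg G] HUV. exists (fun z => (df (g z) * dg z)%C). intros z Hz.
  destruct (G z Hz) as [G1 G2], (F (g z) (HUV z Hz)) as [F1 F2].
  split; [apply cder_comp; assumption|].
  apply ccont_mult; [|exact G2]. apply ccont_comp; [|exact F2].
  apply cder_ccont with (1 := G1).
Qed.

Lemma hol_subset (U V : C -> Prop) (f : C -> C) :
  (forall z, U z -> V z) -> hol V f -> hol U f.
Proof. intros HUV [df F]. exists df. auto. Qed.

(** Taylor coefficients are recorded by saying that the difference with a polynomial is O(z^n). The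
    point 0 is included, so for [n > 0] the function vanishes there. *)
Definition bigO (n : nat) (f : C -> C) : Prop :=
  exists M d : R, 0 < d /\ forall z, Cmod z < d -> Cmod (f z) <= M * Cmod z ^ n.

Lemma bigO_ext_loc (n : nat) (f g : C -> C) (d : R) : 0 < d ->
  (forall z, Cmod z < d -> f z = g z) -> bigO n f -> bigO n g.
Proof.
  intros Hd E [M [d' [Hd' H]]]. exists M, (Rmin d d').
  split; [apply Rmin_pos; assumption|]. intros z Hz.
  rewrite <- E by (apply Rlt_le_trans with (1 := Hz), Rmin_l).
  apply H. apply Rlt_le_trans with (1 := Hz), Rmin_r.
Qed.

Lemma bigO_ext (n : nat) (f g : C -> C) : (forall z, f z = g z) -> bigO n f -> bigO n g.
Proof. intros E. apply bigO_ext_loc with 1; [lra|auto]. Qed.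

Lemma bigO_plus (n : nat) (f g : C -> C) :
  bigO n f -> bigO n g -> bigO n (fun z => (f z + g z)%C).
Proof.
  intros [M [d [Hd H]]] [M' [d' [Hd' H']]]. exists (M + M'), (Rmin d d').
  split; [apply Rmin_pos; assumption|]. intros z Hz.
  specialize (H z (Rlt_le_trans _ _ _ Hz (Rmin_l _ _))).
  specialize (H' z (Rlt_le_trans _ _ _ Hz (Rmin_r _ _))).
  apply Rle_trans with (1 := Cmod_triangle _ _). lra.
Qed.

Lemma bigO_opp (n : nat) (f : C -> C) : bigO n f -> bigO n (fun z => (- f z)%C).
Proof.
  intros [M [d [Hd H]]]. exists M, d. split; [exact Hd|]. intros z Hz.
  rewrite Cmod_opp. auto.
Qed.

Lemma bigO_minus (n : nat) (f g : C -> C) :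
  bigO n f -> bigO n g -> bigO n (fun z => (f z - g z)%C).
Proof. intros F G. apply bigO_plus; [exact F|apply bigO_opp, G]. Qed.

Lemma bigO_mult (n m : nat) (f g : C -> C) :
  bigO n f -> bigO m g -> bigO (n + m) (fun z => (f z * g z)%C).
Proof.
  intros [M [d [Hd H]]] [M' [d' [Hd' H']]]. exists (M * M'), (Rmin d d').
  split; [apply Rmin_pos; assumption|]. intros z Hz.
  specialize (H z (Rlt_le_trans _ _ _ Hz (Rmin_l _ _))).
  specialize (H' z (Rlt_le_trans _ _ _ Hz (Rmin_r _ _))).
  rewrite Cmod_mult, pow_add.
  replace (M * M' * (Cmod z ^ n * Cmod z ^ m))
    with ((M * Cmod z ^ n) * (M' * Cmod z ^ m)) by ring.
  apply Rmult_le_compat; auto using Cmod_ge_0.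
Qed.

Lemma bigO_const (c : C) : bigO 0 (fun _ => c).
Proof. exists (Cmod c), 1. split; [lra|]. intros z _. simpl. lra. Qed.

Lemma bigO_id : bigO 1 (fun z => z).
Proof. exists 1, 1. split; [lra|]. intros z _. simpl. lra. Qed.

Lemma bigO_pow (n : nat) : bigO n (fun z => (z ^ n)%C).
Proof. exists 1, 1. split; [lra|]. intros z _. rewrite Cmod_pow. lra. Qed.

Lemma bigO_le (n m : nat) (f : C -> C) : (m <= n)%nat -> bigO n f -> bigO m f.
Proof.
  intros Hmn [M [d [Hd H]]]. exists (Rabs M), (Rmin d 1).
  split; [apply Rmin_pos; lra|]. intros z Hz.
  specialize (H z (Rlt_le_trans _ _ _ Hz (Rmin_l _ _))).
  assert (Hz1 := Rlt_le_trans _ _ _ Hz (Rmin_r _ _)).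
  assert (H0 := Cmod_ge_0 z).
  apply Rle_trans with (1 := H).
  replace n with (m + (n - m))%nat by lia. rewrite pow_add.
  assert (P1 : 0 <= Cmod z ^ m) by (apply pow_le; lra).
  assert (P2 : 0 <= Cmod z ^ (n - m)) by (apply pow_le; lra).
  assert (P3 : Cmod z ^ (n - m) <= 1).
  { rewrite <- (pow1 (n - m)). apply pow_incr. lra. }
  apply Rle_trans with (Rabs M * (Cmod z ^ m * Cmod z ^ (n - m))).
  - apply Rmult_le_compat_r; [nra|apply Rle_abs].
  - apply Rmult_le_compat_l; [apply Rabs_pos|nra].
Qed.

Lemma bigO_ccont (f : C -> C) : ccont f 0 -> bigO 0 f.
Proof.
  intros Hf. destruct (Hf 1 Rlt_0_1) as [d [Hd H]].
  exists (Cmod (f 0) + 1), d. split; [exact Hd|]. intros z Hz.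
  specialize (H z). replace (z - 0)%C with z in H by ring. specialize (H Hz).
  assert (H' := Cmod_minus_ge (f z) (f 0)). simpl. lra.
Qed.

Lemma bigO_limit (f : C -> C) : bigO 1 f ->
  forall eps, 0 < eps -> exists d, 0 < d /\ forall z, Cmod z < d -> Cmod (f z) < eps.
Proof.
  intros [M [d [Hd H]]] e He.
  assert (HM : 0 < Rabs M + 1) by (assert (H0 := Rabs_pos M); lra).
  exists (Rmin d (e / (Rabs M + 1))). split.
  { apply Rmin_pos; [exact Hd|]. apply Rdiv_lt_0_compat; assumption. }
  intros z Hz. specialize (H z (Rlt_le_trans _ _ _ Hz (Rmin_l _ _))).
  assert (Hz1 := Rlt_le_trans _ _ _ Hz (Rmin_r _ _)).
  apply (Rmult_lt_compat_r (Rabs M + 1)) in Hz1; [|exact HM].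
  unfold Rdiv in Hz1. rewrite Rmult_assoc, Rinv_l in Hz1 by lra.
  assert (H0 := Cmod_ge_0 z). assert (H1 := Rle_abs M). simpl in H. nra.
Qed.

(** The cross term conj(b z) c z^2 equals |z|^2 conj(b) c z. On a circle, where |z|^2 is constant,
    all cross terms are therefore real parts of polynomials in [z] that vanish at 0. *)
Lemma Cmod2_quadratic (a b c z : C) :
  Cmod (a + b * z + c * (z * z)) ^ 2 =
  Cmod a ^ 2 + Cmod b ^ 2 * Cmod z ^ 2 + Cmod c ^ 2 * (Cmod z ^ 2) ^ 2 +
  2 * Re (Cconj a * b * z + Cconj a * c * (z * z) + RtoC (Cmod z ^ 2) * (Cconj b * c * z))%C.
Proof.
  rewrite !Cmod2_alt. destruct a, b, c, z.
  unfold Re, Im, Cconj, RtoC, Cplus, Cmult; simpl. ring.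
Qed.

(** Replaces the limit r -> 1. If S > T, Bernoulli's inequality (1 - d)^n >= 1 - n d with d = (S -
    T) / (2 (n + 1) S) gives (1 - d)^n S >= S - (S - T)/2 > T. *)
Lemma le_of_forall_pow (n : nat) (S T : R) : 0 < T ->
  (forall r, 0 < r < 1 -> r ^ n * S <= T) -> S <= T.
Proof.
  intros HT H. apply Rnot_lt_le. intros Hlt.
  assert (Hn := pos_INR n).
  set (m := 2 * (INR n + 1) * S).
  assert (HnS : 0 <= INR n * S) by (apply Rmult_le_pos; lra).
  assert (Hm : 2 * S <= m) by (unfold m; nra).
  set (d := (S - T) / m).
  assert (Hd : d * m = S - T) by (unfold d; field; lra).
  assert (Hd0 : 0 < d) by (apply Rdiv_lt_0_compat; lra).
  assert (Hd1 : d < 1) by nra.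
  specialize (H (1 - d) ltac:(lra)).
  assert (E : forall k, 1 - INR k * d <= (1 - d) ^ k).
  { intros k. induction k as [|k IH]; [simpl; lra|]. rewrite S_INR.
    assert (Hk := pos_INR k). change ((1 - d) ^ Datatypes.S k) with ((1 - d) * (1 - d) ^ k).
    assert (0 <= INR k * d * d) by (apply Rmult_le_pos; [apply Rmult_le_pos|]; lra). nra. }
  specialize (E n).
  assert ((1 - INR n * d) * S <= (1 - d) ^ n * S) by (apply Rmult_le_compat_r; lra).
  assert (Hd2 : 2 * (INR n * d * S) <= S - T).
  { rewrite <- Hd. unfold m. assert (0 <= d * S) by (apply Rmult_le_pos; lra). nra. }
  lra.
Qed.

(* The lower triangular Toeplitz matrix of the coefficients of a Schwarz function
   is a contraction; [1, s1, s2] is the vector it is applied to. On [|z| = r],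
   [|W p|^2 <= |p|^2] with [p = 1 + s1 z + s2 z^2]; discarding the square of the
   remainder, every term becomes a constant plus the real part of a function
   holomorphic in [0 < |z| < 1] that vanishes at [0]. *)
Lemma schwarz_toeplitz (W : C -> C) (c1 c2 c3 s1 s2 : C) :
  hol (fun z => Cmod z < 1) W ->
  (forall z, Cmod z < 1 -> Cmod (W z) <= 1) ->
  bigO 4 (fun z => (W z - (c1 * z + c2 * z ^ 2 + c3 * z ^ 3))%C) ->
  Cmod c1 ^ 2 + Cmod (c2 + s1 * c1) ^ 2 + Cmod (c3 + s1 * c2 + s2 * c1) ^ 2
  <= 1 + Cmod s1 ^ 2 + Cmod s2 ^ 2.
Proof.
  intros HW Hb HO.
  set (h2 := (c2 + s1 * c1)%C). set (h3 := (c3 + s1 * c2 + s2 * c1)%C).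
  set (p := fun z : C => (1 + s1 * z + s2 * (z * z))%C).
  set (q := fun z : C => (c1 + h2 * z + h3 * (z * z))%C).
  (* [z q] is the part of degree at most 3 of [W p]; this is how [h2] and [h3] arise, and [N] is the
     remainder. *)
  set (N := fun z : C => (W z * p z - z * q z)%C).
  assert (HN : bigO 4 N).
  { apply bigO_ext with
      (fun z => ((W z - (c1 * z + c2 * z ^ 2 + c3 * z ^ 3)) * p z
        + z ^ 4 * (s1 * c3 + s2 * c2 + s2 * c3 * z))%C).
    { intros z. unfold N, p, q, h2, h3. simpl. ring. }
    apply bigO_plus.
    - apply (bigO_mult 4 0); [exact HO|].
      apply bigO_ccont. unfold p.
      repeat apply ccont_plus; repeat apply ccont_mult;
        first [apply ccont_const|apply ccont_id].
    - apply (bigO_mult 4 0); [apply bigO_pow|].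
      apply bigO_ccont. apply ccont_plus; repeat apply ccont_mult;
        first [apply ccont_const|apply ccont_id]. }
  (* On |z|^2 = rho one has conj z = rho / z, so z^3 conj(z q) is the polynomial [T] defined below,
     and N conj(z q) = G T with G = N / z^3. Since N is O(z^4), G still tends to 0. *)
  set (G := fun z : C => (N z * / (z * z * z))%C).
  assert (HG : bigO 1 G).
  { destruct HN as [M [d [Hd H]]]. exists M, d. split; [exact Hd|]. intros z Hz.
    specialize (H z Hz). unfold G. rewrite Cmod_mult.
    destruct (Ceq_dec z 0) as [->|n].
    - replace (0 * 0 * 0)%C with (RtoC 0) by ring. rewrite Cinv_0, Cmod_0. lra.
    - assert (Hp := proj1 (Cmod_gt_0 _) n).
      rewrite Cmod_inv by (repeat apply Cmult_neq_0; exact n). rewrite !Cmod_mult.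
      apply Rmult_le_reg_r with (Cmod z * Cmod z * Cmod z).
      { repeat apply Rmult_lt_0_compat; exact Hp. }
      rewrite Rmult_assoc, Rinv_l, Rmult_1_r by (repeat apply Rmult_integral_contrapositive_currified; lra).
      simpl in H |- *. lra. }
  (* In the inequality obtained at radius [r] the left-hand squares carry r^2, r^4 and r^6; all are
     minorized by r^6. *)
  apply (le_of_forall_pow 6).
  { assert (H1 := pow2_ge_0 (Cmod s1)). assert (H2 := pow2_ge_0 (Cmod s2)). lra. }
  intros r Hr.
  set (rho := (r ^ 2)%R).
  set (kappa := 1 + Cmod s1 ^ 2 * rho + Cmod s2 ^ 2 * rho ^ 2
    - rho * (Cmod c1 ^ 2 + Cmod h2 ^ 2 * rho + Cmod h3 ^ 2 * rho ^ 2)).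
  set (P := fun z : C => (s1 * z + s2 * (z * z) + RtoC rho * (Cconj s1 * s2 * z)
    - RtoC rho * (Cconj c1 * h2 * z + Cconj c1 * h3 * (z * z)
         + RtoC rho * (Cconj h2 * h3 * z)))%C).
  set (T := fun z : C => (RtoC rho * (Cconj c1 * (z * z) + RtoC rho * (Cconj h2 * z)
     + RtoC rho * RtoC rho * Cconj h3))%C).
  (* [kappa] collects the constant terms of |p|^2 - |z q|^2 on the circle of radius [r]. Re K is
     nonnegative on that circle and K tends to [kappa] at 0, so [kappa >= 0]. *)
  set (K := fun z : C => (RtoC kappa + 2 * (P z - G z * T z))%C).
  assert (Hk : 0 <= Re (RtoC kappa)).
  { assert (HK : hol (fun z => 0 < Cmod z < 1) K).
    { unfold K, G, N, P, T, p, q.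
      repeat first [apply hol_const|apply hol_id|apply hol_minus|apply hol_plus|apply hol_mult
                   |solve [apply hol_subset with (2 := HW); tauto]].
      - apply hol_inv.
        + repeat first [apply hol_mult|apply hol_id].
        + intros z [Hz _]. apply Cmod_gt_0 in Hz. repeat apply Cmult_neq_0; exact Hz. }
    destruct HK as [dK HK].
    apply (center_minimum_principle K dK HK (RtoC kappa) r).
    - intros e He.
      assert (HO1 : bigO 1 (fun z => (2 * (P z - G z * T z))%C)).
      { apply (bigO_mult 0 1); [apply bigO_const|]. apply bigO_minus.
        - apply bigO_ext with (fun z => (z * (s1 + s2 * z + RtoC rho * (Cconj s1 * s2)
            - RtoC rho * (Cconj c1 * h2 + Cconj c1 * h3 * z
              + RtoC rho * (Cconj h2 * h3))))%C).
          { intros z. unfold P. ring. }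
          apply (bigO_mult 1 0); [apply bigO_id|]. apply bigO_ccont.
          repeat first [apply ccont_plus|apply ccont_opp|apply ccont_mult|apply ccont_const|apply ccont_id].
        - apply (bigO_mult 1 0); [exact HG|]. apply bigO_ccont. unfold T.
          repeat first [apply ccont_plus|apply ccont_opp|apply ccont_mult|apply ccont_const|apply ccont_id]. }
      destruct (bigO_limit _ HO1 e He) as [d [Hd H]]. exists d. split; [exact Hd|].
      intros z [_ Hz]. unfold K.
      replace (RtoC kappa + 2 * (P z - G z * T z) - RtoC kappa)%C
        with (2 * (P z - G z * T z))%C by ring. auto.
    - exact Hr.
    - intros z Hz.
      assert (Hz0 : z <> 0) by (apply Cmod_gt_0; lra).
      assert (Hrho : rho = Cmod z ^ 2) by (unfold rho; now rewrite Hz).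
      assert (Hzz : (z * Cconj z)%C = RtoC rho) by (rewrite Hrho; symmetry; apply Cmod2_conj).
      assert (E1 := Cmod2_quadratic 1 s1 s2 z). fold (p z) in E1.
      assert (E2 := Cmod2_quadratic c1 h2 h3 z). fold (q z) in E2.
      rewrite <- Hrho in E1, E2.
      assert (E3 : (N z * Cconj (z * q z))%C = (G z * T z)%C).
      { unfold G. transitivity (N z * / (z * z * z) * (z * z * z * Cconj (z * q z)))%C.
        - field. exact Hz0.
        - f_equal. unfold T, q. rewrite <- Hzz.
          rewrite ?Cmult_conj, ?Cplus_conj, ?Cmult_conj. ring. }
      assert (E4 : Cmod (W z * p z) ^ 2 <= Cmod (p z) ^ 2).
      { rewrite Cmod_mult. assert (Hw := Hb z ltac:(lra)).
        apply pow_incr. split.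
        - apply Rmult_le_pos; apply Cmod_ge_0.
        - assert (H0 := Cmod_ge_0 (p z)). nra. }
      assert (E5 : Cmod (z * q z) ^ 2 + 2 * Re (N z * Cconj (z * q z))%C <= Cmod (W z * p z) ^ 2).
      { replace (W z * p z)%C with (z * q z + N z)%C by (unfold N; ring).
        rewrite !Cmod2_alt. set (Q := (z * q z)%C). destruct Q as [x y]. destruct (N z) as [u v].
        unfold Re, Im, Cconj, Cplus, Cmult; simpl. nra. }
      rewrite E3 in E5. rewrite Cmod_mult, Rpow_mult_distr, <- Hrho, E2 in E5.
      rewrite E1 in E4. rewrite Cmod_1 in E4.
      unfold K. rewrite re_plus, re_RtoC, re_scal_l.
      replace (Re (P z - G z * T z)%C) with (Re (P z) - Re (G z * T z)%C) by reflexivity.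
      replace (Re (P z)) with
        (Re (Cconj 1 * s1 * z + Cconj 1 * s2 * (z * z) + RtoC rho * (Cconj s1 * s2 * z))%C
         - rho * Re (Cconj c1 * h2 * z + Cconj c1 * h3 * (z * z) + RtoC rho * (Cconj h2 * h3 * z))%C).
      + unfold kappa. nra.
      + unfold P. rewrite <- re_scal_l.
        match goal with |- Re ?a - Re ?b = Re ?c =>
          change (Re a - Re b) with (Re (a - b)%C); f_equal end.
        replace (Cconj 1) with (RtoC 1)
          by (unfold Cconj, RtoC; simpl; f_equal; ring). ring. }
  rewrite re_RtoC in Hk. unfold kappa in Hk.
  assert (R0 : 0 < rho) by (unfold rho; nra).
  assert (R1 : rho < 1) by (unfold rho; nra).
  replace (r ^ 6) with (rho * rho * rho) by (unfold rho; ring).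
  assert (Q1 := pow2_ge_0 (Cmod s1)). assert (Q2 := pow2_ge_0 (Cmod s2)).
  assert (Q3 := pow2_ge_0 (Cmod c1)). assert (Q4 := pow2_ge_0 (Cmod h2)).
  assert (R2 : rho * rho <= 1) by nra. assert (R3 : rho * rho * rho <= rho) by nra.
  assert (R4 : rho * rho * rho <= rho * rho) by nra.
  nra.
Qed.

(** The hypothesis is quadratic in [t] and strongest at t = conj(c) a / D with D = 1 - |c|^2, where
    a + t c = a / D. If D = 0, the case t = 0 already forces a = 0. This converts contractivity of
    the Toeplitz matrix into bounds for single coefficients. *)
Lemma shift_optimal (a c : C) (A : R) : A <= 1 - Cmod c ^ 2 ->
  (forall t : C, Cmod (a + t * c) ^ 2 <= A + Cmod t ^ 2) ->
  Cmod a ^ 2 <= A * (1 - Cmod c ^ 2).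
Proof.
  intros HA H. set (D := 1 - Cmod c ^ 2) in *.
  assert (H0 := H 0). replace (a + 0 * c)%C with a in H0 by ring.
  rewrite Cmod_0 in H0.
  assert (Ha := pow2_ge_0 (Cmod a)).
  destruct (Rle_lt_or_eq_dec 0 D ltac:(lra)) as [HD|HD]; [|nra].
  assert (HDn : RtoC D <> 0) by (intros E; apply RtoC_inj in E; lra).
  specialize (H (Cconj c * a / RtoC D)%C).
  replace (a + Cconj c * a / RtoC D * c)%C with (a / RtoC D)%C in H.
  - rewrite !Cmod_div, Cmod_mult, Cmod_conj, Cmod_R, Rabs_pos_eq in H by (lra || assumption).
    unfold Rdiv in H. rewrite !Rpow_mult_distr, pow_inv in H.
    assert (E : D ^ 2 * / D ^ 2 = 1) by (apply Rinv_r; nra).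
    apply (Rmult_le_compat_r (D ^ 2)) in H; [|nra].
    replace (Cmod a ^ 2 * / D ^ 2 * D ^ 2) with (Cmod a ^ 2) in H by (field; lra).
    replace ((A + Cmod c ^ 2 * Cmod a ^ 2 * / D ^ 2) * D ^ 2)
      with (A * D ^ 2 + Cmod c ^ 2 * Cmod a ^ 2) in H by (field; lra).
    apply Rmult_le_reg_r with D; [exact HD|].
    replace (Cmod c ^ 2) with (1 - D) in H by (unfold D; ring). nra.
  - transitivity (a * (RtoC D + c * Cconj c) / RtoC D)%C; [|field; exact HDn].
    rewrite <- Cmod2_conj, <- RtoC_plus.
    replace (D + Cmod c ^ 2) with 1 by (unfold D; ring). now rewrite Cmult_1_r.
Qed.

(** By the triangle inequality, AM-GM on the term with [c3], and [y <= D], the modulus is at most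
    1/2 + 5 D / 2 - D^2. This is increasing on [0, 1] and equals 2 at D = 1, that is, at c1 = 0.
    From [b] only b <= 1 and 1 - b^2 <= 1 enter. *)
Lemma hankel_functional_bound (c1 c2 c3 : C) (b : R) : 0 <= b <= 1 ->
  (forall s1 s2, Cmod c1 ^ 2 + Cmod (c2 + s1 * c1) ^ 2 + Cmod (c3 + s1 * c2 + s2 * c1) ^ 2
     <= 1 + Cmod s1 ^ 2 + Cmod s2 ^ 2) ->
  Cmod (3 * c1 * c3 - 2 * c2 ^ 2 + RtoC (b / 2) * c1 ^ 2 * c2
        + RtoC ((1 - b ^ 2) / 2) * c1 ^ 4) <= 2.
Proof.
  intros Hb H.
  set (c := Cmod c1). set (y := Cmod c2). set (v := Cmod c3).
  set (D := 1 - c ^ 2).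
  assert (Hc : 0 <= c) by apply Cmod_ge_0. assert (Hy : 0 <= y) by apply Cmod_ge_0.
  assert (Hv : 0 <= v) by apply Cmod_ge_0.
  (* With s2 = 0 and the last square dropped, the free parameter is s1 and the bound concerns [c2];
     with s1 = 0 and free s2, the next assertion bounds [c3]. *)
  assert (HyD : y ^ 2 <= D * D).
  { apply shift_optimal; [unfold D, c; lra|]. intros t.
    specialize (H t 0). rewrite Cmod_0 in H.
    assert (H1 := pow2_ge_0 (Cmod (c3 + t * c2 + 0 * c1))). unfold D, c. lra. }
  assert (Hv2 : v ^ 2 <= (D - y ^ 2) * D).
  { apply shift_optimal; [unfold D, c; assert (H1 := pow2_ge_0 y); lra|]. intros t.
    specialize (H 0 t). rewrite Cmod_0 in H.
    replace (c2 + 0 * c1)%C with c2 in H by ring.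
    replace (c3 + 0 * c2 + t * c1)%C with (c3 + t * c1)%C in H by ring.
    unfold D, c, y. lra. }
  assert (HD : 0 <= D).
  { specialize (H 0 0). rewrite Cmod_0 in H. fold c in H.
    assert (H1 := pow2_ge_0 (Cmod (c3 + 0 * c2 + 0 * c1))).
    assert (H2 := pow2_ge_0 (Cmod (c2 + 0 * c1))). unfold D. lra. }
  assert (HyD' : y <= D) by nra.
  (* AM-GM on [c D] and [v] *)
  assert (HcD : 2 * (c * v) <= D - y ^ 2 + c ^ 2 * D).
  { destruct (Rle_lt_or_eq_dec 0 D HD) as [HD0|HD0].
    - apply Rmult_le_reg_r with D; [exact HD0|].
      assert (H1 := pow2_ge_0 (v - c * D)). nra.
    - rewrite <- HD0 in Hv2. assert (v = 0) by nra. assert (y = 0) by nra.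
      subst v. rewrite H0, H1, <- HD0. lra. }
  apply Rle_trans with (3 * (c * v) + 2 * y ^ 2 + b / 2 * (c ^ 2 * y) + (1 - b ^ 2) / 2 * c ^ 4).
  - eapply Rle_trans; [apply Cmod_triangle|]. apply Rplus_le_compat.
    + eapply Rle_trans; [apply Cmod_triangle|]. apply Rplus_le_compat.
      * eapply Rle_trans; [apply Cmod_triangle|]. apply Rplus_le_compat.
        -- rewrite !Cmod_mult, Cmod_R, Rabs_pos_eq by lra. unfold c, v. lra.
        -- rewrite Cmod_opp, Cmod_mult, Cmod_pow, Cmod_R, Rabs_pos_eq by lra. unfold y. lra.
      * rewrite !Cmod_mult, Cmod_pow, Cmod_R, Rabs_pos_eq by lra. unfold c, y. lra.
    + rewrite Cmod_mult, Cmod_pow, Cmod_R, Rabs_pos_eq by nra. unfold c. lra.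
  - assert (E : c ^ 2 = 1 - D) by (unfold D; ring).
    replace (c ^ 4) with (c ^ 2 * c ^ 2) by ring. rewrite E in *.
    assert (H1 : D <= 1) by (assert (H1 := pow2_ge_0 c); lra).
    assert (H2 : b / 2 * ((1 - D) * y) <= 1 / 2 * ((1 - D) * D)).
    { apply Rmult_le_compat; try lra; [apply Rmult_le_pos; lra|].
      apply Rmult_le_compat_l; lra. }
    assert (H3 : (1 - b ^ 2) / 2 * ((1 - D) * (1 - D)) <= 1 / 2 * ((1 - D) * (1 - D))).
    { apply Rmult_le_compat_r; nra. }
    nra.
Qed.

(** * Complex power series *)

Notation is_Cseries := (@is_series C_AbsRing C_NormedModule).

Lemma sum_n_fst (u : nat -> C) (n : nat) :
  fst (@sum_n C_AbelianMonoid u n) = sum_n (fun k => fst (u k)) n.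
Proof.
  induction n as [|n IH]; [now rewrite !sum_O|].
  rewrite !sum_Sn, <- IH. reflexivity.
Qed.

Lemma sum_n_snd (u : nat -> C) (n : nat) :
  snd (@sum_n C_AbelianMonoid u n) = sum_n (fun k => snd (u k)) n.
Proof.
  induction n as [|n IH]; [now rewrite !sum_O|].
  rewrite !sum_Sn, <- IH. reflexivity.
Qed.

Lemma is_series_ball (u : nat -> R) (l : R) :
  is_series u l <->
  forall e : posreal, exists N, forall n, (N <= n)%nat -> Rabs (sum_n u n - l) < e.
Proof.
  exact (@filterlim_locally nat R_UniformSpace eventually
           (@filter_filter _ _ eventually_filter) (sum_n u) l).
Qed.

Lemma is_Cseries_ball (u : nat -> C) (l : C) :
  is_Cseries u l <->
  forall e : posreal, exists N, forall n, (N <= n)%nat ->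
    Rabs (fst (@sum_n C_AbelianMonoid u n) - fst l) < e /\
    Rabs (snd (@sum_n C_AbelianMonoid u n) - snd l) < e.
Proof.
  exact (@filterlim_locally nat C_UniformSpace eventually
           (@filter_filter _ _ eventually_filter) (@sum_n C_AbelianMonoid u) l).
Qed.

(** The uniform structure on [C] is the product one, so convergence is componentwise and results on
    real series carry over. *)
Lemma is_Cseries_iff (u : nat -> C) (l : C) :
  is_Cseries u l <->
  is_series (fun n => fst (u n)) (fst l) /\ is_series (fun n => snd (u n)) (snd l).
Proof.
  rewrite is_Cseries_ball, !is_series_ball. split.
  - intros H. split; intros e; destruct (H e) as [N HN]; exists N; intros n Hn;
      destruct (HN n Hn) as [H1 H2].
    + rewrite <- sum_n_fst. exact H1.
    + rewrite <- sum_n_snd. exact H2.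
  - intros [H1 H2] e. destruct (H1 e) as [N1 K1]. destruct (H2 e) as [N2 K2].
    exists (max N1 N2). intros n Hn. split.
    + rewrite sum_n_fst. apply K1. lia.
    + rewrite sum_n_snd. apply K2. lia.
Qed.

Lemma is_Cseries_ext (u v : nat -> C) (l : C) :
  (forall n, u n = v n) -> is_Cseries u l -> is_Cseries v l.
Proof. apply is_series_ext. Qed.

Lemma is_Cseries_scal (c : C) (u : nat -> C) (l : C) :
  is_Cseries u l -> is_Cseries (fun n => (c * u n)%C) (c * l)%C.
Proof. apply (@is_series_scal C_AbsRing C_NormedModule). Qed.

Lemma is_Cseries_minus (u v : nat -> C) (l l' : C) :
  is_Cseries u l -> is_Cseries v l' -> is_Cseries (fun n => (u n - v n)%C) (l - l')%C.
Proof. apply (@is_series_minus C_AbsRing C_NormedModule). Qed.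

Lemma is_Cseries_decr (u : nat -> C) (l : C) :
  is_Cseries (fun n => u (S n)) l -> is_Cseries u (u 0%nat + l)%C.
Proof.
  intros H. apply (@is_series_decr_1 C_AbsRing C_NormedModule).
  match goal with |- is_Cseries _ ?x => change x with ((u 0%nat + l) + - u 0%nat)%C end.
  replace ((u 0%nat + l) + - u 0%nat)%C with l by ring. exact H.
Qed.

Lemma Cmod_sum_n (u : nat -> C) (n : nat) :
  Cmod (@sum_n C_AbelianMonoid u n) <= sum_n (fun k => Cmod (u k)) n.
Proof.
  induction n as [|n IH]; [rewrite !sum_O; lra|].
  rewrite !sum_Sn. eapply Rle_trans; [apply Cmod_triangle|].
  apply Rplus_le_compat_r, IH.
Qed.

Lemma is_Cseries_near (u : nat -> C) (l : C) (e : R) : 0 < e -> is_Cseries u l ->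
  exists N, forall n, (N <= n)%nat -> Cmod (@sum_n C_AbelianMonoid u n - l) < e.
Proof.
  intros He H. assert (He2 : 0 < e / 2) by lra.
  destruct (proj1 (is_Cseries_ball u l) H (mkposreal _ He2)) as [N HN]. cbn [pos] in HN.
  exists N. intros n Hn. destruct (HN n Hn) as [K1 K2].
  apply Rle_lt_trans with (1 := Cmod_le_abs _ _).
  change (Rabs (fst (@sum_n C_AbelianMonoid u n) - fst l) +
          Rabs (snd (@sum_n C_AbelianMonoid u n) - snd l) < e).
  lra.
Qed.

Lemma sum_n_pos_le (v : nat -> R) (L : R) (n : nat) :
  (forall k, 0 <= v k) -> is_series v L -> sum_n v n <= L.
Proof.
  intros Hv H. apply (is_lim_seq_incr_compare (sum_n v)); [exact H|].
  intros k. rewrite sum_Sn. unfold plus; simpl. specialize (Hv (S k)). lra.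
Qed.

Lemma Cmod_series_le_partial (u : nat -> C) (l : C) (L : R) :
  (forall n, sum_n (fun k => Cmod (u k)) n <= L) -> is_Cseries u l -> Cmod l <= L.
Proof.
  intros HL Hu. apply le_epsilon. intros e He.
  destruct (is_Cseries_near u l e He Hu) as [N HN]. specialize (HN N (le_n N)).
  assert (H1 := Cmod_minus_ge l (@sum_n C_AbelianMonoid u N)).
  rewrite Cmod_minus_sym in H1.
  assert (H2 := Cmod_sum_n u N). specialize (HL N). lra.
Qed.

Lemma Cmod_series_le (u : nat -> C) (v : nat -> R) (l : C) (L : R) :
  (forall n, Cmod (u n) <= v n) -> is_Cseries u l -> is_series v L -> Cmod l <= L.
Proof.
  intros Huv Hu Hv. apply Cmod_series_le_partial with (2 := Hu). intros n.
  apply Rle_trans with (sum_n v n); [apply sum_n_m_le, Huv|].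
  apply sum_n_pos_le; [|exact Hv]. intros k.
  apply Rle_trans with (2 := Huv k), Cmod_ge_0.
Qed.

Definition Csum (u : nat -> C) : C :=
  (Series (fun n => fst (u n)), Series (fun n => snd (u n))).

Lemma Csum_correct (u : nat -> C) (v : nat -> R) :
  (forall n, Cmod (u n) <= v n) -> ex_series v -> is_Cseries u (Csum u).
Proof.
  intros Huv Hv. apply is_Cseries_iff. split; simpl; apply Series_correct.
  - apply (@ex_series_le R_AbsRing R_CompleteNormedModule) with v; [|exact Hv].
    intros n. apply Rle_trans with (2 := Huv n). apply re_le_Cmod.
  - apply (@ex_series_le R_AbsRing R_CompleteNormedModule) with v; [|exact Hv].
    intros n. apply Rle_trans with (2 := Huv n). apply im_le_Cmod.
Qed.

Lemma Csum_unique (u : nat -> C) (l : C) : is_Cseries u l -> Csum u = l.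
Proof.
  rewrite is_Cseries_iff. intros [H1 H2]. unfold Csum.
  apply injective_projections; simpl; apply is_series_unique; assumption.
Qed.

Lemma is_Cseries_bounded (u : nat -> C) (l : C) :
  is_Cseries u l -> exists M, forall n, Cmod (u n) <= M.
Proof.
  intros H. destruct (is_Cseries_near u l 1 Rlt_0_1 H) as [N HN].
  (* A term of index at most [N] is bounded by the sum of moduli; a later one is the difference of
     two partial sums within 1 of [l], whence the 2. *)
  exists (sum_n (fun k => Cmod (u k)) N + 2). intros n.
  assert (Hpos : forall m, 0 <= sum_n (fun k => Cmod (u k)) m).
  { intros m. induction m as [|m IH].
    - rewrite sum_O. apply Cmod_ge_0.
    - rewrite sum_Sn. apply Rplus_le_le_0_compat; [exact IH|apply Cmod_ge_0]. }
  destruct (le_lt_dec n N) as [Hn|Hn].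
  - apply Rle_trans with (sum_n (fun k => Cmod (u k)) N); [|lra].
    clear HN. induction N as [|N IH].
    + replace n with 0%nat by lia. rewrite sum_O. lra.
    + rewrite sum_Sn. unfold plus; simpl. destruct (le_lt_dec n N) as [Hn'|Hn'].
      * specialize (IH Hn'). assert (H0 := Cmod_ge_0 (u (S N))). lra.
      * replace n with (S N) by lia. specialize (Hpos N). lra.
  - destruct n as [|n]; [lia|].
    assert (H1 := HN (S n) ltac:(lia)). assert (H2 := HN n ltac:(lia)).
    rewrite sum_Sn in H1.
    assert (H3 : u (S n) = ((plus (@sum_n C_AbelianMonoid u n) (u (S n)) - l)
       - (@sum_n C_AbelianMonoid u n - l))%C).
    { change (u (S n) = ((@sum_n C_AbelianMonoid u n + u (S n)) - l)
       - (@sum_n C_AbelianMonoid u n - l))%C. ring. }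
    rewrite H3. eapply Rle_trans; [apply Cmod_triangle|]. rewrite Cmod_opp.
    specialize (Hpos N). unfold C_AbelianMonoid in *. lra.
Qed.

Lemma pow_n_Cpow (z : C) (n : nat) : @pow_n C_Ring z n = (z ^ n)%C.
Proof. induction n as [|n IH]; [reflexivity|]. simpl. rewrite IH. reflexivity. Qed.

Lemma is_pseries_iff (a : nat -> C) (z l : C) :
  @is_pseries C_AbsRing C_NormedModule a z l <-> is_Cseries (fun n => (a n * z ^ n)%C) l.
Proof.
  split; apply is_series_ext; intros n; rewrite <- pow_n_Cpow;
    [rewrite Cmult_comm|rewrite Cmult_comm]; reflexivity.
Qed.

Definition CS (a : nat -> C) (z : C) : C := Csum (fun n => (a n * z ^ n)%C).

(* The power series with coefficients [a] has radius of convergence at least 1. *)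
Definition rad1 (a : nat -> C) : Prop :=
  forall rho, 0 < rho < 1 -> exists M, forall n, Cmod (a n) * rho ^ n <= M.

Lemma has_expansion_rad1 (f : C -> C) (a : nat -> C) : has_expansion f a -> rad1 a.
Proof.
  intros H rho Hrho.
  assert (Hd : unit_disk (RtoC rho)).
  { unfold unit_disk. rewrite Cmod_R, Rabs_pos_eq; lra. }
  apply H, is_pseries_iff, is_Cseries_bounded in Hd. destruct Hd as [M HM].
  exists M. intros n. specialize (HM n).
  rewrite Cmod_mult, Cmod_pow, Cmod_R, Rabs_pos_eq in HM by lra. exact HM.
Qed.

Lemma has_expansion_CS (f : C -> C) (a : nat -> C) (z : C) :
  has_expansion f a -> Cmod z < 1 -> f z = CS a z.
Proof. intros H Hz. symmetry. apply Csum_unique, is_pseries_iff, H, Hz. Qed.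

(** Comparison with the geometric series of ratio rho / s, where [s] is the midpoint of [rho] and
    1. *)
Lemma rad1_summable (a : nat -> C) (rho : R) : rad1 a -> 0 <= rho < 1 ->
  ex_series (fun n => Cmod (a n) * rho ^ n).
Proof.
  intros H Hrho. set (s := (1 + rho) / 2).
  destruct (H s) as [M HM]; [unfold s; lra|].
  assert (Hs : 0 < s) by (unfold s; lra).
  apply (@ex_series_le R_AbsRing R_CompleteNormedModule) with (fun n => M * (rho / s) ^ n).
  - intros n. change (Rabs (Cmod (a n) * rho ^ n) <= M * (rho / s) ^ n).
    rewrite Rabs_pos_eq by (apply Rmult_le_pos; [apply Cmod_ge_0|apply pow_le; lra]).
    unfold Rdiv. rewrite Rpow_mult_distr, pow_inv.
    assert (Hp : 0 < s ^ n) by (apply pow_lt, Hs).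
    assert (Hq : 0 <= rho ^ n) by (apply pow_le; lra).
    replace (Cmod (a n) * rho ^ n) with ((Cmod (a n) * s ^ n) * (rho ^ n * / s ^ n))
      by (field; lra).
    apply Rmult_le_compat_r; [|apply HM].
    apply Rmult_le_pos; [exact Hq|]. left. apply Rinv_0_lt_compat, Hp.
  - apply (@ex_series_scal_l R_AbsRing). apply ex_series_geom.
    rewrite Rabs_pos_eq by (apply Rdiv_le_0_compat; lra).
    apply Rmult_lt_reg_r with s; [exact Hs|].
    unfold Rdiv. rewrite Rmult_assoc, Rinv_l by lra. unfold s. lra.
Qed.

Lemma CS_correct (a : nat -> C) (z : C) : rad1 a -> Cmod z < 1 ->
  is_Cseries (fun n => (a n * z ^ n)%C) (CS a z).
Proof.
  intros H Hz. apply Csum_correct with (fun n => Cmod (a n) * Cmod z ^ n).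
  - intros n. rewrite Cmod_mult, Cmod_pow. lra.
  - apply rad1_summable; [exact H|]. split; [apply Cmod_ge_0|exact Hz].
Qed.

Lemma CS_expansion (a : nat -> C) : rad1 a -> has_expansion (CS a) a.
Proof. intros H z Hz. apply is_pseries_iff, CS_correct; assumption. Qed.

Lemma CS_ext (a b : nat -> C) (z : C) : (forall n, a n = b n) -> CS a z = CS b z.
Proof.
  intros H. unfold CS, Csum. f_equal; apply Series_ext; intros n; now rewrite H.
Qed.

(** With 1/q = 1 + x, Bernoulli gives n x <= (1 + x)^n = q^(-n), so n q^n <= 1/x. *)
Lemma nat_mult_geom_bounded (q : R) : 0 < q < 1 -> exists M, forall n, INR n * q ^ n <= M.
Proof.
  intros Hq. set (x := / q - 1).
  assert (Hx : 0 < x).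
  { unfold x. apply Rlt_0_minus. rewrite <- Rinv_1. apply Rinv_lt_contravar; lra. }
  exists (/ x). intros n.
  assert (Hb : 1 + INR n * x <= (1 + x) ^ n) by (apply poly, Hx).
  assert (Hp : 0 < q ^ n) by (apply pow_lt; lra).
  assert (E : (1 + x) ^ n * q ^ n = 1).
  { rewrite <- Rpow_mult_distr. replace ((1 + x) * q) with 1 by (unfold x; field; lra).
    apply pow1. }
  apply Rmult_le_reg_r with x; [exact Hx|]. rewrite Rinv_l by lra. nra.
Qed.

Lemma rad1_nmult (a : nat -> C) : rad1 a -> rad1 (fun n => (RtoC (INR n) * a n)%C).
Proof.
  intros H rho Hrho. set (s := (1 + rho) / 2).
  destruct (H s) as [M HM]; [unfold s; lra|].
  assert (Hs : 0 < s) by (unfold s; lra).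
  destruct (nat_mult_geom_bounded (rho / s)) as [M' HM'].
  { split; [apply Rdiv_lt_0_compat; lra|].
    apply Rmult_lt_reg_r with s; [exact Hs|].
    unfold Rdiv. rewrite Rmult_assoc, Rinv_l by lra. unfold s. lra. }
  exists (M * M'). intros n.
  rewrite Cmod_mult, Cmod_R, Rabs_pos_eq by apply pos_INR.
  replace (INR n * Cmod (a n) * rho ^ n)
    with ((Cmod (a n) * s ^ n) * (INR n * (rho / s) ^ n)).
  - apply Rmult_le_compat; auto.
    + apply Rmult_le_pos; [apply Cmod_ge_0|apply pow_le; lra].
    + apply Rmult_le_pos; [apply pos_INR|]. apply pow_le, Rdiv_le_0_compat; lra.
  - unfold Rdiv. rewrite Rpow_mult_distr, pow_inv. field. apply pow_nonzero. lra.
Qed.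

Lemma rad1_shift (a : nat -> C) : rad1 a -> rad1 (fun n => a (S n)).
Proof.
  intros H rho Hrho. destruct (H rho Hrho) as [M HM]. exists (M / rho). intros n.
  apply Rmult_le_reg_r with rho; [lra|].
  replace (M / rho * rho) with M by (field; lra).
  specialize (HM (S n)). simpl in HM. lra.
Qed.

Definition dcoef (a : nat -> C) (n : nat) : C := (RtoC (INR (S n)) * a (S n))%C.

Lemma rad1_dcoef (a : nat -> C) : rad1 a -> rad1 (dcoef a).
Proof. intros H. apply (rad1_shift _ (rad1_nmult _ H)). Qed.

(** The remainder e_n satisfies e_(n+1) = w e_n + (n + 1) z^n (w - z)^2, and (n + 1)^2 + (n + 1) <=
    (n + 2)^2 closes the induction. The factor rho^2 on the left avoids the exponent n - 1 and any
    division. *)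
Lemma Cpow_taylor_bound (z w : C) (rho : R) (n : nat) :
  Cmod z <= rho -> Cmod w <= rho ->
  rho ^ 2 * Cmod (w ^ S n - z ^ S n - RtoC (INR (S n)) * z ^ n * (w - z))
  <= INR (S n) ^ 2 * rho ^ S n * Cmod (w - z) ^ 2.
Proof.
  intros Hz Hw. assert (H0 := Cmod_ge_0 z).
  set (h := Cmod (w - z)). assert (Hh : 0 <= h) by apply Cmod_ge_0.
  induction n as [|n IH].
  - replace (w ^ 1 - z ^ 1 - RtoC (INR 1) * z ^ 0 * (w - z))%C with (RtoC 0)
      by (simpl; ring).
    rewrite Cmod_0, Rmult_0_r. repeat apply Rmult_le_pos; simpl; lra || nra.
  - set (e := (w ^ S n - z ^ S n - RtoC (INR (S n)) * z ^ n * (w - z))%C) in *.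
    replace (w ^ S (S n) - z ^ S (S n) - RtoC (INR (S (S n))) * z ^ S n * (w - z))%C
      with (w * e + RtoC (INR (S n)) * z ^ n * ((w - z) * (w - z)))%C.
    2: { unfold e. rewrite (S_INR (S n)), RtoC_plus. simpl. ring. }
    assert (Hzn : Cmod z ^ n <= rho ^ n) by (apply pow_incr; lra).
    assert (Hrn : 0 <= rho ^ n) by (apply pow_le; lra).
    assert (HN := pos_INR (S n)).
    apply Rle_trans with (rho ^ 2 * (rho * Cmod e + INR (S n) * rho ^ n * h ^ 2)).
    + apply Rmult_le_compat_l; [nra|].
      eapply Rle_trans; [apply Cmod_triangle|]. apply Rplus_le_compat.
      * rewrite Cmod_mult. apply Rmult_le_compat_r; [apply Cmod_ge_0|exact Hw].
      * rewrite !Cmod_mult, Cmod_R, Rabs_pos_eq, Cmod_pow by exact HN.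
        fold h. replace (h ^ 2) with (h * h) by ring.
        apply Rmult_le_compat_r; [nra|]. apply Rmult_le_compat_l; assumption.
    + replace (rho ^ 2 * (rho * Cmod e + INR (S n) * rho ^ n * h ^ 2))
        with (rho * (rho ^ 2 * Cmod e) + INR (S n) * rho ^ S (S n) * h ^ 2) by (simpl; ring).
      assert (Hr2 : 0 <= rho ^ S (S n) * h ^ 2).
      { apply Rmult_le_pos; [apply pow_le; lra|apply pow2_ge_0]. }
      assert (IH' := Rmult_le_compat_l rho _ _ ltac:(lra) IH).
      replace (rho * (INR (S n) ^ 2 * rho ^ S n * h ^ 2))
        with (INR (S n) ^ 2 * (rho ^ S (S n) * h ^ 2)) in IH' by (simpl; ring).
      rewrite (S_INR (S n)). nra.
Qed.

Lemma CS_cder (a : nat -> C) (z : C) : rad1 a -> Cmod z < 1 ->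
  cder (CS a) z (CS (dcoef a) z).
Proof.
  intros Ha Hz. assert (H0 := Cmod_ge_0 z).
  set (rho := (1 + Cmod z) / 2).
  assert (Hrho : 0 < rho < 1) by (unfold rho; lra).
  (* The remainders of the monomials grow like n^2 rho^n, so the dominating series is that of n^2
     a_n at a radius strictly between |z| and 1. *)
  set (b := fun n => (RtoC (INR n) * (RtoC (INR n) * a n))%C).
  assert (Hb : ex_series (fun n => Cmod (b n) * rho ^ n)).
  { apply rad1_summable; [|lra]. apply rad1_nmult, rad1_nmult, Ha. }
  destruct Hb as [S0 HS].
  apply cder_quadratic with (S0 / rho ^ 2) ((1 - Cmod z) / 2); [lra|].
  intros w Hw.
  assert (Hwr : Cmod w <= rho).
  { assert (H1 := Cmod_minus_ge w z). unfold rho. lra. }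
  assert (Hw1 : Cmod w < 1) by lra.
  assert (Kw := CS_correct a w Ha Hw1). assert (Kz := CS_correct a z Ha Hz).
  assert (Kd := CS_correct _ z (rad1_dcoef a Ha) Hz).
  (* The derived series is padded with a zero at index 0, so that index [n] in all three series
     refers to the same power w^n - z^n. *)
  assert (Kd' : is_Cseries (fun n => match n with O => RtoC 0 | S k => (dcoef a k * z ^ k)%C end)
     (CS (dcoef a) z)).
  { replace (CS (dcoef a) z) with (0 + CS (dcoef a) z)%C by ring.
    apply (is_Cseries_decr (fun n => match n with O => RtoC 0 | S k => (dcoef a k * z ^ k)%C end)).
    exact Kd. }
  assert (K := is_Cseries_minus _ _ _ _ (is_Cseries_minus _ _ _ _ Kw Kz)
                 (is_Cseries_scal (w - z) _ _ Kd')).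
  rewrite (Cmult_comm (CS (dcoef a) z)).
  apply (Cmod_series_le _ (fun n => (Cmod (w - z) ^ 2 / rho ^ 2) * (Cmod (b n) * rho ^ n)))
    with (2 := K).
  - intros [|n].
    + replace (a 0%nat * w ^ 0 - a 0%nat * z ^ 0 - (w - z) * 0)%C with (RtoC 0) by (simpl; ring).
      rewrite Cmod_0. apply Rmult_le_pos.
      * apply Rdiv_le_0_compat; [apply pow2_ge_0|nra].
      * apply Rmult_le_pos; [apply Cmod_ge_0|simpl; lra].
    + replace (a (S n) * w ^ S n - a (S n) * z ^ S n - (w - z) * (dcoef a n * z ^ n))%C
        with (a (S n) * (w ^ S n - z ^ S n - RtoC (INR (S n)) * z ^ n * (w - z)))%C
        by (unfold dcoef; ring).
      assert (E := Cpow_taylor_bound z w rho n ltac:(unfold rho; lra) Hwr).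
      unfold b. rewrite !Cmod_mult, Cmod_R, Rabs_pos_eq by apply pos_INR.
      set (e := Cmod (w ^ S n - z ^ S n - RtoC (INR (S n)) * z ^ n * (w - z))) in *.
      apply Rmult_le_reg_l with (rho ^ 2); [nra|].
      replace (rho ^ 2 * (Cmod (a (S n)) * e)) with (Cmod (a (S n)) * (rho ^ 2 * e)) by ring.
      apply Rle_trans with (1 := Rmult_le_compat_l _ _ _ (Cmod_ge_0 _) E).
      right. field. lra.
  - replace (S0 / rho ^ 2 * Cmod (w - z) ^ 2) with (Cmod (w - z) ^ 2 / rho ^ 2 * S0)
      by (field; lra).
    apply (@is_series_scal R_AbsRing R_NormedModule), HS.
Qed.

Lemma CS_hol (a : nat -> C) : rad1 a -> hol (fun z => Cmod z < 1) (CS a).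
Proof.
  intros Ha. exists (CS (dcoef a)). intros z Hz. split; [apply CS_cder; assumption|].
  eapply cder_ccont, CS_cder; [apply rad1_dcoef, Ha|exact Hz].
Qed.

Lemma CS_decr (a : nat -> C) (z : C) : rad1 a -> Cmod z < 1 ->
  CS a z = (a 0%nat + z * CS (fun n => a (S n)) z)%C.
Proof.
  intros Ha Hz. apply Csum_unique.
  replace (a 0%nat) with (a 0%nat * z ^ 0)%C at 1 by (simpl; ring).
  apply (is_Cseries_decr (fun n => (a n * z ^ n)%C)).
  apply is_Cseries_ext with (fun n => (z * (a (S n) * z ^ n))%C).
  { intros n. simpl. ring. }
  apply is_Cseries_scal, CS_correct; [apply rad1_shift, Ha|exact Hz].
Qed.

Lemma CS_bigO0 (a : nat -> C) : rad1 a -> bigO 0 (CS a).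
Proof.
  intros Ha. apply bigO_ccont. eapply cder_ccont, CS_cder; [exact Ha|].
  rewrite Cmod_0. lra.
Qed.

Lemma CS_0 (a : nat -> C) : rad1 a -> CS a 0 = a 0%nat.
Proof. intros Ha. rewrite CS_decr by (assumption || (rewrite Cmod_0; lra)). ring. Qed.

(** * Complex exponential, sine and arcsine *)

Definition cexp (z : C) : C := cpolar (exp (Re z)) (Im z).

Lemma cpolar_mult (r s t u : R) : (cpolar r t * cpolar s u)%C = cpolar (r * s) (t + u).
Proof.
  unfold cpolar, Cmult; simpl. rewrite cos_plus, sin_plus. f_equal; ring.
Qed.

Lemma cexp_plus (z w : C) : cexp (z + w)%C = (cexp z * cexp w)%C.
Proof.
  unfold cexp. rewrite re_plus, im_plus, exp_plus. symmetry. apply cpolar_mult.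
Qed.

Lemma cexp_0 : cexp 0 = 1.
Proof.
  unfold cexp, cpolar. rewrite re_RtoC, im_RtoC, exp_0, cos_0, sin_0.
  unfold RtoC. f_equal; ring.
Qed.

Lemma cexp_opp_r (z : C) : (cexp z * cexp (- z))%C = 1.
Proof. rewrite <- cexp_plus, Cplus_opp_r. apply cexp_0. Qed.

Lemma Cmod_cexp (z : C) : Cmod (cexp z) = exp (Re z).
Proof. apply Cmod_cpolar. left. apply exp_pos. Qed.

Lemma abs_sin_le (t : R) : Rabs (sin t) <= Rabs t.
Proof.
  assert (H := bounded_variation sin cos 1 0 t). rewrite sin_0, !Rminus_0_r in H.
  rewrite <- (Rmult_1_l (Rabs t)). apply H. intros u _. split.
  - apply is_derive_Reals, derivable_pt_lim_sin.
  - apply Rabs_le. generalize (COS_bound u). lra.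
Qed.

Lemma one_minus_cos_bound (t : R) : 0 <= 1 - cos t <= t ^ 2 / 2.
Proof.
  replace (cos t) with (1 - 2 * sin (t / 2) * sin (t / 2))
    by (rewrite <- cos_2a_sin; f_equal; field).
  assert (H := abs_sin_le (t / 2)).
  apply Rsqr_le_abs_1 in H. unfold Rsqr in H. nra.
Qed.

Lemma abs_sin_sub_id_le (t : R) : Rabs (sin t - t) <= t ^ 2 / 2 * Rabs t.
Proof.
  assert (H := bounded_variation (fun u => sin u - u) (fun u => cos u - 1) (t ^ 2 / 2) 0 t).
  simpl in H. rewrite sin_0, !Rminus_0_r in H. apply H. intros u Hu. split.
  - auto_derive; [exact I|ring].
  - rewrite !Rminus_0_r in Hu. apply Rsqr_le_abs_1 in Hu. unfold Rsqr in Hu.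
    generalize (one_minus_cos_bound u). intros Hc. apply Rabs_le. simpl in *. lra.
Qed.

(** Below, exp x >= 1 + x. Above, exp (-x) >= 1 - x gives exp x <= 1/(1 - x), and this is at most 1
    + x + 2 x^2 when x <= 1/2. *)
Lemma abs_exp_sub_le (x : R) : Rabs x <= 1 / 2 -> Rabs (exp x - 1 - x) <= 2 * x ^ 2.
Proof.
  intros Hx. apply Rabs_le_between in Hx.
  assert (H1 := exp_ineq1_le x). assert (H2 := exp_ineq1_le (- x)).
  assert (H3 := exp_pos x).
  assert (H4 : exp x * exp (- x) = 1) by (rewrite <- exp_plus, Rplus_opp_r; apply exp_0).
  assert (H5 : exp x * (1 - x) <= 1) by nra.
  assert (H6 : 1 <= (1 + x + 2 * x ^ 2) * (1 - x)) by nra.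
  apply Rabs_le. split; nra.
Qed.

Lemma cder_cexp (z : C) : cder cexp z (cexp z).
Proof.
  (* The estimates below give 3 |h|^2 for the real part of the remainder and 4 |h|^2 for the
     imaginary part; 10 leaves room. *)
  apply cder_quadratic with (Cmod (cexp z) * 10) (1 / 2); [lra|].
  intros w Hw. set (h := (w - z)%C) in *.
  replace (cexp w - cexp z - cexp z * h)%C with (cexp z * (cexp h - 1 - h))%C.
  2: { replace w with (z + h)%C by (unfold h; ring). rewrite cexp_plus. ring. }
  rewrite Cmod_mult, Rmult_assoc. apply Rmult_le_compat_l; [apply Cmod_ge_0|].
  assert (Hre := re_le_Cmod h). assert (Him := im_le_Cmod h).
  set (m := Cmod h) in *.
  destruct h as [x y]. unfold Re, Im in Hre, Him; simpl in Hre, Him.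
  assert (He := abs_exp_sub_le x ltac:(lra)).
  assert (Hc := one_minus_cos_bound y). assert (Hs := abs_sin_sub_id_le y).
  assert (Ex : x ^ 2 <= m ^ 2) by (rewrite <- (pow2_abs x); assert (H0 := Rabs_pos x); nra).
  assert (Ey : y ^ 2 <= m ^ 2) by (rewrite <- (pow2_abs y); assert (H0 := Rabs_pos y); nra).
  assert (Hm : 0 <= m < 1 / 2) by (split; [apply Cmod_ge_0|lra]).
  assert (He3 : exp x <= 2).
  { apply Rabs_le_between in He. apply Rabs_le_between in Hre. nra. }
  assert (Hex := exp_pos x).
  change (Cmod (exp x * cos y - 1 - x, exp x * sin y - 0 - y) <= 10 * m ^ 2).
  apply Rle_trans with (1 := Cmod_le_abs _ _).
  replace (exp x * cos y - 1 - x) with ((exp x - 1 - x) + - (exp x * (1 - cos y))) by ring.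
  replace (exp x * sin y - 0 - y)
    with (exp x * (sin y - y) + ((exp x - 1 - x) * y + x * y)) by ring.
  assert (T1 := Rabs_triang (exp x - 1 - x) (- (exp x * (1 - cos y)))).
  assert (T2 := Rabs_triang (exp x * (sin y - y)) ((exp x - 1 - x) * y + x * y)).
  assert (T3 := Rabs_triang ((exp x - 1 - x) * y) (x * y)).
  rewrite Rabs_Ropp, Rabs_mult, (Rabs_pos_eq (exp x)), (Rabs_pos_eq (1 - cos y)) in T1 by lra.
  rewrite Rabs_mult, (Rabs_pos_eq (exp x)) in T2 by lra.
  rewrite !Rabs_mult in T3.
  set (X := Rabs x) in *. set (Y := Rabs y) in *.
  assert (HX : 0 <= X) by apply Rabs_pos. assert (HY : 0 <= Y) by apply Rabs_pos.
  set (S := Rabs (sin y - y)) in *. set (E := Rabs (exp x - 1 - x)) in *.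
  assert (HS0 : 0 <= S) by apply Rabs_pos. assert (HE0 : 0 <= E) by apply Rabs_pos.
  assert (B1 : exp x * (1 - cos y) <= m ^ 2) by nra.
  assert (B2 : S <= m ^ 2 / 2).
  { apply Rle_trans with (1 := Hs). assert (0 <= y ^ 2) by apply pow2_ge_0. nra. }
  assert (B3 : exp x * S <= m ^ 2) by nra.
  assert (B4 : X * Y <= m ^ 2) by nra.
  assert (B5 : E * Y <= 2 * m ^ 2) by nra.
  lra.
Qed.

Definition csin (z : C) : C := ((cexp (Ci * z) - cexp (- Ci * z)) / (2 * Ci))%C.
Definition ccos (z : C) : C := ((cexp (Ci * z) + cexp (- Ci * z)) / 2)%C.

Lemma cder_cexp_scal (c z : C) : cder (fun w => cexp (c * w)%C) z (c * cexp (c * z))%C.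
Proof.
  apply cder_eq with (cexp (c * z) * (c * 1))%C; [|ring].
  apply (cder_comp cexp (fun w => c * w)%C); [apply cder_scal, cder_id|apply cder_cexp].
Qed.

Lemma Ci2 : (Ci * Ci)%C = (-1)%C.
Proof. unfold Ci, Cmult, RtoC, Copp; simpl. f_equal; ring. Qed.

Lemma cder_csin (z : C) : cder csin z (ccos z).
Proof.
  apply cder_ext_loc with (fun w => (/ (2 * Ci) * (cexp (Ci * w) - cexp (- Ci * w)))%C).
  { exists 1. split; [lra|]. intros w _. unfold csin, Cdiv. ring. }
  apply cder_eq with (/ (2 * Ci) * (Ci * cexp (Ci * z) - (- Ci) * cexp (- Ci * z)))%C.
  - apply cder_scal. apply cder_minus; apply cder_cexp_scal.
  - unfold ccos. field. apply Ci_nz.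
Qed.

Lemma cder_ccos (z : C) : cder ccos z (- csin z)%C.
Proof.
  apply cder_ext_loc with (fun w => (/ 2 * (cexp (Ci * w) + cexp (- Ci * w)))%C).
  { exists 1. split; [lra|]. intros w _. unfold ccos, Cdiv. ring. }
  apply cder_eq with (/ 2 * (Ci * cexp (Ci * z) + (- Ci) * cexp (- Ci * z)))%C.
  - apply cder_scal. apply cder_plus; apply cder_cexp_scal.
  - unfold csin. set (a := cexp (Ci * z)). set (b := cexp (- Ci * z)).
    transitivity ((Ci * Ci) * (a - b) / (2 * Ci))%C.
    + field. apply Ci_nz.
    + rewrite Ci2. field. apply Ci_nz.
Qed.

Lemma csin_0 : csin 0 = 0.
Proof.
  unfold csin. replace (Ci * 0)%C with (RtoC 0) by ring.
  replace (- Ci * 0)%C with (RtoC 0) by ring. rewrite cexp_0. field. apply Ci_nz.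
Qed.

Lemma ccos_0 : ccos 0 = 1.
Proof.
  unfold ccos. replace (Ci * 0)%C with (RtoC 0) by ring.
  replace (- Ci * 0)%C with (RtoC 0) by ring. rewrite cexp_0. field.
Qed.

Lemma hol_csin (U : C -> Prop) : hol U csin.
Proof.
  exists ccos. intros z _. split; [apply cder_csin|].
  apply cder_ccont with (1 := cder_ccos z).
Qed.

(** The real mean value theorem is applied to Re (conj(d) h(t z)) with d = h z - h 0, whose total
    increment is |d|^2; one factor |d| is then cancelled. *)
Lemma segment_mean_value (h dh : C -> C) (z : C) (M : R) :
  (forall t, 0 <= t <= 1 -> cder h (RtoC t * z)%C (dh (RtoC t * z)%C)
      /\ Cmod (dh (RtoC t * z)%C) <= M) ->
  Cmod (h z - h 0) <= M * Cmod z.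
Proof.
  intros H. set (d := (h z - h 0)%C).
  destruct (Ceq_dec d 0) as [->|Hd].
  { rewrite Cmod_0. apply Rmult_le_pos; [|apply Cmod_ge_0].
    apply Rle_trans with (2 := proj2 (H 0 ltac:(lra))), Cmod_ge_0. }
  assert (Hd' := proj1 (Cmod_gt_0 _) Hd).
  assert (E : forall t, (RtoC t * z)%C = (t * fst z, t * snd z)%R).
  { intros t. destruct z. unfold RtoC, Cmult; simpl. f_equal; ring. }
  set (u := fun t : R => Re (Cconj d * h (RtoC t * z))%C).
  assert (Hu : forall t, 0 <= t <= 1 ->
     is_derive u t (Re ((Cconj d * dh (RtoC t * z)) * z)%C)).
  { intros t Ht. destruct (H t Ht) as [H1 _].
    apply is_derive_ext with (fun s => Re (Cconj d * h (s * fst z, s * snd z)%R)%C).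
    { intros s. unfold u. now rewrite E. }
    replace (Re (Cconj d * dh (RtoC t * z) * z)%C)
      with (Re (Cconj d * dh (RtoC t * z) * (fst z, snd z)%R)%C)
      by (now rewrite <- surjective_pairing).
    apply (is_derive_re_curve (fun w => Cconj d * h w)%C _
             (fun s => s * fst z) (fun s => s * snd z)).
    - rewrite <- E. apply cder_scal, H1.
    - auto_derive; [exact I|ring].
    - auto_derive; [exact I|ring]. }
  destruct (MVT_gen u 0 1 (fun t => Re ((Cconj d * dh (RtoC t * z)) * z)%C)) as [c [Hc K]].
  - rewrite Rmin_left, Rmax_right by lra. intros t Ht. apply Hu. lra.
  - rewrite Rmin_left, Rmax_right by lra. intros t Ht. apply derivable_continuous_pt.
    eexists. apply is_derive_Reals, Hu, Ht.
  - rewrite Rmin_left, Rmax_right in Hc by lra.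
    assert (K1 : u 1 - u 0 = Cmod d ^ 2).
    { unfold u. rewrite Cmult_1_l, Cmult_0_l.
      transitivity (Re (Cconj d * h z - Cconj d * h 0)%C); [reflexivity|].
      replace (Cconj d * h z - Cconj d * h 0)%C with (d * Cconj d)%C by (unfold d; ring).
      rewrite <- Cmod2_conj. apply re_RtoC. }
    rewrite K1, Rminus_0_r, Rmult_1_r in K.
    assert (K2 := Rle_trans _ _ _ (Rle_abs _) (re_le_Cmod ((Cconj d * dh (RtoC c * z)) * z)%C)).
    rewrite <- K, !Cmod_mult, Cmod_conj in K2.
    assert (K3 := proj2 (H c Hc)). assert (Hz := Cmod_ge_0 z).
    apply Rmult_le_reg_l with (Cmod d); [exact Hd'|].
    apply Rle_trans with (Cmod d * (Cmod (dh (c * z)%C) * Cmod z)); [lra|].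
    apply Rmult_le_compat_l; [lra|]. apply Rmult_le_compat_r; assumption.
Qed.

Lemma bigO_primitive (n : nat) (h dh : C -> C) :
  (forall z, cder h z (dh z)) -> h 0 = 0 -> bigO n dh -> bigO (S n) h.
Proof.
  intros Hh H0 [M [d [Hd H]]]. exists (Rabs M), d. split; [exact Hd|]. intros z Hz.
  replace (h z) with (h z - h 0)%C by (rewrite H0; ring).
  simpl. rewrite (Rmult_comm (Cmod z)), <- Rmult_assoc.
  apply segment_mean_value with dh. intros t Ht. split; [apply Hh|].
  assert (Hm : Cmod (RtoC t * z) <= Cmod z).
  { rewrite Cmod_mult, Cmod_R, Rabs_pos_eq by lra. assert (Hp := Cmod_ge_0 z). nra. }
  apply Rle_trans with (1 := H _ (Rle_lt_trans _ _ _ Hm Hz)).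
  apply Rle_trans with (Rabs M * Cmod (RtoC t * z) ^ n).
  - apply Rmult_le_compat_r; [apply pow_le, Cmod_ge_0|apply Rle_abs].
  - apply Rmult_le_compat_l; [apply Rabs_pos|]. apply pow_incr.
    split; [apply Cmod_ge_0|exact Hm].
Qed.

(** Repeated integration from 0: sine is bounded near 0, hence 1 - cos is O(z), z - sin is O(z^2),
    cos - 1 + z^2/2 is O(z^3), and the claim follows. Each order is one less than the true one,
    which is enough for cubic approximation. *)
Lemma csin_taylor : bigO 4 (fun z => (csin z - z + z ^ 3 / 6)%C).
Proof.
  assert (B1 : bigO 1 (fun z => (1 - ccos z)%C)).
  { apply bigO_primitive with csin.
    - intros z. apply cder_eq with (0 - - csin z)%C; [|ring].
      apply cder_minus; [apply cder_const|apply cder_ccos].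
    - rewrite ccos_0. ring.
    - apply bigO_ccont. apply cder_ccont with (1 := cder_csin 0). }
  assert (B2 : bigO 2 (fun z => (z - csin z)%C)).
  { apply bigO_primitive with (fun z => (1 - ccos z)%C).
    - intros z. apply cder_minus; [apply cder_id|apply cder_csin].
    - rewrite csin_0. ring.
    - exact B1. }
  assert (B3 : bigO 3 (fun z => (ccos z - 1 + z * z / 2)%C)).
  { apply bigO_primitive with (fun z => (z - csin z)%C).
    - intros z. apply cder_eq with (- csin z - 0 + (1 * z + z * 1) * / 2 + (z * z) * 0)%C; [|field].
      rewrite <- Cplus_assoc. apply cder_plus.
      + apply cder_minus; [apply cder_ccos|apply cder_const].
      + apply (cder_mult (fun w => w * w)%C (fun _ => / 2)%C); [|apply cder_const].
        apply (cder_mult (fun w => w) (fun w => w)); apply cder_id.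
    - rewrite ccos_0. field.
    - exact B2. }
  apply bigO_primitive with (fun z => (ccos z - 1 + z * z / 2)%C); [| |exact B3].
  - intros z. apply cder_ext_loc with (fun z => (csin z - z + (z * z) * z * / 6)%C).
    { exists 1. split; [lra|]. intros w _. simpl. field. }
    apply cder_eq with (ccos z - 1 + (((1 * z + z * 1) * z + (z * z) * 1) * / 6 + (z * z * z) * 0))%C;
      [|field].
    apply cder_plus.
    + apply cder_minus; [apply cder_csin|apply cder_id].
    + apply (cder_mult (fun w => w * w * w)%C (fun _ => / 6)%C); [|apply cder_const].
      apply (cder_mult (fun w => w * w)%C (fun w => w)); [|apply cder_id].
      apply (cder_mult (fun w => w) (fun w => w)); apply cder_id.
  - rewrite csin_0. simpl. field.
Qed.

(** * Principal argument, logarithm, square root and arcsine *)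

Lemma cpolar_Carg (z : C) : z <> 0 -> cpolar (Cmod z) (Carg z) = z.
Proof.
  intros Hz. assert (Hm := proj1 (Cmod_gt_0 _) Hz).
  assert (Hre := re_le_Cmod z). apply Rabs_le_between in Hre.
  assert (H2 := Cmod2_alt z).
  set (m := Cmod z) in *. set (x := Re z / m).
  assert (Ex : x * m = Re z) by (unfold x; field; lra).
  assert (Hx : -1 <= x <= 1) by (split; nra).
  assert (Hs : m * sin (acos x) = Rabs (Im z)).
  { rewrite sin_acos by exact Hx.
    rewrite <- (sqrt_Rsqr m) at 1 by lra.
    rewrite <- sqrt_mult_alt by apply Rle_0_sqr.
    rewrite <- sqrt_Rsqr_abs. f_equal. unfold Rsqr. nra. }
  unfold cpolar, Carg. fold m x. destruct (Rle_dec 0 (Im z)) as [Hi|Hi].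
  - rewrite Hs, cos_acos, Rabs_pos_eq by assumption.
    rewrite Rmult_comm, Ex. symmetry. apply surjective_pairing.
  - rewrite cos_neg, sin_neg, cos_acos by exact Hx.
    replace (m * - sin (acos x)) with (Im z).
    + rewrite Rmult_comm, Ex. symmetry. apply surjective_pairing.
    + rewrite Rabs_left in Hs by lra. lra.
Qed.

Lemma Carg_cpolar (r t : R) : 0 < r -> - PI < t < PI -> Carg (cpolar r t) = t.
Proof.
  intros Hr Ht. unfold Carg. rewrite Cmod_cpolar by lra.
  unfold cpolar, Re, Im; simpl.
  replace (r * cos t / r) with (cos t) by (field; lra).
  destruct (Rle_dec 0 (r * sin t)) as [H|H].
  - apply acos_cos. split; [|lra]. apply Rnot_lt_le. intros Hneg.
    assert (H1 : 0 < sin (- t)) by (apply sin_gt_0; lra).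
    rewrite sin_neg in H1. nra.
  - rewrite <- cos_neg, acos_cos; [ring|]. split; [|lra].
    apply Rnot_lt_le. intros Hneg.
    assert (H1 : 0 < sin t) by (apply sin_gt_0; lra). nra.
Qed.

Lemma Carg_bound (z : C) : - PI <= Carg z <= PI.
Proof.
  unfold Carg. assert (H := acos_bound (Re z / Cmod z)).
  destruct (Rle_dec 0 (Im z)); lra.
Qed.

Lemma cexp_Clog (z : C) : z <> 0 -> cexp (Clog z) = z.
Proof.
  intros Hz. unfold cexp, Clog, Re, Im; simpl.
  rewrite exp_ln by (apply Cmod_gt_0, Hz). apply cpolar_Carg, Hz.
Qed.

Lemma Clog_cexp (z : C) : - PI < Im z < PI -> Clog (cexp z) = z.
Proof.
  intros Hz. unfold Clog. rewrite Cmod_cexp, ln_exp. unfold cexp.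
  rewrite Carg_cpolar by (assumption || apply exp_pos).
  symmetry. apply surjective_pairing.
Qed.

Lemma Csqrt_sqr (z : C) : (Csqrt z * Csqrt z)%C = z.
Proof.
  destruct (Ceq_dec z 0) as [->|Hz].
  { unfold Csqrt. rewrite Cmod_0, sqrt_0. ring. }
  assert (E : Csqrt z = cpolar (sqrt (Cmod z)) (Carg z / 2)).
  { unfold Csqrt, cpolar, RtoC, Cmult; simpl. f_equal; ring. }
  rewrite E, cpolar_mult, sqrt_sqrt by apply Cmod_ge_0.
  replace (Carg z / 2 + Carg z / 2) with (Carg z) by field.
  apply cpolar_Carg, Hz.
Qed.

(** A positive real part means an argument in (-PI/2, PI/2); doubling it stays inside (-PI, PI), so
    the principal argument of the square is the doubled one. *)
Lemma Csqrt_of_sqr (q : C) : 0 < Re q -> Csqrt (q * q)%C = q.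
Proof.
  intros Hq.
  assert (Hn : q <> 0) by (intros ->; unfold Re, RtoC in Hq; simpl in Hq; lra).
  assert (Hm := proj1 (Cmod_gt_0 _) Hn).
  assert (Ha : - (PI / 2) < Carg q < PI / 2).
  { assert (HP := PI_RGT_0).
    assert (Hx : 0 < Re q / Cmod q <= 1).
    { split; [apply Rdiv_lt_0_compat; assumption|].
      apply Rmult_le_reg_r with (Cmod q); [exact Hm|].
      unfold Rdiv. rewrite Rmult_assoc, Rinv_l by lra.
      generalize (re_le_Cmod q) (Rle_abs (Re q)). lra. }
    assert (H1 : acos (Re q / Cmod q) < PI / 2).
    { apply Rnot_le_lt. intros Hle.
      assert (H1 := acos_bound (Re q / Cmod q)).
      assert (H2 := cos_le_0 (acos (Re q / Cmod q)) Hle ltac:(lra)).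
      rewrite cos_acos in H2 by lra. lra. }
    assert (H2 := acos_bound (Re q / Cmod q)).
    unfold Carg. destruct (Rle_dec 0 (Im q)); lra. }
  rewrite <- (cpolar_Carg q Hn) at 1 2. rewrite cpolar_mult.
  unfold Csqrt. rewrite Cmod_cpolar, Carg_cpolar by nra.
  rewrite sqrt_square by lra.
  replace ((Carg q + Carg q) / 2) with (Carg q) by field.
  rewrite <- (cpolar_Carg q Hn) at 4. unfold cpolar, RtoC, Cmult; simpl. f_equal; ring.
Qed.

Lemma Carcsin_arg_mult (w : C) :
  ((Ci * w + Csqrt (1 - w * w)) * (- Ci * w + Csqrt (1 - w * w)))%C = 1.
Proof.
  set (q := Csqrt (1 - w * w)).
  transitivity (- (Ci * Ci) * (w * w) + q * q)%C; [ring|].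
  unfold q. rewrite Csqrt_sqr, Ci2. ring.
Qed.

Lemma Carcsin_arg_neq_0 (w : C) : (Ci * w + Csqrt (1 - w * w))%C <> 0.
Proof.
  intros E. assert (H := Carcsin_arg_mult w). rewrite E, Cmult_0_l in H.
  symmetry in H. exact (C1_nz H).
Qed.

(** Valid for every [w], branch cuts included: by [Carcsin_arg_mult] the two numbers i w + q and - i
    w + q are reciprocal as soon as q^2 = 1 - w^2, and the exponential undoes any choice of
    logarithm. *)
Lemma csin_Carcsin (w : C) : csin (Carcsin w) = w.
Proof.
  unfold csin, Carcsin. set (zeta := (Ci * w + Csqrt (1 - w * w))%C).
  set (zeta' := (- Ci * w + Csqrt (1 - w * w))%C).
  assert (Hz : zeta <> 0) by apply Carcsin_arg_neq_0.
  assert (Hm : (zeta * zeta')%C = 1) by apply Carcsin_arg_mult.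
  replace (Ci * - (Ci * Clog zeta))%C with (- (Ci * Ci) * Clog zeta)%C by ring.
  replace (- Ci * - (Ci * Clog zeta))%C with ((Ci * Ci) * Clog zeta)%C by ring.
  rewrite Ci2. replace (- (-1) * Clog zeta)%C with (Clog zeta) by ring.
  replace (-1 * Clog zeta)%C with (- Clog zeta)%C by ring.
  assert (E1 := cexp_Clog zeta Hz). assert (E2 := cexp_opp_r (Clog zeta)).
  rewrite E1 in *.
  assert (E3 : cexp (- Clog zeta) = zeta').
  { transitivity (cexp (- Clog zeta) * (zeta * zeta'))%C; [rewrite Hm; ring|].
    transitivity ((zeta * cexp (- Clog zeta)) * zeta')%C; [ring|]. rewrite E2. ring. }
  rewrite E3. unfold zeta, zeta'. field. apply Ci_nz.
Qed.

Lemma Cmod_Csqrt (z : C) : Cmod (Csqrt z) = sqrt (Cmod z).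
Proof.
  assert (E : Csqrt z = cpolar (sqrt (Cmod z)) (Carg z / 2)).
  { unfold Csqrt, cpolar, RtoC, Cmult; simpl. f_equal; ring. }
  rewrite E. apply Cmod_cpolar, sqrt_pos.
Qed.

(** The numbers i w + q and - i w + q have moduli at most 3 and product 1, so the logarithm of each
    modulus lies in [-3, 3]; the argument contributes at most PI. *)
Lemma Carcsin_bounded : exists M, forall w, Cmod w <= 1 -> Cmod (Carcsin w) <= M.
Proof.
  exists (3 + PI). intros w Hw. unfold Carcsin.
  assert (Hq : Cmod (Csqrt (1 - w * w)) <= 2).
  { rewrite Cmod_Csqrt. apply Rle_trans with (sqrt (2 * 2)); [|rewrite sqrt_square; lra].
    apply sqrt_le_1_alt. eapply Rle_trans; [apply Cmod_triangle|].
    rewrite Cmod_opp, Cmod_mult, Cmod_1. assert (H0 := Cmod_ge_0 w). nra. }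
  assert (Hm := f_equal Cmod (Carcsin_arg_mult w)).
  assert (Hn := proj1 (Cmod_gt_0 _) (Carcsin_arg_neq_0 w)).
  assert (H1 : Cmod (Ci * w + Csqrt (1 - w * w)) <= 3).
  { eapply Rle_trans; [apply Cmod_triangle|]. rewrite Cmod_mult, Cmod_Ci. lra. }
  assert (H2 : Cmod (- Ci * w + Csqrt (1 - w * w)) <= 3).
  { eapply Rle_trans; [apply Cmod_triangle|]. rewrite Cmod_mult, Cmod_opp, Cmod_Ci. lra. }
  rewrite Cmod_mult, Cmod_1 in Hm.
  set (zeta := (Ci * w + Csqrt (1 - w * w))%C) in *.
  set (m := Cmod zeta) in *. set (m' := Cmod (- Ci * w + Csqrt (1 - w * w))) in *.
  rewrite Cmod_opp, Cmod_mult, Cmod_Ci, Rmult_1_l.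
  unfold Clog. apply Rle_trans with (1 := Cmod_le_abs _ _). fold m.
  assert (Hl : forall x, 0 < x <= 3 -> ln x <= 3).
  { intros x Hx. destruct (Rle_lt_dec (ln x) 3) as [h|h]; [exact h|].
    assert (H3 := exp_ineq1_le (ln x)). rewrite exp_ln in H3 by lra. lra. }
  assert (Hm' : 0 < m').
  { destruct (Rle_lt_dec m' 0) as [h|h]; [|exact h]. nra. }
  assert (Hln : ln m + ln m' = 0) by (rewrite <- ln_mult, Hm by assumption; apply ln_1).
  assert (L1 := Hl m ltac:(lra)). assert (L2 := Hl m' ltac:(lra)).
  assert (Ha := Carg_bound zeta).
  apply Rplus_le_compat; apply Rabs_le; lra.
Qed.

(** A test for the principal branch: Re q > 0 makes [q] the principal root, and the condition on Re
    d, which is the imaginary part of i d, makes the logarithm undo the exponential. *)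
Lemma Carcsin_unique (s q d : C) :
  (q * q)%C = (1 - s * s)%C -> 0 < Re q -> cexp (Ci * d) = (Ci * s + q)%C ->
  - PI < Re d < PI -> Carcsin s = d.
Proof.
  intros Hq Hre He Hd. unfold Carcsin.
  rewrite <- Hq, (Csqrt_of_sqr q Hre), <- He, Clog_cexp.
  - transitivity (- (Ci * Ci) * d)%C; [ring|]. rewrite Ci2. ring.
  - rewrite im_mult. unfold Re, Im, Ci in *; simpl. lra.
Qed.

(** * The upper bound *)

Lemma disk_neighborhood (z : C) : Cmod z < 1 ->
  exists d, 0 < d /\ forall w, Cmod (w - z) < d -> Cmod w < 1.
Proof.
  intros Hz. exists (1 - Cmod z). split; [lra|]. intros w Hw.
  assert (H := Cmod_minus_ge w z). lra.
Qed.

Lemma cder_of_expansion (f : C -> C) (a : nat -> C) (z : C) :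
  has_expansion f a -> Cmod z < 1 -> cder f z (CS (dcoef a) z).
Proof.
  intros H Hz. apply cder_ext_loc with (CS a).
  - destruct (disk_neighborhood z Hz) as [d [Hd Hw]]. exists d. split; [exact Hd|].
    intros w Hwz. symmetry. apply has_expansion_CS; auto.
  - apply CS_cder; [apply has_expansion_rad1 with (1 := H)|exact Hz].
Qed.

Lemma C_derive_cder (f : C -> C) (z d : C) : cder f z d -> C_derive f z = d.
Proof. intros H. apply is_C_derive_unique. apply is_derive_of_cder, H. Qed.

Lemma has_expansion_C_derive (f : C -> C) (a : nat -> C) :
  has_expansion f a -> has_expansion (C_derive f) (dcoef a).
Proof.
  intros H z Hz. rewrite (C_derive_cder _ _ _ (cder_of_expansion f a z H Hz)).
  apply CS_expansion; [|exact Hz]. apply rad1_dcoef, has_expansion_rad1 with (1 := H).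
Qed.

(* Gronwall along the radius: [|F(t z)|^2 exp (K t)] is nondecreasing. *)
Lemma nonvanishing_of_log_derivative_bound (F dF : C -> C) (M : R) :
  (forall z, Cmod z < 1 -> cder F z (dF z)) -> F 0 <> 0 ->
  (forall z, Cmod z < 1 -> F z <> 0 -> Cmod (z * dF z) <= M * Cmod (F z)) ->
  forall z, Cmod z < 1 -> F z <> 0.
Proof.
  intros HF H0 HM z Hz Ez.
  assert (Hzt : forall t, 0 <= t <= 1 -> Cmod (RtoC t * z) <= Cmod z).
  { intros t Ht. rewrite Cmod_mult, Cmod_R, Rabs_pos_eq by lra.
    assert (Hp := Cmod_ge_0 z). nra. }
  assert (E : forall t, (RtoC t * z)%C = (t * fst z, t * snd z)%R).
  { intros t. destruct z. unfold RtoC, Cmult; simpl. f_equal; ring. }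
  destruct (ccont_neq_0 F 0) as [d [Hd HFd]].
  { apply cder_ccont with (dF 0). apply HF. rewrite Cmod_0. lra. }
  { exact H0. }
  (* The hypothesis bounds z F'(z), so the radial derivative at [t] is controlled after division by
     [t]. Starting at t0 > 0, where F(t0 z) is nonzero by continuity, gives one constant [K] for the
     whole segment. *)
  set (t0 := Rmin (d / 2) 1).
  assert (Ht0 : 0 < t0) by (apply Rmin_pos; lra).
  assert (Ht0d : t0 <= d / 2) by apply Rmin_l. assert (Ht01 : t0 <= 1) by apply Rmin_r.
  set (u := fun t : R => Cmod (F (RtoC t * z)%C) ^ 2).
  set (du := fun t : R => 2 * Re (Cconj (F (RtoC t * z)) * (dF (RtoC t * z) * z))%C).
  set (K := 2 * Rabs M / t0).
  assert (Hu : forall t, 0 <= t <= 1 -> is_derive u t (du t)).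
  { intros t Ht.
    assert (Hc : forall c : C, is_derive (fun s => Re (c * F (RtoC s * z))%C) t
       (Re (c * dF (RtoC t * z) * z)%C)).
    { intros c. apply is_derive_ext with (fun s => Re (c * F (s * fst z, s * snd z)%R)%C).
      { intros s. now rewrite E. }
      replace (Re (c * dF (RtoC t * z) * z)%C)
        with (Re (c * dF (RtoC t * z) * (fst z, snd z)%R)%C)
        by (now rewrite <- surjective_pairing).
      apply (is_derive_re_curve (fun w => c * F w)%C _
               (fun s => s * fst z) (fun s => s * snd z)).
      - rewrite <- E. apply cder_scal, HF. specialize (Hzt t Ht). lra.
      - auto_derive; [exact I|ring].
      - auto_derive; [exact I|ring]. }
    assert (H1 := Hc 1). assert (H2 := Hc (- Ci)%C).
    apply is_derive_Reals in H1. apply is_derive_Reals in H2.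
    apply is_derive_ext with
      (fun s => Re (1 * F (RtoC s * z))%C * Re (1 * F (RtoC s * z))%C
         + Re (- Ci * F (RtoC s * z))%C * Re (- Ci * F (RtoC s * z))%C).
    { intros s. unfold u. rewrite Cmod2_alt, <- im_as_re, Cmult_1_l. simpl. ring. }
    apply is_derive_Reals.
    assert (H3 := derivable_pt_lim_plus _ _ _ _ _ (derivable_pt_lim_mult _ _ _ _ _ H1 H1)
                    (derivable_pt_lim_mult _ _ _ _ _ H2 H2)).
    match type of H3 with derivable_pt_lim _ _ ?l => replace (du t) with l; [exact H3|] end.
    unfold du. destruct (F (RtoC t * z)%C) as [x y]. destruct (dF (RtoC t * z)%C) as [p q].
    destruct z as [z1 z2].
    unfold Re, Im, Ci, Cconj, RtoC, Cmult, Copp; simpl. ring. }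
  assert (HK : 0 <= K).
  { apply Rdiv_le_0_compat; [|exact Ht0]. assert (Hp := Rabs_pos M). lra. }
  assert (Hdu : forall t, t0 <= t <= 1 -> 0 <= du t + K * u t).
  { intros t Ht. set (v := F (RtoC t * z)%C).
    assert (Hb : Rabs (du t) <= K * u t).
    { unfold du, u. fold v. rewrite Rabs_mult, (Rabs_pos_eq 2) by lra.
      assert (H1 := re_le_Cmod (Cconj v * (dF (RtoC t * z) * z))%C).
      rewrite Cmod_mult, Cmod_conj in H1.
      assert (Hv := Cmod_ge_0 v).
      (* The bound is assumed off the zeros of [F]; at a zero the derivative of |F|^2 vanishes too,
         so the differential inequality extends to it. *)
      destruct (Ceq_dec v 0) as [Hv0|Hv0].
      { rewrite Hv0, Cmod_0 in *. rewrite Rmult_0_l in H1. lra. }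
      assert (H2 := HM (RtoC t * z)%C ltac:(specialize (Hzt t ltac:(lra)); lra) Hv0).
      fold v in H2.
      replace (RtoC t * z * dF (RtoC t * z))%C with (RtoC t * (dF (RtoC t * z) * z))%C in H2 by ring.
      rewrite Cmod_mult, Cmod_R, Rabs_pos_eq in H2 by lra.
      set (D := Cmod (dF (RtoC t * z) * z)%C) in *.
      assert (HD : 0 <= D) by apply Cmod_ge_0.
      assert (H3 : t0 * D <= Rabs M * Cmod v).
      { apply Rle_trans with (t * D); [nra|]. apply Rle_trans with (1 := H2).
        apply Rmult_le_compat_r; [exact Hv|apply Rle_abs]. }
      apply Rle_trans with (2 * (Cmod v * D)); [lra|].
      unfold K. apply Rmult_le_reg_l with t0; [exact Ht0|].
      replace (t0 * (2 * Rabs M / t0 * Cmod v ^ 2)) with (2 * Cmod v * (Rabs M * Cmod v))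
        by (field; lra).
      nra. }
    apply Rabs_le_between in Hb. lra. }
  set (w := fun t => u t * exp (K * t)).
  assert (Hw : forall t, 0 <= t <= 1 -> is_derive w t ((du t + K * u t) * exp (K * t))).
  { intros t Ht. apply is_derive_Reals.
    assert (H1 := Hu t Ht). apply is_derive_Reals in H1.
    assert (H2 : is_derive (fun s => exp (K * s)) t (K * exp (K * t))).
    { auto_derive; [exact I|ring]. }
    apply is_derive_Reals in H2.
    assert (H3 := derivable_pt_lim_mult _ _ _ _ _ H1 H2).
    replace ((du t + K * u t) * exp (K * t)) with (du t * exp (K * t) + u t * (K * exp (K * t)))
      by ring.
    exact H3. }
  destruct (MVT_gen w t0 1 (fun t => (du t + K * u t) * exp (K * t))) as [c [Hc HMVT]].
  - rewrite Rmin_left, Rmax_right by lra. intros t Ht. apply Hw. lra.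
  - rewrite Rmin_left, Rmax_right by lra. intros t Ht. apply derivable_continuous_pt.
    eexists. apply is_derive_Reals, Hw. lra.
  - rewrite Rmin_left, Rmax_right in Hc by lra.
    assert (W1 : w 1 = 0).
    { unfold w, u. rewrite Cmult_1_l, Ez, Cmod_0. ring. }
    assert (W0 : 0 < w t0).
    { unfold w, u. apply Rmult_lt_0_compat; [|apply exp_pos]. apply pow_lt.
      assert (Hf := proj1 (Cmod_gt_0 _) H0).
      apply Rlt_trans with (2 := HFd (RtoC t0 * z)%C
        ltac:(replace (RtoC t0 * z - 0)%C with (RtoC t0 * z)%C by ring;
              rewrite Cmod_mult, Cmod_R, Rabs_pos_eq by lra;
              assert (Hp := Cmod_ge_0 z); nra)).
      lra. }
    assert (H1 := Hdu c Hc). assert (H2 := exp_pos (K * c)).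
    assert (H3 : 0 <= (du c + K * u c) * exp (K * c)) by (apply Rmult_le_pos; lra).
    assert (H4 : 0 <= (du c + K * u c) * exp (K * c) * (1 - t0)) by (apply Rmult_le_pos; lra).
    lra.
Qed.

Lemma CS_decr3 (a : nat -> C) (z : C) : rad1 a -> Cmod z < 1 ->
  CS a z = (a 0%nat + a 1%nat * z + a 2%nat * (z * z)
            + z * z * z * CS (fun n => a (S (S (S n)))) z)%C.
Proof.
  intros Ha Hz. rewrite CS_decr by assumption.
  rewrite (CS_decr (fun n => a (S n))) by (assumption || apply rad1_shift, Ha).
  rewrite (CS_decr (fun n => a (S (S n))))
    by (assumption || apply (rad1_shift (fun n => a (S n))), rad1_shift, Ha).
  ring.
Qed.

Lemma bigO_comp (n : nat) (F g : C -> C) :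
  bigO n F -> bigO 1 g -> bigO n (fun z => F (g z)).
Proof.
  intros [M [d [Hd H]]] Hg. destruct (bigO_limit g Hg d Hd) as [d1 [Hd1 H1]].
  destruct Hg as [M' [d2 [Hd2 H2]]].
  exists (Rabs M * Rabs M' ^ n), (Rmin d1 d2).
  split; [apply Rmin_pos; assumption|]. intros z Hz.
  specialize (H1 z (Rlt_le_trans _ _ _ Hz (Rmin_l _ _))).
  specialize (H2 z (Rlt_le_trans _ _ _ Hz (Rmin_r _ _))).
  apply Rle_trans with (1 := H _ H1).
  rewrite Rmult_assoc, <- Rpow_mult_distr.
  apply Rle_trans with (Rabs M * Cmod (g z) ^ n).
  - apply Rmult_le_compat_r; [apply pow_le, Cmod_ge_0|apply Rle_abs].
  - apply Rmult_le_compat_l; [apply Rabs_pos|]. apply pow_incr.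
    split; [apply Cmod_ge_0|]. apply Rle_trans with (1 := H2). simpl. rewrite Rmult_1_r.
    apply Rmult_le_compat_r; [apply Cmod_ge_0|apply Rle_abs].
Qed.

Lemma C_eq_div (x y z : C) : y <> 0 -> (x / y)%C = z -> x = (z * y)%C.
Proof. intros Hy <-. field. exact Hy. Qed.

Lemma rad1_shift3 (a : nat -> C) : rad1 a -> rad1 (fun n => a (S (S (S n)))).
Proof.
  intros Ha. apply (rad1_shift (fun n => a (S (S n)))), (rad1_shift (fun n => a (S n))).
  apply rad1_shift, Ha.
Qed.

(** The cubic P is determined by z f'' = f' P up to O(z^4); division by f' is legitimate near 0,
    where f'(0) = 1 keeps it away from zero. *)
Lemma log_derivative_taylor (a : nat -> C) : rad1 a -> a 1%nat = 1 ->
  bigO 4 (fun z => (z * CS (dcoef (dcoef a)) z * / CS (dcoef a) z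
    - (2 * a 2%nat * z + (6 * a 3%nat - 4 * a 2%nat ^ 2) * z ^ 2
       + (12 * a 4%nat - 18 * a 2%nat * a 3%nat + 8 * a 2%nat ^ 3) * z ^ 3))%C).
Proof.
  intros Ha Ha1.
  set (F1 := CS (dcoef a)). set (F2 := CS (dcoef (dcoef a))).
  assert (Hd1 := rad1_dcoef _ Ha). assert (Hd2 := rad1_dcoef _ Hd1).
  set (P := fun z : C => (2 * a 2%nat * z + (6 * a 3%nat - 4 * a 2%nat ^ 2) * z ^ 2
       + (12 * a 4%nat - 18 * a 2%nat * a 3%nat + 8 * a 2%nat ^ 3) * z ^ 3)%C).
  set (R1 := CS (fun n => dcoef a (S (S (S n))))).
  set (R2 := CS (fun n => dcoef (dcoef a) (S (S (S n))))).
  assert (HR1 : bigO 0 R1) by (apply CS_bigO0; apply rad1_shift3; exact Hd1).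
  assert (HR2 : bigO 0 R2) by (apply CS_bigO0; apply rad1_shift3; exact Hd2).
  assert (I2 : INR 2 = 2) by (simpl; ring). assert (I3 : INR 3 = 3) by (simpl; ring).
  assert (I4 : INR 4 = 4) by (simpl; ring).
  assert (F1c : ccont F1 0).
  { eapply cder_ccont, CS_cder; [exact Hd1|]. rewrite Cmod_0. lra. }
  assert (F10 : F1 0 <> 0).
  { unfold F1. rewrite CS_0 by exact Hd1. unfold dcoef. rewrite Ha1, Cmult_1_r.
    exact C1_nz. }
  destruct (ccont_neq_0 F1 0 F1c F10) as [d [Hd HF1]].
  apply bigO_ext_loc with (fun z => ((z * F2 z - F1 z * P z) * / F1 z)%C) d; [exact Hd| |].
  { intros z Hz. specialize (HF1 z). replace (z - 0)%C with z in HF1 by ring.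
    specialize (HF1 Hz). assert (Hn : F1 z <> 0).
    { apply Cmod_gt_0. assert (H0 := Cmod_ge_0 (F1 0)). lra. }
    fold (P z). field. exact Hn. }
  apply (bigO_mult 4 0); [|apply bigO_ccont, ccont_inv; assumption].
  set (g1 := (2 * a 2%nat)%C). set (g2 := (6 * a 3%nat - 4 * a 2%nat ^ 2)%C).
  set (g3 := (12 * a 4%nat - 18 * a 2%nat * a 3%nat + 8 * a 2%nat ^ 3)%C).
  apply bigO_ext_loc with (fun z => (z ^ 4 * (R2 z - R1 z * (g1 + g2 * z + g3 * (z * z))
     - (2 * a 2%nat * g3 + 3 * a 3%nat * g2 + 3 * a 3%nat * g3 * z)))%C) 1; [lra| |].
  { intros z Hz. unfold F1, F2.
    rewrite (CS_decr3 (dcoef a)), (CS_decr3 (dcoef (dcoef a))) by assumption.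
    fold (R1 z) (R2 z).
    replace (dcoef a 0) with (RtoC 1) by (unfold dcoef; rewrite Ha1; simpl; ring).
    replace (dcoef (dcoef a) 0) with (2 * a 2%nat)%C
      by (unfold dcoef; rewrite I2; simpl; ring).
    replace (dcoef (dcoef a) 1) with (6 * a 3%nat)%C
      by (unfold dcoef; rewrite I2, I3; ring).
    replace (dcoef (dcoef a) 2) with (12 * a 4%nat)%C
      by (unfold dcoef; rewrite I3, I4; ring).
    replace (dcoef a 1) with (2 * a 2%nat)%C by (unfold dcoef; now rewrite I2).
    replace (dcoef a 2) with (3 * a 3%nat)%C by (unfold dcoef; now rewrite I3).
    unfold P, g1, g2, g3. simpl. ring. }
  apply (bigO_mult 4 0); [apply bigO_pow|].
  apply bigO_minus; [apply bigO_minus; [exact HR2|]|].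
  - apply (bigO_mult 0 0); [exact HR1|]. apply bigO_ccont.
    repeat first [apply ccont_const|apply ccont_id|apply ccont_plus|apply ccont_mult].
  - apply bigO_ccont.
    repeat first [apply ccont_const|apply ccont_id|apply ccont_plus|apply ccont_mult].
Qed.

(** sin g = g - g^3/6 + O(z^4), g^3 - P^3 contains the factor g - P = O(z^4), and P^3 = w1^3 z^3 +
    O(z^4). Only the cubic coefficient changes. *)
Lemma csin_comp_taylor (g : C -> C) (w1 w2 w3 : C) :
  bigO 4 (fun z => (g z - (w1 * z + w2 * z ^ 2 + w3 * z ^ 3))%C) ->
  bigO 4 (fun z => (csin (g z) - (w1 * z + w2 * z ^ 2 + (w3 - w1 ^ 3 / 6) * z ^ 3))%C).
Proof.
  intros Hg. set (P := fun z : C => (w1 * z + w2 * z ^ 2 + w3 * z ^ 3)%C).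
  assert (HP : bigO 1 P).
  { apply bigO_ext with (fun z => (z * (w1 + w2 * z + w3 * (z * z)))%C).
    { intros z. unfold P. simpl. ring. }
    apply (bigO_mult 1 0); [apply bigO_id|]. apply bigO_ccont.
    repeat first [apply ccont_const|apply ccont_id|apply ccont_plus|apply ccont_mult]. }
  assert (Hg1 : bigO 1 g).
  { apply bigO_ext with (fun z => ((g z - P z) + P z)%C).
    { intros z. ring. }
    apply bigO_plus; [|exact HP]. apply bigO_le with (2 := Hg). lia. }
  (* The long polynomial that multiplies z^4 is (P^3 - w1^3 z^3) / z^4 written out. *)
  apply bigO_ext with (fun z => ((csin (g z) - g z + g z ^ 3 / 6) + (g z - P z)
     - ((g z - P z) * ((g z * g z + g z * P z + P z * P z) * / 6)
        + z ^ 4 * ((w1 ^ 2 * w2 * 3 + 3 * (w1 * w2 ^ 2 + w1 ^ 2 * w3) * z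
            + (w2 ^ 3 + 6 * w1 * w2 * w3) * z ^ 2 + 3 * (w2 ^ 2 * w3 + w1 * w3 ^ 2) * z ^ 3
            + 3 * w2 * w3 ^ 2 * z ^ 4 + w3 ^ 3 * z ^ 5) * / 6)))%C).
  { intros z. unfold P. simpl. field. }
  apply bigO_minus; [apply bigO_plus|apply bigO_plus].
  - apply (bigO_comp 4 _ g csin_taylor Hg1).
  - exact Hg.
  - apply (bigO_mult 4 0); [exact Hg|]. apply (bigO_mult 0 0); [|apply bigO_const].
    repeat apply bigO_plus; apply (bigO_le 2); try lia;
      apply (bigO_mult 1 1); assumption.
  - apply (bigO_mult 4 0); [apply bigO_pow|]. apply bigO_ccont. simpl.
    repeat first [apply ccont_const|apply ccont_id|apply ccont_plus|apply ccont_mult].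
Qed.

Lemma hankel_upper_bound (f : C -> C) (a : nat -> C) :
  class_C_arcsin f -> normalized_expansion f a ->
  Cmod (hankel22 a) <= 1 / (9 * PI ^ 2).
Proof.
  intros [_ [w [[_ [_ Hw]] Hsub]]] [_ [Ha1 Hexp]].
  assert (HP := PI_RGT_0). assert (HP2 := PI2_3_2).
  assert (Ha := has_expansion_rad1 _ _ Hexp).
  assert (Hd1 := rad1_dcoef _ Ha). assert (Hd2 := rad1_dcoef _ Hd1).
  set (F1 := CS (dcoef a)). set (F2 := CS (dcoef (dcoef a))).
  set (b := 2 / PI).
  assert (Hb : 0 <= b <= 1).
  { unfold b. split; [apply Rdiv_le_0_compat; lra|].
    apply Rmult_le_reg_r with PI; [exact HP|]. unfold Rdiv. rewrite Rmult_assoc, Rinv_l; lra. }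
  assert (Hode : forall z, Cmod z < 1 -> (z * F2 z / F1 z)%C = (RtoC b * Carcsin (w z))%C).
  { intros z Hz. specialize (Hsub z Hz). simpl in Hsub.
    assert (Hexp' := has_expansion_C_derive _ _ Hexp).
    rewrite (C_derive_cder _ _ _ (cder_of_expansion _ _ z Hexp' Hz)) in Hsub.
    rewrite (C_derive_cder _ _ _ (cder_of_expansion _ _ z Hexp Hz)) in Hsub.
    fold F1 F2 b in Hsub.
    transitivity ((1 + z * F2 z / F1 z) - 1)%C; [ring|]. rewrite Hsub. ring. }
  assert (HF1 : forall z, Cmod z < 1 -> F1 z <> 0).
  { destruct Carcsin_bounded as [M HM].
    apply (nonvanishing_of_log_derivative_bound F1 F2 (b * M)).
    - intros z Hz. apply CS_cder; assumption.
    - unfold F1. rewrite CS_0 by exact Hd1. unfold dcoef. rewrite Ha1, Cmult_1_r.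
      exact C1_nz.
    - intros z Hz Hn. rewrite (C_eq_div _ _ _ Hn (Hode z Hz)).
      rewrite !Cmod_mult, Cmod_R, Rabs_pos_eq by lra.
      apply Rmult_le_compat_r; [apply Cmod_ge_0|].
      apply Rmult_le_compat_l; [lra|]. apply HM, Hw, Hz. }
  set (g := fun z : C => (RtoC (PI / 2) * (z * F2 z * / F1 z))%C).
  set (W := fun z : C => csin (g z)).
  assert (HWw : forall z, Cmod z < 1 -> W z = w z).
  { intros z Hz. unfold W, g. specialize (Hode z Hz). unfold Cdiv in Hode. rewrite Hode.
    rewrite Cmult_assoc, <- RtoC_mult. replace (PI / 2 * b) with 1 by (unfold b; field; lra).
    rewrite Cmult_1_l. apply csin_Carcsin. }
  assert (HholW : hol (fun z => Cmod z < 1) W).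
  { apply (hol_comp _ (fun _ => True) csin g); [apply hol_csin| |auto].
    apply hol_mult; [apply hol_const|]. apply hol_mult.
    - apply hol_mult; [apply hol_id|apply CS_hol, Hd2].
    - apply hol_inv; [apply CS_hol, Hd1|exact HF1]. }
  set (k := RtoC (PI / 2)).
  set (w1 := (k * (2 * a 2%nat))%C).
  set (w2 := (k * (6 * a 3%nat - 4 * a 2%nat ^ 2))%C).
  set (w3 := (k * (12 * a 4%nat - 18 * a 2%nat * a 3%nat + 8 * a 2%nat ^ 3))%C).
  assert (HO : bigO 4 (fun z => (W z - (w1 * z + w2 * z ^ 2 + (w3 - w1 ^ 3 / 6) * z ^ 3))%C)).
  { apply csin_comp_taylor.
    eapply bigO_ext; [|apply (bigO_mult 0 4 _ _ (bigO_const k) (log_derivative_taylor a Ha Ha1))].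
    intros z. unfold g, w1, w2, w3, k, F1, F2. simpl. ring. }
  assert (HX := hankel_functional_bound w1 w2 (w3 - w1 ^ 3 / 6)%C b Hb
    (fun s1 s2 => schwarz_toeplitz W w1 w2 _ s1 s2 HholW
       (fun z Hz => eq_ind_r (fun v => Cmod v <= 1) (Hw z Hz) (HWw z Hz)) HO)).
  assert (HPn : RtoC PI <> 0) by (intros E; apply RtoC_inj in E; lra).
  (* After substitution the contributions of a2^2 a3 and of a2^4 cancel; what survives is 18 PI^2
     (a2 a4 - a3^2). *)
  match type of HX with Cmod ?X <= 2 =>
    assert (E : X = (RtoC (18 * PI ^ 2) * hankel22 a)%C) end.
  { unfold hankel22, w1, w2, w3, k, b.
    replace (2 / PI / 2) with (/ PI) by (field; lra).
    replace ((1 - (2 / PI) ^ 2) / 2) with (/ 2 - 2 * / (PI * PI)) by (field; lra).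
    replace (18 * PI ^ 2) with (18 * (PI * PI)) by ring.
    replace (PI / 2) with (PI * / 2) by reflexivity.
    rewrite RtoC_minus, !RtoC_mult, !RtoC_inv, !RtoC_mult by (try lra; nra).
    simpl. field. exact HPn. }
  rewrite E, Cmod_mult, Cmod_R, Rabs_pos_eq in HX by nra.
  apply Rmult_le_reg_l with (18 * PI ^ 2); [nra|].
  replace (18 * PI ^ 2 * (1 / (9 * PI ^ 2))) with 2 by (field; lra). exact HX.
Qed.

(** * The extremal function *)

Lemma rad1_bounded (a : nat -> C) (M : R) : (forall n, Cmod (a n) <= M) -> rad1 a.
Proof.
  intros H rho Hrho. exists M. intros n.
  assert (H1 : rho ^ n <= 1) by (rewrite <- (pow1 n); apply pow_incr; lra).
  assert (H2 : 0 <= rho ^ n) by (apply pow_le; lra).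
  assert (H3 := Cmod_ge_0 (a n)). specialize (H n). nra.
Qed.

Lemma CS_scal (c : C) (a : nat -> C) (z : C) : rad1 a -> Cmod z < 1 ->
  CS (fun n => (c * a n)%C) z = (c * CS a z)%C.
Proof.
  intros Ha Hz. apply Csum_unique.
  apply is_Cseries_ext with (fun n => (c * (a n * z ^ n))%C); [intros n; ring|].
  apply is_Cseries_scal, CS_correct; assumption.
Qed.

Lemma CS_plus (a b : nat -> C) (z : C) : rad1 a -> rad1 b -> Cmod z < 1 ->
  CS (fun n => (a n + b n)%C) z = (CS a z + CS b z)%C.
Proof.
  intros Ha Hb Hz. apply Csum_unique.
  apply is_Cseries_ext with (fun n => (a n * z ^ n + b n * z ^ n)%C); [intros n; ring|].
  apply (@is_series_plus C_AbsRing C_NormedModule); apply CS_correct; assumption.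
Qed.

Lemma CS_euler (a : nat -> C) (z : C) : rad1 a -> Cmod z < 1 ->
  CS (fun n => (RtoC (INR n) * a n)%C) z = (z * CS (dcoef a) z)%C.
Proof.
  intros Ha Hz. rewrite CS_decr by (assumption || apply rad1_nmult, Ha).
  change (CS (fun n => RtoC (INR (S n)) * a (S n))%C z) with (CS (dcoef a) z).
  simpl INR. ring.
Qed.

Lemma constant_of_cder_0 (h : C -> C) (z : C) :
  (forall w, Cmod w < 1 -> cder h w 0) -> Cmod z < 1 -> h z = h 0.
Proof.
  intros H Hz. apply Ceq_minus, Cmod_eq_0, Rle_antisym; [|apply Cmod_ge_0].
  enough (K : Cmod (h z - h 0) <= 0 * Cmod z) by lra.
  apply (segment_mean_value h (fun _ => RtoC 0)). intros t Ht. split.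
  - apply H. rewrite Cmod_mult, Cmod_R, Rabs_pos_eq by lra.
    assert (H0 := Cmod_ge_0 z). nra.
  - rewrite Cmod_0. lra.
Qed.

(** Intermediate value theorem on the radius from 0 to [z]. Branch conditions thereby reduce to the
    avoidance of a single value. *)
Lemma re_gt_of_avoid (h : C -> C) (c : R) :
  (forall z, Cmod z < 1 -> ccont h z) -> c < Re (h 0) ->
  (forall z, Cmod z < 1 -> Re (h z) <> c) ->
  forall z, Cmod z < 1 -> c < Re (h z).
Proof.
  intros Hc H0 Hne z Hz. apply Rnot_le_lt. intros Hle.
  assert (Hlt : Re (h z) < c) by (specialize (Hne z Hz); lra).
  assert (E : forall t, (RtoC t * z)%C = (t * fst z, t * snd z)%R).
  { intros t. destruct z. unfold RtoC, Cmult; simpl. f_equal; ring. }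
  assert (Hzt : forall t, 0 <= t <= 1 -> Cmod (RtoC t * z) < 1).
  { intros t Ht. rewrite Cmod_mult, Cmod_R, Rabs_pos_eq by lra.
    assert (Hp := Cmod_ge_0 z). nra. }
  destruct (Ranalysis5.IVT_interv (fun t => - Re (h (t * fst z, t * snd z)%R) + c) 0 1)
    as [t [Ht Et]].
  - intros t Ht. apply continuity_pt_plus; [|apply continuity_pt_const; now intros x y].
    apply continuity_pt_opp.
    assert (Hlin : forall k, continuity_pt (fun s => s * k) t).
    { intros k. apply continuity_pt_mult; [apply derivable_continuous_pt, derivable_pt_id|].
      apply continuity_pt_const. now intros x y. }
    apply (continuity_pt_re_curve h (fun s => s * fst z) (fun s => s * snd z));
      [|apply Hlin|apply Hlin].
    rewrite <- E. apply Hc, Hzt, Ht.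
  - lra.
  - rewrite <- E, Cmult_0_l. lra.
  - rewrite <- E, Cmult_1_l. lra.
  - rewrite <- E in Et. apply (Hne (RtoC t * z)%C (Hzt t Ht)). lra.
Qed.

(* Coefficients of [(1 - z^4)^(-1/2)]. *)
Fixpoint isqrt_coef (n : nat) : R :=
  match n with
  | 0%nat => 1
  | S (S (S (S m))) => (INR m + 2) / (INR m + 4) * isqrt_coef m
  | _ => 0
  end.

(* Coefficients of [arcsin (z^2)], the primitive of [2 z (1 - z^4)^(-1/2)]. *)
Definition arcsin2_coef (n : nat) : R :=
  match n with S (S m) => 2 * isqrt_coef m / (INR m + 2) | _ => 0 end.

Definition isqrt_ccoef (n : nat) : C := RtoC (isqrt_coef n).
Definition arcsin2_ccoef (n : nat) : C := RtoC (arcsin2_coef n).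

Lemma nat_ind4 (P : nat -> Prop) :
  P 0%nat -> P 1%nat -> P 2%nat -> P 3%nat ->
  (forall n, P n -> P (S (S (S (S n))))) -> forall n, P n.
Proof.
  intros H0 H1 H2 H3 H n.
  enough (K : P n /\ P (S n) /\ P (S (S n)) /\ P (S (S (S n)))) by tauto.
  induction n as [|n [K0 [K1 [K2 K3]]]]; auto.
Qed.

Lemma isqrt_coef_bound (n : nat) : 0 <= isqrt_coef n <= 1.
Proof.
  induction n as [| | | |n IH] using nat_ind4; try (simpl; lra).
  cbn [isqrt_coef]. assert (Hn := pos_INR n).
  assert (H : 0 <= (INR n + 2) / (INR n + 4) <= 1).
  { split; [apply Rdiv_le_0_compat; lra|].
    apply Rmult_le_reg_r with (INR n + 4); [lra|].
    unfold Rdiv. rewrite Rmult_assoc, Rinv_l; lra. }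
  nra.
Qed.

Lemma arcsin2_coef_bound (n : nat) : 0 <= arcsin2_coef n <= 1.
Proof.
  destruct n as [|[|n]]; try (simpl; lra). cbn [arcsin2_coef].
  assert (H := isqrt_coef_bound n). assert (Hn := pos_INR n).
  split; [apply Rdiv_le_0_compat; lra|].
  apply Rmult_le_reg_r with (INR n + 2); [lra|].
  unfold Rdiv. rewrite Rmult_assoc, Rinv_l; lra.
Qed.

Lemma rad1_isqrt_ccoef : rad1 isqrt_ccoef.
Proof.
  apply rad1_bounded with 1. intros n. unfold isqrt_ccoef. assert (H := isqrt_coef_bound n).
  rewrite Cmod_R, Rabs_pos_eq; lra.
Qed.

Lemma rad1_arcsin2_ccoef : rad1 arcsin2_ccoef.
Proof.
  apply rad1_bounded with 1. intros n. unfold arcsin2_ccoef. assert (H := arcsin2_coef_bound n).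
  rewrite Cmod_R, Rabs_pos_eq; lra.
Qed.

(** The recurrence (m + 4) c_(m+4) = (m + 2) c_m is Y' = z^3 (z Y' + 2 Y) read off
    coefficientwise. *)
Lemma isqrt_series_ode (z : C) : Cmod z < 1 ->
  ((1 - z ^ 4) * CS (dcoef isqrt_ccoef) z = 2 * z ^ 3 * CS isqrt_ccoef z)%C.
Proof.
  intros Hz. assert (HY := rad1_isqrt_ccoef). assert (Hd := rad1_dcoef _ HY).
  assert (E : CS (dcoef isqrt_ccoef) z
              = (z ^ 3 * (z * CS (dcoef isqrt_ccoef) z + 2 * CS isqrt_ccoef z))%C).
  { rewrite (CS_decr3 (dcoef isqrt_ccoef)) at 1 by assumption.
    replace (dcoef isqrt_ccoef 0) with (RtoC 0) by (unfold dcoef, isqrt_ccoef; simpl; ring).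
    replace (dcoef isqrt_ccoef 1) with (RtoC 0) by (unfold dcoef, isqrt_ccoef; simpl; ring).
    replace (dcoef isqrt_ccoef 2) with (RtoC 0) by (unfold dcoef, isqrt_ccoef; simpl; ring).
    rewrite (CS_ext (fun n => dcoef isqrt_ccoef (S (S (S n))))
               (fun n => (RtoC (INR n) * isqrt_ccoef n + 2 * isqrt_ccoef n)%C)).
    - rewrite (CS_plus (fun n => RtoC (INR n) * isqrt_ccoef n)%C (fun n => 2 * isqrt_ccoef n)%C).
      + rewrite CS_euler, (CS_scal 2) by assumption. simpl. ring.
      + apply rad1_nmult, HY.
      + apply rad1_bounded with 2. intros n. unfold isqrt_ccoef.
        assert (H := isqrt_coef_bound n).
        rewrite <- RtoC_mult, Cmod_R, Rabs_pos_eq; lra.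
      + exact Hz.
    - intros n. unfold dcoef, isqrt_ccoef. cbn [isqrt_coef].
      rewrite <- !RtoC_mult, <- RtoC_plus. f_equal.
      rewrite !S_INR. assert (Hn := pos_INR n). field. lra. }
  transitivity (CS (dcoef isqrt_ccoef) z - z ^ 4 * CS (dcoef isqrt_ccoef) z)%C; [ring|].
  rewrite E at 1. simpl. ring.
Qed.

Lemma arcsin2_series_derivative (z : C) : Cmod z < 1 ->
  CS (dcoef arcsin2_ccoef) z = (2 * z * CS isqrt_ccoef z)%C.
Proof.
  intros Hz. rewrite CS_decr by (assumption || apply rad1_dcoef, rad1_arcsin2_ccoef).
  replace (dcoef arcsin2_ccoef 0) with (RtoC 0) by (unfold dcoef, arcsin2_ccoef; simpl; ring).
  rewrite (CS_ext (fun n => dcoef arcsin2_ccoef (S n)) (fun n => (2 * isqrt_ccoef n)%C)).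
  - rewrite (CS_scal 2) by (assumption || apply rad1_isqrt_ccoef). ring.
  - intros n. unfold dcoef, arcsin2_ccoef, isqrt_ccoef. cbn [arcsin2_coef].
    rewrite <- !RtoC_mult. f_equal. rewrite !S_INR. assert (Hn := pos_INR n). field. lra.
Qed.

Lemma cder_pow4 (z : C) : cder (fun w => 1 - w ^ 4)%C z (- (4 * z ^ 3))%C.
Proof.
  apply cder_ext_loc with (fun w => 1 - (w * w) * (w * w))%C.
  { exists 1. split; [lra|]. intros w _. simpl. ring. }
  apply cder_eq with (0 - ((1 * z + z * 1) * (z * z) + (z * z) * (1 * z + z * 1)))%C;
    [|simpl; ring].
  apply cder_minus; [apply cder_const|].
  apply (cder_mult (fun w => w * w)%C (fun w => w * w)%C);
    apply (cder_mult (fun w => w) (fun w => w)); apply cder_id.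
Qed.

(** By the differential equation of the series the left side has zero derivative, and it equals 1 at
    0. *)
Lemma isqrt_series_sqr (z : C) : Cmod z < 1 ->
  ((1 - z ^ 4) * (CS isqrt_ccoef z * CS isqrt_ccoef z))%C = 1.
Proof.
  intros Hz.
  transitivity ((1 - 0 ^ 4) * (CS isqrt_ccoef 0 * CS isqrt_ccoef 0))%C.
  - apply (constant_of_cder_0 (fun z => (1 - z ^ 4) * (CS isqrt_ccoef z * CS isqrt_ccoef z))%C);
      [|exact Hz].
    intros w Hw. assert (HY := CS_cder isqrt_ccoef w rad1_isqrt_ccoef Hw).
    assert (Ho := isqrt_series_ode w Hw).
    set (Y := CS isqrt_ccoef w) in *. set (dY := CS (dcoef isqrt_ccoef) w) in *.
    apply cder_eq with (- (4 * w ^ 3) * (Y * Y) + (1 - w ^ 4) * (dY * Y + Y * dY))%C.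
    + apply (cder_mult (fun w => 1 - w ^ 4)%C (fun w => CS isqrt_ccoef w * CS isqrt_ccoef w)%C);
        [apply cder_pow4|]. apply cder_mult; exact HY.
    + transitivity (2 * Y * ((1 - w ^ 4) * dY) - 4 * w ^ 3 * (Y * Y))%C; [ring|].
      rewrite Ho. ring.
  - rewrite CS_0 by apply rad1_isqrt_ccoef. unfold isqrt_ccoef. simpl. ring.
Qed.

(** The root of 1 - z^4 that is 1 at 0, written as (1 - z^4) times the series of (1 - z^4)^(-1/2) so
    that nothing is inverted. *)
Definition sqrt1z4 (z : C) : C := ((1 - z ^ 4) * CS isqrt_ccoef z)%C.

Lemma sqrt1z4_sqr (z : C) : Cmod z < 1 -> (sqrt1z4 z * sqrt1z4 z = 1 - (z * z) * (z * z))%C.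
Proof.
  intros Hz. unfold sqrt1z4.
  transitivity ((1 - z ^ 4) * ((1 - z ^ 4) * (CS isqrt_ccoef z * CS isqrt_ccoef z)))%C; [ring|].
  rewrite isqrt_series_sqr by exact Hz. simpl. ring.
Qed.

Lemma cder_sqrt1z4 (z : C) : Cmod z < 1 -> cder sqrt1z4 z (- (2 * z ^ 3 * CS isqrt_ccoef z))%C.
Proof.
  intros Hz. assert (Ho := isqrt_series_ode z Hz).
  apply cder_eq with (- (4 * z ^ 3) * CS isqrt_ccoef z + (1 - z ^ 4) * CS (dcoef isqrt_ccoef) z)%C.
  - apply (cder_mult (fun w => 1 - w ^ 4)%C (CS isqrt_ccoef)); [apply cder_pow4|].
    apply CS_cder; [apply rad1_isqrt_ccoef|exact Hz].
  - rewrite Ho. ring.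
Qed.

Lemma sqrt1z4_0 : sqrt1z4 0 = 1.
Proof. unfold sqrt1z4. rewrite CS_0 by apply rad1_isqrt_ccoef. unfold isqrt_ccoef. simpl. ring. Qed.

(** The product of the right side with exp (- i A), A the series, has zero derivative and value 1 at
    0. *)
Lemma cexp_arcsin2_series (z : C) : Cmod z < 1 ->
  cexp (Ci * CS arcsin2_ccoef z) = (Ci * (z * z) + sqrt1z4 z)%C.
Proof.
  intros Hz.
  set (h := fun w : C => ((Ci * (w * w) + sqrt1z4 w) * cexp (- Ci * CS arcsin2_ccoef w))%C).
  assert (Eh : h z = 1).
  { transitivity (h 0).
    - apply constant_of_cder_0; [|exact Hz]. intros w Hw. unfold h.
      assert (HD := CS_cder arcsin2_ccoef w rad1_arcsin2_ccoef Hw).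
      rewrite arcsin2_series_derivative in HD by exact Hw.
      assert (HQ := cder_sqrt1z4 w Hw). assert (Hs := isqrt_series_sqr w Hw).
      set (Y := CS isqrt_ccoef w) in *. set (e := cexp (- Ci * CS arcsin2_ccoef w)) in *.
      apply cder_eq with ((Ci * (1 * w + w * 1) + - (2 * w ^ 3 * Y)) * e
         + (Ci * (w * w) + sqrt1z4 w) * (e * (- Ci * (2 * w * Y))))%C.
      + apply (cder_mult (fun w => Ci * (w * w) + sqrt1z4 w)%C
                 (fun w => cexp (- Ci * CS arcsin2_ccoef w))).
        * apply cder_plus; [|exact HQ]. apply cder_scal.
          apply (cder_mult (fun w => w) (fun w => w)); apply cder_id.
        * apply (cder_comp cexp (fun w => - Ci * CS arcsin2_ccoef w)%C); [|apply cder_cexp].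
          apply cder_scal, HD.
      + unfold sqrt1z4. fold Y.
        transitivity (2 * w * e * (Ci - w ^ 2 * Y - (Ci * Ci) * (w ^ 2 * Y)
           - Ci * ((1 - w ^ 4) * (Y * Y))))%C; [simpl; ring|].
        rewrite Hs, Ci2. simpl. ring.
    - unfold h. rewrite sqrt1z4_0, CS_0 by apply rad1_arcsin2_ccoef. unfold arcsin2_ccoef. simpl.
      replace (- Ci * 0)%C with (RtoC 0) by ring. rewrite cexp_0. ring. }
  assert (Ee := cexp_opp_r (Ci * CS arcsin2_ccoef z)%C).
  replace (- (Ci * CS arcsin2_ccoef z))%C with (- Ci * CS arcsin2_ccoef z)%C in Ee by ring.
  unfold h in Eh.
  transitivity (cexp (Ci * CS arcsin2_ccoef z)
                * ((Ci * (z * z) + sqrt1z4 z) * cexp (- Ci * CS arcsin2_ccoef z)))%C;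
    [rewrite Eh; ring|].
  transitivity ((cexp (Ci * CS arcsin2_ccoef z) * cexp (- Ci * CS arcsin2_ccoef z))
                * (Ci * (z * z) + sqrt1z4 z))%C;
    [ring|]. rewrite Ee. ring.
Qed.

(** A purely imaginary value would have a square with nonpositive real part, whereas Re (1 - z^4) >
    0 in the disk. *)
Lemma re_sqrt1z4_pos (z : C) : Cmod z < 1 -> 0 < Re (sqrt1z4 z).
Proof.
  apply (re_gt_of_avoid sqrt1z4 0).
  - intros w Hw. apply cder_ccont with (1 := cder_sqrt1z4 w Hw).
  - rewrite sqrt1z4_0, re_RtoC. lra.
  - intros w Hw E. assert (Hs := f_equal Re (sqrt1z4_sqr w Hw)).
    rewrite re_mult, E in Hs.
    assert (H1 := Rle_trans _ _ _ (Rle_abs _) (re_le_Cmod ((w * w) * (w * w))%C)).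
    rewrite !Cmod_mult in H1. assert (H0 := Cmod_ge_0 w).
    assert (H2 : Cmod w * Cmod w < 1) by nra.
    assert (H3 : Cmod w * Cmod w * (Cmod w * Cmod w) < 1) by nra.
    replace (Re (1 - w * w * (w * w))%C) with (1 - Re (w * w * (w * w))%C) in Hs by reflexivity.
    assert (H4 := pow2_ge_0 (Im (sqrt1z4 w))). nra.
Qed.

(** Let zeta = exp (i A). Then zeta + 1/zeta is twice the root of 1 - z^4, so its real part is
    positive; as zeta and 1/zeta have real parts of equal sign, Re zeta > 0. Hence cos (Re A) > 0,
    and Re A, which starts at 0, never reaches PI/2 or -PI/2. *)
Lemma re_arcsin2_series_bound (z : C) : Cmod z < 1 -> - (PI / 2) < Re (CS arcsin2_ccoef z) < PI / 2.
Proof.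
  assert (HP := PI_RGT_0).
  assert (Hcos : forall w, Cmod w < 1 -> 0 < cos (Re (CS arcsin2_ccoef w))).
  { intros w Hw. assert (Hq := re_sqrt1z4_pos w Hw). assert (Hs := sqrt1z4_sqr w Hw).
    assert (He := f_equal Re (cexp_arcsin2_series w Hw)).
    assert (Hre : 0 < Re (Ci * (w * w) + sqrt1z4 w)%C).
    { set (zeta := (Ci * (w * w) + sqrt1z4 w)%C) in *.
      assert (Hm : (zeta * (2 * sqrt1z4 w - zeta))%C = 1).
      { transitivity (sqrt1z4 w * sqrt1z4 w - (Ci * Ci) * ((w * w) * (w * w)))%C;
          [unfold zeta; ring|]. rewrite Hs, Ci2. ring. }
      destruct zeta as [x y]. destruct (sqrt1z4 w) as [u v].
      unfold Re in *; simpl in *. injection Hm. intros M1 M2. clear Hm.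
      set (p := 2 * u - x). set (t := 2 * v - y).
      assert (N1 : x * p - y * t = 1) by (unfold p, t; lra).
      assert (N2 : x * t + y * p = 0) by (unfold p, t; lra).
      assert (N3 : x * (p * p + t * t) = p).
      { replace (x * (p * p + t * t))
          with (p * (x * p - y * t) + t * (x * t + y * p)) by ring.
        rewrite N1, N2. ring. }
      apply Rnot_le_lt. intros Hx. assert (Hp : 0 < p) by (unfold p; lra).
      assert (0 < p * p + t * t) by nra. nra. }
    rewrite <- He in Hre.
    change (0 < exp (Re (Ci * CS arcsin2_ccoef w)%C) * cos (Im (Ci * CS arcsin2_ccoef w)%C)) in Hre.
    replace (Im (Ci * CS arcsin2_ccoef w)%C) with (Re (CS arcsin2_ccoef w)) in Hre
      by (unfold Re, Im, Ci, Cmult; simpl; ring).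
    apply Rmult_lt_reg_l with (1 := exp_pos (Re (Ci * CS arcsin2_ccoef w)%C)). lra. }
  assert (HcD : forall w, Cmod w < 1 -> ccont (CS arcsin2_ccoef) w).
  { intros w Hw. eapply cder_ccont, CS_cder; [apply rad1_arcsin2_ccoef|exact Hw]. }
  assert (HD0 : CS arcsin2_ccoef 0 = 0) by (rewrite CS_0 by apply rad1_arcsin2_ccoef; reflexivity).
  intros Hz. split.
  - apply (re_gt_of_avoid (CS arcsin2_ccoef) (- (PI / 2)) HcD); [rewrite HD0, re_RtoC; lra| |exact Hz].
    intros w Hw E. specialize (Hcos w Hw). rewrite E, cos_neg, cos_PI2 in Hcos. lra.
  - apply Ropp_lt_cancel. rewrite <- re_opp.
    apply (re_gt_of_avoid (fun w => - CS arcsin2_ccoef w)%C (- (PI / 2))); [| | |exact Hz].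
    + intros w Hw. apply ccont_opp, HcD, Hw.
    + rewrite HD0, re_opp, re_RtoC. lra.
    + intros w Hw E. specialize (Hcos w Hw).
      assert (E' : Re (CS arcsin2_ccoef w) = PI / 2) by (rewrite re_opp in E; lra).
      rewrite E', cos_PI2 in Hcos. lra.
Qed.

Lemma Carcsin_sqr (z : C) : Cmod z < 1 -> Carcsin (z * z)%C = CS arcsin2_ccoef z.
Proof.
  intros Hz. apply Carcsin_unique with (sqrt1z4 z).
  - apply sqrt1z4_sqr, Hz.
  - apply re_sqrt1z4_pos, Hz.
  - apply cexp_arcsin2_series, Hz.
  - assert (H := re_arcsin2_series_bound z Hz). lra.
Qed.

(** The coefficients are nonnegative, so at real [r] the partial sum times r^N is at most the value
    of the series, which is below PI/2; then [r] tends to 1. Convergence at the point 1 itself is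
    not presupposed. *)
Lemma sum_arcsin2_coef_le (N : nat) : sum_n arcsin2_coef N <= PI / 2.
Proof.
  assert (HP := PI_RGT_0).
  apply (le_of_forall_pow N); [lra|]. intros r Hr.
  assert (Hz : Cmod (RtoC r) < 1) by (rewrite Cmod_R, Rabs_pos_eq; lra).
  apply Rle_trans with (Re (CS arcsin2_ccoef (RtoC r)));
    [|left; apply re_arcsin2_series_bound, Hz].
  assert (K := proj1 (proj1 (is_Cseries_iff _ _)
    (CS_correct arcsin2_ccoef (RtoC r) rad1_arcsin2_ccoef Hz))).
  assert (K' : is_series (fun n => arcsin2_coef n * r ^ n) (Re (CS arcsin2_ccoef (RtoC r)))).
  { apply is_series_ext with (2 := K). intros n. unfold arcsin2_ccoef.
    rewrite <- RtoC_pow, <- RtoC_mult. reflexivity. }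
  apply Rle_trans with (2 := sum_n_pos_le _ _ N
    (fun k => Rmult_le_pos _ _ (proj1 (arcsin2_coef_bound k)) (pow_le r k ltac:(lra))) K').
  rewrite <- (sum_n_mult_l (K := R_Ring) (r ^ N)).
  rewrite !sum_n_Reals. apply sum_Rle. intros n Hn.
  unfold mult; simpl. rewrite Rmult_comm.
  apply Rmult_le_compat_l; [apply arcsin2_coef_bound|].
  replace N with (n + (N - n))%nat by lia. rewrite pow_add.
  assert (H1 : 0 <= r ^ n) by (apply pow_le; lra).
  assert (H2 : r ^ (N - n) <= 1) by (rewrite <- (pow1 (N - n)); apply pow_incr; lra).
  nra.
Qed.

(* [exp_coef_upto psi N] is the solution of [n p_n = sum_(k <= n) psi_k p_(n-k)], [p_0 = 1],
   up to the index [N]; the term [k = 0], which refers to a not yet defined value,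
   carries the factor [psi_0 = 0]. *)
Fixpoint exp_coef_upto (psi : nat -> R) (N : nat) : nat -> R :=
  match N with
  | 0%nat => fun n => if Nat.eqb n 0 then 1 else 0
  | S M => fun n =>
      if Nat.eqb n (S M)
      then sum_f_R0 (fun k => psi k * exp_coef_upto psi M (n - k)) n / INR n
      else exp_coef_upto psi M n
  end.

Definition exp_coef (psi : nat -> R) (n : nat) : R := exp_coef_upto psi n n.

Lemma exp_coef_upto_stable (psi : nat -> R) (n N : nat) : (n <= N)%nat ->
  exp_coef_upto psi N n = exp_coef psi n.
Proof.
  intros H. induction N as [|N IH].
  - replace n with 0%nat by lia. reflexivity.
  - destruct (Nat.eq_dec n (S N)) as [->|Hn]; [reflexivity|].
    simpl exp_coef_upto. rewrite (proj2 (Nat.eqb_neq n (S N)) Hn). apply IH. lia.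
Qed.

Lemma exp_coef_0 (psi : nat -> R) : exp_coef psi 0 = 1.
Proof. reflexivity. Qed.

Lemma exp_coef_rec (psi : nat -> R) (n : nat) : psi 0%nat = 0 ->
  INR n * exp_coef psi n = sum_f_R0 (fun k => psi k * exp_coef psi (n - k)) n.
Proof.
  intros H0. destruct n as [|n]; [simpl; rewrite H0; ring|].
  unfold exp_coef at 1. cbn [exp_coef_upto]. rewrite Nat.eqb_refl.
  transitivity (sum_f_R0 (fun k => psi k * exp_coef_upto psi n (S n - k)) (S n)).
  - field. apply not_0_INR. lia.
  - apply sum_eq. intros k Hk. destruct k as [|k]; [rewrite H0; ring|].
    rewrite exp_coef_upto_stable by lia. reflexivity.
Qed.

Lemma sum_f_R0_pos (u : nat -> R) (n : nat) :
  (forall k, (k <= n)%nat -> 0 <= u k) -> 0 <= sum_f_R0 u n.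
Proof.
  intros H. rewrite <- (sum_eq_R0 (fun _ => 0) n) by reflexivity.
  apply sum_Rle. exact H.
Qed.

Lemma exp_coef_pos (psi : nat -> R) (n : nat) : psi 0%nat = 0 -> (forall k, 0 <= psi k) ->
  0 <= exp_coef psi n.
Proof.
  intros H0 Hpsi. induction n as [n IH] using lt_wf_ind.
  destruct n as [|n]; [rewrite exp_coef_0; lra|].
  assert (Hn : 0 < INR (S n)) by (apply lt_0_INR; lia).
  apply Rmult_le_reg_l with (INR (S n)); [exact Hn|].
  rewrite Rmult_0_r, exp_coef_rec by exact H0. apply sum_f_R0_pos. intros k Hk.
  destruct k as [|k]; [rewrite H0; lra|].
  apply Rmult_le_pos; [apply Hpsi|apply IH; lia].
Qed.

(* If [psi] starts at order 2 then [2 (T - 1) <= sum n p_n <= (sum psi) T <= T]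
   for the partial sums [T] of [p]. *)
Lemma sum_exp_coef_le (psi : nat -> R) (N : nat) :
  psi 0%nat = 0 -> psi 1%nat = 0 -> (forall k, 0 <= psi k) ->
  (forall n, sum_f_R0 psi n <= 1) -> sum_f_R0 (exp_coef psi) N <= 2.
Proof.
  intros H0 H1 Hpos Hsum.
  assert (Hp := fun n => exp_coef_pos psi n H0 Hpos).
  destruct N as [|N]; [simpl; rewrite exp_coef_0; lra|].
  assert (E1 : exp_coef psi 1 = 0).
  { assert (E := exp_coef_rec psi 1 H0). simpl in E. rewrite H0, H1 in E. lra. }
  set (T := sum_f_R0 (exp_coef psi) (S N)).
  (* The term p_0 = 1 has weight 0 and accounts for the subtracted 1; p_1 = 0, and from index 2 on
     the weight is at least 2. *)
  assert (L1 : 2 * (T - 1) <= sum_f_R0 (fun n => INR n * exp_coef psi n) (S N)).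
  { unfold T. clear T. induction N as [|N IH].
    - simpl. rewrite exp_coef_0, E1. lra.
    - rewrite !(tech5 _ (S N)). specialize (Hp (S (S N))).
      assert (2 <= INR (S (S N))) by (rewrite !S_INR; generalize (pos_INR N); lra). nra. }
  (* The product of the two partial sums exceeds the truncated Cauchy product by products of
     nonnegative terms. *)
  assert (L2 : sum_f_R0 (fun n => INR n * exp_coef psi n) (S N) <= sum_f_R0 psi (S N) * T).
  { unfold T. rewrite (cauchy_finite psi (exp_coef psi) (S N)) by lia.
    rewrite (sum_eq _ (fun k => sum_f_R0 (fun p => psi p * exp_coef psi (k - p)) k) (S N))
      by (intros k _; apply exp_coef_rec, H0).
    apply Rplus_le_reg_l with
      (- sum_f_R0 (fun k => sum_f_R0 (fun p => psi p * exp_coef psi (k - p)) k) (S N)).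
    rewrite Rplus_opp_l, <- Rplus_assoc, Rplus_opp_l, Rplus_0_l.
    apply sum_f_R0_pos. intros k _. apply sum_f_R0_pos. intros l _.
    apply Rmult_le_pos; auto. }
  assert (HT : 0 <= T) by (apply sum_f_R0_pos; auto).
  specialize (Hsum (S N)). nra.
Qed.

(** Expanding into real and imaginary parts reduces the claim to four real Cauchy products, each
    absolutely convergent. *)
Lemma is_Cseries_mult (u v : nat -> C) (l m : C) :
  is_Cseries u l -> is_Cseries v m ->
  ex_series (fun n => Cmod (u n)) -> ex_series (fun n => Cmod (v n)) ->
  is_Cseries (fun n => @sum_n C_AbelianMonoid (fun k => (u k * v (n - k)%nat)%C) n) (l * m)%C.
Proof.
  intros Hu Hv Au Av.
  apply is_Cseries_iff in Hu. apply is_Cseries_iff in Hv.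
  destruct Hu as [U1 U2]. destruct Hv as [V1 V2].
  assert (Hre : forall w : nat -> C, ex_series (fun n => Cmod (w n)) ->
     ex_series (fun n => Rabs (fst (w n)))).
  { intros w. apply (@ex_series_le R_AbsRing R_CompleteNormedModule). intros n.
    change (Rabs (Rabs (fst (w n))) <= Cmod (w n)). rewrite Rabs_Rabsolu. apply re_le_Cmod. }
  assert (Him : forall w : nat -> C, ex_series (fun n => Cmod (w n)) ->
     ex_series (fun n => Rabs (snd (w n)))).
  { intros w. apply (@ex_series_le R_AbsRing R_CompleteNormedModule). intros n.
    change (Rabs (Rabs (snd (w n))) <= Cmod (w n)). rewrite Rabs_Rabsolu. apply im_le_Cmod. }
  apply is_Cseries_iff. split.
  - apply is_series_ext with (fun n =>
      minus (sum_f_R0 (fun k => fst (u k) * fst (v (n - k)%nat)) n)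
            (sum_f_R0 (fun k => snd (u k) * snd (v (n - k)%nat)) n)).
    { intros n. rewrite sum_n_fst, sum_n_Reals. symmetry.
      apply (minus_sum (fun k => fst (u k) * fst (v (n - k)%nat))
                       (fun k => snd (u k) * snd (v (n - k)%nat)) n). }
    exact (@is_series_minus R_AbsRing R_NormedModule _ _ _ _
             (is_series_mult _ _ _ _ U1 V1 (Hre _ Au) (Hre _ Av))
             (is_series_mult _ _ _ _ U2 V2 (Him _ Au) (Him _ Av))).
  - apply is_series_ext with (fun n =>
      plus (sum_f_R0 (fun k => fst (u k) * snd (v (n - k)%nat)) n)
           (sum_f_R0 (fun k => snd (u k) * fst (v (n - k)%nat)) n)).
    { intros n. rewrite sum_n_snd, sum_n_Reals. symmetry.
      apply (plus_sum (fun k => fst (u k) * snd (v (n - k)%nat))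
                       (fun k => snd (u k) * fst (v (n - k)%nat)) n). }
    exact (@is_series_plus R_AbsRing R_NormedModule _ _ _ _
             (is_series_mult _ _ _ _ U1 V2 (Hre _ Au) (Him _ Av))
             (is_series_mult _ _ _ _ U2 V1 (Him _ Au) (Hre _ Av))).
Qed.

Lemma sum_n_RtoC_pow (c : nat -> R) (z : C) (n m : nat) :
  @sum_n C_AbelianMonoid (fun k => (RtoC (c k) * z ^ n)%C) m
  = (RtoC (sum_f_R0 c m) * z ^ n)%C.
Proof.
  induction m as [|m IH]; [now rewrite sum_O|].
  rewrite sum_Sn, IH. simpl sum_f_R0. rewrite RtoC_plus.
  change (RtoC (sum_f_R0 c m) * z ^ n + RtoC (c (S m)) * z ^ n
    = (RtoC (sum_f_R0 c m) + RtoC (c (S m))) * z ^ n)%C. ring.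
Qed.

(** The coefficient of z^n in the Cauchy product on the right is n p_n by the recurrence. With F the
    series of p this is z F' = psi F, so F = exp (int psi / z). *)
Lemma exp_coef_series_ode (psi : nat -> R) (z : C) :
  psi 0%nat = 0 -> rad1 (fun n => RtoC (psi n)) -> rad1 (fun n => RtoC (exp_coef psi n)) ->
  Cmod z < 1 ->
  (z * CS (dcoef (fun n => RtoC (exp_coef psi n))) z
   = CS (fun n => RtoC (psi n)) z * CS (fun n => RtoC (exp_coef psi n)) z)%C.
Proof.
  intros H0 Hpsi Hp Hz.
  rewrite <- CS_euler by assumption. apply Csum_unique.
  assert (A : forall a, rad1 a -> ex_series (fun n => Cmod (a n * z ^ n)%C)).
  { intros a Ha.
    assert (Ha' := rad1_summable a (Cmod z) Ha (conj (Cmod_ge_0 z) Hz)).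
    revert Ha'. apply ex_series_ext. intros n. now rewrite Cmod_mult, Cmod_pow. }
  assert (M := is_Cseries_mult _ _ _ _ (CS_correct _ z Hpsi Hz) (CS_correct _ z Hp Hz)
                 (A _ Hpsi) (A _ Hp)).
  apply is_Cseries_ext with (2 := M). intros n. simpl.
  rewrite <- RtoC_mult, exp_coef_rec by exact H0. rewrite <- sum_n_RtoC_pow.
  apply sum_n_ext_loc. intros k Hk.
  assert (E : (RtoC (psi k) * z ^ k * (RtoC (exp_coef psi (n - k)) * z ^ (n - k))
               = RtoC (psi k * exp_coef psi (n - k)) * z ^ n)%C).
  { replace (z ^ n)%C with (z ^ k * z ^ (n - k))%C.
    - rewrite RtoC_mult. ring.
    - rewrite <- Cpow_add_r. f_equal. lia. }
  exact E.
Qed.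

Lemma is_derive_affine (c k t : R) : is_derive (fun s => c + s * k) t k.
Proof. auto_derive; [exact I|ring]. Qed.

(* [Re (conj (w - z) f)] increases strictly along the segment from [z] to [w]. *)
Lemma noshiro_warschawski (f df : C -> C) :
  (forall z, Cmod z < 1 -> cder f z (df z)) -> (forall z, Cmod z < 1 -> 0 < Re (df z)) ->
  univalent_in_disk f.
Proof.
  intros Hf Hpos z w Hz Hw Efw. unfold unit_disk in *.
  destruct (Ceq_dec z w) as [E|Hne]; [exact E|exfalso].
  set (d := (w - z)%C).
  assert (Hd : d <> 0) by (apply Cminus_eq_contra; congruence).
  assert (Hd' := proj1 (Cmod_gt_0 _) Hd).
  assert (E : forall t, (z + RtoC t * d)%C = (fst z + t * fst d, snd z + t * snd d)%R).
  { intros t. destruct z, d. unfold RtoC, Cplus, Cmult; simpl. f_equal; ring. }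
  assert (Hin : forall t, 0 <= t <= 1 -> Cmod (z + RtoC t * d) < 1).
  { intros t Ht. replace (z + RtoC t * d)%C with (RtoC (1 - t) * z + RtoC t * w)%C
      by (unfold d; rewrite RtoC_minus; ring).
    eapply Rle_lt_trans; [apply Cmod_triangle|].
    rewrite !Cmod_mult, !Cmod_R, !Rabs_pos_eq by lra.
    apply Rle_lt_trans with (Rmax (Cmod z) (Cmod w)); [|apply Rmax_lub_lt; assumption].
    assert (H0 := Rmax_l (Cmod z) (Cmod w)). assert (H1 := Rmax_r (Cmod z) (Cmod w)). nra. }
  set (u := fun t : R => Re (Cconj d * f (z + RtoC t * d))%C).
  assert (Hu : forall t, 0 <= t <= 1 ->
     is_derive u t (Re (Cconj d * df (z + RtoC t * d) * d)%C)).
  { intros t Ht.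
    apply is_derive_ext with (fun s => Re (Cconj d * f (fst z + s * fst d, snd z + s * snd d)%R)%C).
    { intros s. unfold u. now rewrite E. }
    replace (Re (Cconj d * df (z + RtoC t * d) * d)%C)
      with (Re (Cconj d * df (z + RtoC t * d) * (fst d, snd d)%R)%C)
      by (now rewrite <- surjective_pairing).
    apply (is_derive_re_curve (fun w => Cconj d * f w)%C _
             (fun s => fst z + s * fst d) (fun s => snd z + s * snd d)).
    - rewrite <- E. apply cder_scal, Hf, Hin, Ht.
    - apply is_derive_affine.
    - apply is_derive_affine. }
  destruct (MVT_gen u 0 1 (fun t => Re (Cconj d * df (z + RtoC t * d) * d)%C)) as [c [Hc K]].
  - rewrite Rmin_left, Rmax_right by lra. intros t Ht. apply Hu. lra.
  - rewrite Rmin_left, Rmax_right by lra. intros t Ht. apply derivable_continuous_pt.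
    eexists. apply is_derive_Reals, Hu, Ht.
  - rewrite Rmin_left, Rmax_right in Hc by lra.
    assert (U : u 1 = u 0).
    { unfold u. replace (z + 1 * d)%C with w by (unfold d; ring).
      replace (z + 0 * d)%C with z by (clearbody d; ring). now rewrite Efw. }
    rewrite U in K.
    replace (Cconj d * df (z + RtoC c * d) * d)%C
      with (RtoC (Cmod d ^ 2) * df (z + RtoC c * d))%C in K by (rewrite Cmod2_conj; ring).
    rewrite re_scal_l in K. specialize (Hpos _ (Hin c Hc)).
    assert (0 < Cmod d ^ 2) by nra. nra.
Qed.

(** Coefficients of (2/PI) arcsin (z^2), the prescribed z f''/f'. The factor 2/PI, reciprocal to
    arcsin 1, keeps their sum at most 1. *)
Definition psi_coef (n : nat) : R := 2 / PI * arcsin2_coef n.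

Definition extremal_deriv_coef (n : nat) : C := RtoC (exp_coef psi_coef n).

Definition extremal_coef (n : nat) : C :=
  match n with 0%nat => RtoC 0 | S m => RtoC (exp_coef psi_coef m / INR (S m)) end.

Lemma psi_coef_pos (n : nat) : 0 <= psi_coef n.
Proof.
  assert (HP := PI_RGT_0). apply Rmult_le_pos; [apply Rdiv_le_0_compat; lra|].
  apply arcsin2_coef_bound.
Qed.

Lemma psi_coef_sum (n : nat) : sum_f_R0 psi_coef n <= 1.
Proof.
  assert (HP := PI_RGT_0). unfold psi_coef.
  rewrite (sum_eq _ (fun i => arcsin2_coef i * (2 / PI)) n) by (intros; ring).
  rewrite <- scal_sum.
  assert (H : sum_f_R0 arcsin2_coef n <= PI / 2).
  { rewrite <- sum_n_Reals. apply sum_arcsin2_coef_le. }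
  apply Rmult_le_reg_l with (PI / 2); [lra|].
  replace (PI / 2 * (2 / PI * sum_f_R0 arcsin2_coef n)) with (sum_f_R0 arcsin2_coef n)
    by (field; lra).
  rewrite Rmult_1_r. exact H.
Qed.

Lemma psi_coef_0 : psi_coef 0 = 0.
Proof. unfold psi_coef. simpl. ring. Qed.

Lemma psi_coef_1 : psi_coef 1 = 0.
Proof. unfold psi_coef. simpl. ring. Qed.

Lemma extremal_deriv_coef_sum (N : nat) : sum_f_R0 (exp_coef psi_coef) N <= 2.
Proof.
  apply sum_exp_coef_le.
  - apply psi_coef_0.
  - apply psi_coef_1.
  - apply psi_coef_pos.
  - apply psi_coef_sum.
Qed.

Lemma extremal_deriv_coef_pos (n : nat) : 0 <= exp_coef psi_coef n.
Proof. apply exp_coef_pos; [apply psi_coef_0|apply psi_coef_pos]. Qed.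

Lemma extremal_deriv_coef_le (n : nat) : exp_coef psi_coef n <= 2.
Proof.
  assert (H := extremal_deriv_coef_sum n). destruct n as [|n]; [exact H|].
  simpl in H. assert (H1 := sum_f_R0_pos _ n (fun k _ => extremal_deriv_coef_pos k)). lra.
Qed.

Lemma rad1_extremal_deriv_coef : rad1 extremal_deriv_coef.
Proof.
  apply rad1_bounded with 2. intros n. unfold extremal_deriv_coef.
  rewrite Cmod_R, Rabs_pos_eq by apply extremal_deriv_coef_pos. apply extremal_deriv_coef_le.
Qed.

Lemma rad1_extremal_coef : rad1 extremal_coef.
Proof.
  apply rad1_bounded with 2. intros [|n]; unfold extremal_coef.
  - rewrite Cmod_0. lra.
  - assert (Hn : 1 <= INR (S n)) by (rewrite S_INR; generalize (pos_INR n); lra).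
    assert (H1 := extremal_deriv_coef_pos n). assert (H2 := extremal_deriv_coef_le n).
    rewrite Cmod_R, Rabs_pos_eq by (apply Rdiv_le_0_compat; lra).
    apply Rmult_le_reg_r with (INR (S n)); [lra|].
    unfold Rdiv. rewrite Rmult_assoc, Rinv_l by lra. nra.
Qed.

Lemma dcoef_extremal_coef (n : nat) : dcoef extremal_coef n = extremal_deriv_coef n.
Proof.
  unfold dcoef, extremal_coef, extremal_deriv_coef. rewrite <- RtoC_mult. f_equal. field.
  apply not_0_INR. lia.
Qed.

(** The constant term is 1 and the remaining coefficients sum to at most 1. One factor [z] is split
    off to make the comparison strict in the open disk. *)
Lemma re_extremal_deriv_pos (z : C) : Cmod z < 1 -> 0 < Re (CS extremal_deriv_coef z).
Proof.
  intros Hz. rewrite CS_decr by (assumption || apply rad1_extremal_deriv_coef).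
  replace (extremal_deriv_coef 0) with (RtoC 1) by reflexivity.
  set (s := CS (fun n => extremal_deriv_coef (S n)) z).
  assert (Hs : Cmod s <= 1).
  { apply (Cmod_series_le_partial (fun n => extremal_deriv_coef (S n) * z ^ n)%C).
    - intros N. rewrite sum_n_Reals.
      apply Rle_trans with (sum_f_R0 (fun k => exp_coef psi_coef (S k)) N).
      + apply sum_Rle. intros n _. unfold extremal_deriv_coef.
        rewrite Cmod_mult, Cmod_R, Rabs_pos_eq, Cmod_pow by apply extremal_deriv_coef_pos.
        assert (H0 := Cmod_ge_0 z).
        assert (H1 : Cmod z ^ n <= 1) by (rewrite <- (pow1 n); apply pow_incr; lra).
        assert (H2 := extremal_deriv_coef_pos (S n)). nra.
      + assert (H := extremal_deriv_coef_sum (S N)).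
        rewrite decomp_sum in H by lia. rewrite exp_coef_0 in H. simpl pred in H. lra.
    - apply CS_correct; [apply rad1_shift, rad1_extremal_deriv_coef|exact Hz]. }
  assert (H1 := re_le_Cmod (z * s)%C). rewrite Cmod_mult in H1.
  apply Rabs_le_between in H1. rewrite re_plus, re_RtoC.
  assert (H0 := Cmod_ge_0 z). assert (H2 := Cmod_ge_0 s). nra.
Qed.

Lemma psi_series (z : C) : Cmod z < 1 ->
  CS (fun n => RtoC (psi_coef n)) z = (RtoC (2 / PI) * Carcsin (z * z))%C.
Proof.
  intros Hz. rewrite Carcsin_sqr by exact Hz.
  rewrite <- CS_scal by (assumption || apply rad1_arcsin2_ccoef).
  apply CS_ext. intros n. unfold arcsin2_ccoef, psi_coef. apply RtoC_mult.
Qed.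

Lemma rad1_psi_coef : rad1 (fun n => RtoC (psi_coef n)).
Proof.
  apply rad1_bounded with 1. intros n. assert (H := psi_coef_pos n).
  rewrite Cmod_R, Rabs_pos_eq by exact H. assert (H1 := psi_coef_sum n).
  destruct n as [|n]; [exact H1|]. simpl in H1.
  assert (H2 := sum_f_R0_pos _ n (fun k _ => psi_coef_pos k)). lra.
Qed.

Lemma extremal_in_class : class_C_arcsin (CS extremal_coef).
Proof.
  assert (Hexp := CS_expansion _ rad1_extremal_coef).
  assert (Hder : forall z, Cmod z < 1 -> cder (CS extremal_coef) z (CS extremal_deriv_coef z)).
  { intros z Hz. apply cder_eq with (1 := CS_cder _ z rad1_extremal_coef Hz).
    apply CS_ext, dcoef_extremal_coef. }
  split; [split; [split|]|].
  - intros z Hz. eexists. apply is_derive_of_cder, Hder, Hz.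
  - exists extremal_coef. split; [reflexivity|]. split; [|exact Hexp].
    unfold extremal_coef. rewrite exp_coef_0. f_equal. simpl. field.
  - apply noshiro_warschawski with (CS extremal_deriv_coef); [exact Hder|exact re_extremal_deriv_pos].
  - exists (fun z => (z * z)%C). split; [split; [|split]|].
    + intros z _. eexists. apply is_derive_of_cder.
      apply (cder_mult (fun w => w) (fun w => w)); apply cder_id.
    + ring.
    + intros z Hz. unfold unit_disk in Hz. rewrite Cmod_mult.
      assert (H0 := Cmod_ge_0 z). nra.
    + intros z Hz. unfold unit_disk in Hz.
      assert (Hexp' := has_expansion_C_derive _ _ Hexp).
      rewrite (C_derive_cder _ _ _ (cder_of_expansion _ _ z Hexp' Hz)).
      rewrite (C_derive_cder _ _ _ (Hder z Hz)).
      rewrite (CS_ext (dcoef (dcoef extremal_coef)) (dcoef extremal_deriv_coef))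
        by (intros n; unfold dcoef at 1 3; now rewrite dcoef_extremal_coef).
      unfold extremal_deriv_coef at 1.
      rewrite (exp_coef_series_ode psi_coef z psi_coef_0 rad1_psi_coef rad1_extremal_deriv_coef Hz).
      rewrite psi_series by exact Hz.
      change (fun n => RtoC (exp_coef psi_coef n)) with extremal_deriv_coef.
      assert (Hp := re_extremal_deriv_pos z Hz).
      field. intros E. rewrite E, re_RtoC in Hp. lra.
Qed.

(** Here a2 = p_1 / 2 = 0, so the determinant is - a3^2; and 2 p_2 = psi_2 p_0 = 2/PI gives a3 = p_2
    / 3 = 1/(3 PI). *)
Lemma extremal_hankel : Cmod (hankel22 extremal_coef) = 1 / (9 * PI ^ 2).
Proof.
  assert (HP := PI_RGT_0).
  assert (E1 : exp_coef psi_coef 1 = 0).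
  { assert (E := exp_coef_rec psi_coef 1 psi_coef_0). simpl in E.
    rewrite psi_coef_0, psi_coef_1 in E. lra. }
  assert (E2 : exp_coef psi_coef 2 = / PI).
  { assert (E := exp_coef_rec psi_coef 2 psi_coef_0). simpl in E.
    assert (E3 : psi_coef 2 = 2 * / PI) by (unfold psi_coef; simpl; field; lra).
    rewrite psi_coef_0, psi_coef_1, exp_coef_0, E3 in E. lra. }
  unfold hankel22, extremal_coef. rewrite E1, E2.
  replace (0 / INR 2) with 0 by (simpl; field).
  replace (/ PI / INR 3) with (/ (3 * PI)) by (simpl; field; lra).
  rewrite Cmult_0_l, <- RtoC_mult, <- RtoC_minus, Cmod_R.
  replace (0 - / (3 * PI) * / (3 * PI)) with (- (1 / (9 * PI ^ 2))) by (field; lra).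
  rewrite Rabs_Ropp, Rabs_pos_eq; [reflexivity|].
  apply Rdiv_le_0_compat; [lra|]. nra.
Qed.

Theorem theorem3p6 :
  (forall (f : C -> C) (a : nat -> C),
      class_C_arcsin f -> normalized_expansion f a ->
      Cmod (hankel22 a) <= 1 / (9 * PI ^ 2)) /\
  (exists (f : C -> C) (a : nat -> C),
      class_C_arcsin f /\ normalized_expansion f a /\
      Cmod (hankel22 a) = 1 / (9 * PI ^ 2)).
Proof.
  split; [exact hankel_upper_bound|].
  exists (CS extremal_coef), extremal_coef.
  split; [exact extremal_in_class|]. split; [|exact extremal_hankel].
  split; [reflexivity|]. split; [|apply CS_expansion, rad1_extremal_coef].
  unfold extremal_coef. rewrite exp_coef_0. f_equal. simpl. field.
Qed.
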